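(* Let $q\ge 2$ be an integer and $k$ a positive integer. Assume the Generalized Riemann Hypothesis. Then for every $\varepsilon>0$, \[\sum_{\substack{\chi\bmod q,\ \chi\neq\chi_0\\ \chi(-1)=1}}\frac{1}{|L(1,\chi)|^{2k}}=\frac{C(k)}{2}\,\varphi(q)\prod_{p\mid q}\left(1+\frac{\binom{k}{1}^2}{p^2}+\dots+\frac{\binom{k}{k}^2}{p^{2k}}\right)^{-1}\left(1+O\!\left(q^{-1+\varepsilon}\right)\right),\] where the sum runs over the non-principal even Dirichlet characters modulo $q$ and \[C(k)=\prod_p\left(1+\frac{\binom{k}{1}^2}{p^2}+\dots+\frac{\binom{k}{k}^2}{p^{2k}}\right),\] the products being over primes $p$.
   Context: $\chi_0$ is the principal character modulo $q$, $L(s,\chi)$ the Dirichlet $L$-function, $\varphi$ Euler's totient function. GRH asserts all nontrivial zeros of all Dirichlet $L$-functions have real part $1/2$. The implied constant may depend on $k$ and $\varepsilon$. *)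

(* Defs.v *)
From HB Require Import structures.
From mathcomp Require Import all_boot all_order all_algebra.
From mathcomp Require Import all_classical all_reals all_analysis.
From mathcomp Require Import complex.
Set Implicit Arguments. Unset Strict Implicit. Unset Printing Implicit Defensive.
Import Order.TTheory GRing.Theory Num.Theory.
Import numFieldNormedType.Exports.
Local Open Scope ring_scope.
Local Open Scope classical_set_scope.

(** The complex numbers R[i] (R real closed) carry the standard topology and
    normed-module structure of a numeric field, exactly as in the library's
    numFieldNormedType instances for numeric fields (via the regular alias ^o). *)
Set Warnings "-redundant-canonical-projection".
HB.instance Definition _ (R : rcfType) := PseudoPointedMetric.copy R[i] (R[i])^o.
HB.instance Definition _ (R : rcfType) := GRing.ComAlgebra.copy R[i] (R[i])^o.
HB.instance Definition _ (R : rcfType) := Vector.copy R[i] (R[i])^o.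
HB.instance Definition _ (R : rcfType) := NormedModule.copy R[i] (R[i])^o.

Section Dirichlet.
Variable R : realType.
Local Notation C := R[i].

Definition is_dchar (m : nat) (chi : nat -> C) : Prop :=
  [/\ forall n, chi (n + m)%N = chi n,
      forall a b, chi (a * b)%N = chi a * chi b,
      chi 1%N = 1 &
      forall n, (chi n != 0) = coprime n m].

Definition principal_char (m : nat) : nat -> C :=
  fun n => if coprime n m then 1 else 0.

(** Even character: chi(-1) = 1, i.e. chi(m-1) = 1 (by periodicity). *)
Definition is_even_char (m : nat) (chi : nat -> C) : Prop := chi (m - 1)%N = 1.

Definition npow_neg (n : nat) (s : C) : C :=
  let a := complex.Re s in let b := complex.Im s in
  Complex (expR (- a * ln n%:R) * cos (b * ln n%:R))
          (- (expR (- a * ln n%:R) * sin (b * ln n%:R))).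

(** L(s, chi) := sum_{n >= 1} chi(n) n^{-s}, as the limit of partial sums
    (this converges for Re s > 0 when chi is non-principal). *)
Definition Lfun (chi : nat -> C) (s : C) : C :=
  lim (series (fun n => chi n.+1 * npow_neg n.+1 s) @ \oo).

(** Dirichlet eta function eta(s) = sum_{n>=1} (-1)^{n-1} n^{-s}, converging
    for Re s > 0; zeta(s) = eta(s) / (1 - 2^{1-s}). *)
Definition eta_fun (s : C) : C :=
  lim (series (fun n => (-1) ^+ n * npow_neg n.+1 s) @ \oo).

(** Generalized Riemann Hypothesis: every zero in the critical strip
    0 < Re s < 1 of every Dirichlet L-function has real part 1/2.
    For principal characters chi_0 mod m, L(s,chi_0) = zeta(s) prod_{p|m}(1-p^{-s})
    and the finite product has no zeros in the open strip, so the condition is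
    the Riemann hypothesis, stated through eta (1 - 2^{1-s} has no zeros in the
    open strip either). For non-principal characters L is given by the
    (convergent) Dirichlet series in the strip. *)
Definition GRH : Prop :=
  (forall s : C, 0 < complex.Re s < 1 -> eta_fun s = 0 -> complex.Re s = 2^-1) /\
  (forall (m : nat) (chi : nat -> C), (0 < m)%N -> is_dchar m chi ->
     chi <> principal_char m ->
     forall s : C, 0 < complex.Re s < 1 -> Lfun chi s = 0 -> complex.Re s = 2^-1).

Definition local_factor (k p : nat) : R :=
  \sum_(0 <= j < k.+1) ('C(k, j) ^ 2)%:R / (p%:R ^+ (2 * j)).

Definition Ck (k : nat) : R :=
  lim ((fun N : nat => \prod_(0 <= p < N | prime p) local_factor k p) @ \oo).

(** Left-hand side: sum of 1/|L(1,chi)|^{2k} over non-principal even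
    characters mod q (a finite set of functions). *)
Definition even_nonprincipal_chars (q : nat) : set (nat -> C) :=
  [set chi | is_dchar q chi /\ chi <> principal_char q /\ is_even_char q chi].

Definition inv_moment_sum (q k : nat) : R :=
  \sum_(chi \in even_nonprincipal_chars q)
     (Normc.normc (Lfun chi 1) ^+ (2 * k))^-1.

Definition main_term (q k : nat) : R :=
  Ck k / 2 * (totient q)%:R * \prod_(p <- primes q) (local_factor k p)^-1.

End Dirichlet.

(* Main.v *)
(** Put s = 2 - z and f(z) = L(2 - z, chi) = sum_j c_j z^j, a power series with radius of
    convergence at least 7/4 for non-principal chi.  Under GRH and by Landau's theorem on the line
    Re s = 1, f has no zeros in |z| <= 5/4.  Truncations of f are then polynomials without zeros
    in that disc; a discrete Borel-Caratheodory argument (averages of log |.| over roots of unity)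
    bounds the power sums of their inverse roots by a multiple of log q, and Newton's identities
    turn this into a bound q^{O(1)} (8/9)^j for the coefficients of 1/f.  Hence L(1, chi)^{-k} is, up to a
    negligible error, a sum over n of mu_k(n) chi(n) with the coefficients mu_k of zeta^{-k} and a
    weight which is at most 1/n and decays slightly faster than 1/n, once O(log q) Taylor terms
    are kept.  Orthogonality over even characters leaves the pairs m = n, which give the Euler
    product, and the pairs m = +-n mod q with m <> n, which contribute O(q^{-1+eps}) relative to
    the main term; the principal character contributes O(q^eps). *)

Require Import Defs.
From HB Require Import structures.
From mathcomp Require Import all_boot all_order all_algebra.
From mathcomp Require Import all_classical all_reals all_analysis.
From mathcomp Require Import complex.
From mathcomp Require Import separable cyclotomic cyclic.
From mathcomp Require Import all_fingroup all_field classfun character.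
From mathcomp Require Import ring lra zify.
Set Implicit Arguments. Unset Strict Implicit. Unset Printing Implicit Defensive.
Import Order.TTheory GRing.Theory Num.Theory.
Import numFieldNormedType.Exports.
Local Open Scope ring_scope.
Local Open Scope complex_scope.

(** * Complex norm, limits and absolutely convergent series *)

(** The argument works on coefficient sequences: products of Dirichlet series become Cauchy products
    of Taylor coefficients at s = 2, and no contour integral or complex logarithm occurs. The radii
    in z are nested: 1 (the point s = 1) < 17/16 (summation of the k-th power) < 9/8 (coefficients
    of 1/L) < 5/4 (zero-free disc, where Re s >= 3/4) < 3/2 (s = 1/2 in Landau's argument) < 7/4
    (convergence of L by Abel summation) < 2. The line Re s = 1 needs its own argument because the
    hypothesis speaks of the open strip, and a zero on that line could lie in the disc. Two rates
    compete in the number J of Taylor terms. The error q^{O(1)} (16/17)^J asks for J of order log q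
    with a large constant, while the bound rho^{-J} n^{rho-2} for the weight asks that rho^{-J} stay
    below a small power of q. Both are met because the constant in J is fixed first, in terms of k
    alone, and rho < 1 is then taken close to 1. The exponent rho - 2 < -1 makes the sums over n and
    over residue classes converge absolutely. *)

Section ComplexNorm.
Variable R : realType.
Local Notation C := R[i].
Local Notation nm := (@Normc.normc R).
Implicit Types (x y z : C).

Lemma nmE x : ((nm x)%:C : C) = `|x|.
Proof. by rewrite normc_def; case: x. Qed.

Lemma nm_le x y : (nm x <= nm y) = (`|x| <= `|y|).
Proof. by rewrite -!nmE lecR. Qed.

Lemma nm_ge0 x : 0 <= nm x.
Proof. by rewrite -lecR nmE normr_ge0. Qed.

Lemma nm0 : nm 0 = 0. Proof. exact: Normc.normc0. Qed.
Lemma nm1 : nm 1 = 1. Proof. exact: Normc.normc1. Qed.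
Lemma nmM x y : nm (x * y) = nm x * nm y. Proof. exact: Normc.normcM. Qed.
Lemma nmV x : nm x^-1 = (nm x)^-1. Proof. exact: Normc.normcV. Qed.
Lemma nmD x y : nm (x + y) <= nm x + nm y. Proof. exact: le_normcD. Qed.
Lemma nmN x : nm (- x) = nm x. Proof. exact: normcN. Qed.
Lemma nmB x y : nm (x - y) <= nm x + nm y.
Proof. by rewrite -(nmN y); exact: nmD. Qed.
Lemma nmBC x y : nm (x - y) = nm (y - x).
Proof. by rewrite -nmN opprB. Qed.
Lemma nmBD z x y : nm (x - y) <= nm (x - z) + nm (z - y).
Proof. by apply: le_trans (nmD _ _); rewrite addrA subrK. Qed.
Lemma nm_eq0 x : (nm x == 0) = (x == 0).
Proof. by apply/eqP/eqP => [/Normc.eq0_normc //|->]; exact: nm0. Qed.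
Lemma nm_gt0 x : (0 < nm x) = (x != 0).
Proof. by rewrite lt_neqAle nm_ge0 andbT eq_sym nm_eq0. Qed.
Lemma nmX x n : nm (x ^+ n) = nm x ^+ n.
Proof. by elim: n => [|n IH]; rewrite ?expr0 ?nm1 // !exprS nmM IH. Qed.
Lemma nm_sum I (r : seq I) (P : pred I) (F : I -> C) :
  nm (\sum_(i <- r | P i) F i) <= \sum_(i <- r | P i) nm (F i).
Proof.
elim/big_rec2: _ => [|i y x _ h]; first by rewrite nm0.
by apply: le_trans (nmD _ _) _; rewrite lerD2l.
Qed.
Lemma nm_prod I (r : seq I) (P : pred I) (F : I -> C) :
  nm (\prod_(i <- r | P i) F i) = \prod_(i <- r | P i) nm (F i).
Proof. by apply: (big_morph nm nmM nm1). Qed.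
Lemma nm_real (a : R) : nm a%:C = `|a|.
Proof. by rewrite /= expr0n /= addr0 sqrtr_sqr. Qed.
Lemma nm_nat n : nm n%:R = n%:R.
Proof. by rewrite -(rmorph_nat (real_complex R)) nm_real ger0_norm. Qed.
Lemma nm_conj x : nm x^* = nm x.
Proof. by case: x => a b; rewrite /= sqrrN. Qed.
Lemma nm_Re x : `|complex.Re x| <= nm x.
Proof.
case: x => a b /=; rewrite -sqrtr_sqr; apply: ler_wsqrtr.
by rewrite lerDl sqr_ge0.
Qed.
Lemma nm_Im x : `|complex.Im x| <= nm x.
Proof.
case: x => a b /=; rewrite -sqrtr_sqr; apply: ler_wsqrtr.
by rewrite lerDr sqr_ge0.
Qed.
Lemma nm_ReIm x : nm x <= `|complex.Re x| + `|complex.Im x|.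
Proof.
rewrite {1}[x]complexE; apply: le_trans (nmD _ _) _.
rewrite nmM !nm_real (_ : nm 'i = 1) ?mul1r //.
by rewrite /= expr0n expr1n add0r sqrtr1.
Qed.
Lemma nm_i : nm 'i = 1.
Proof. by rewrite /Normc.normc /= expr0n expr1n add0r sqrtr1. Qed.
Lemma nm_sqr x : (nm x ^+ 2)%:C = x * x^*.
Proof. by rewrite rmorphXn /= nmE sqr_normc. Qed.
Lemma ler_nmB x y : nm x - nm y <= nm (x - y).
Proof. by rewrite lerBlDr -{1}(subrK y x) nmD. Qed.
Lemma Re_sum I (r : seq I) (P : pred I) (F : I -> C) :
  complex.Re (\sum_(i <- r | P i) F i) = \sum_(i <- r | P i) complex.Re (F i).
Proof. by apply: (big_morph (@complex.Re R)) => // -[? ?] [? ?]. Qed.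
Lemma Im_sum I (r : seq I) (P : pred I) (F : I -> C) :
  complex.Im (\sum_(i <- r | P i) F i) = \sum_(i <- r | P i) complex.Im (F i).
Proof. by apply: (big_morph (@complex.Im R)) => // -[? ?] [? ?]. Qed.
Lemma ReD x y : complex.Re (x + y) = complex.Re x + complex.Re y.
Proof. by case: x; case: y. Qed.
Lemma ReN x : complex.Re (- x) = - complex.Re x.
Proof. by case: x. Qed.
Lemma ReB x y : complex.Re (x - y) = complex.Re x - complex.Re y.
Proof. by rewrite ReD ReN. Qed.
Lemma ReZ (a : R) x : complex.Re (a%:C * x) = a * complex.Re x.
Proof. by case: x => u v /=; rewrite mul0r subr0. Qed.

Lemma ImB x y : complex.Im (x - y) = complex.Im x - complex.Im y.
Proof. by case: x; case: y. Qed.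
Lemma ImZ (a : R) x : complex.Im (a%:C * x) = a * complex.Im x.
Proof. by case: x => u v /=; rewrite mul0r addr0. Qed.
Lemma nm_sqrE x : nm x ^+ 2 = complex.Re x ^+ 2 + complex.Im x ^+ 2.
Proof. by case: x => u v; rewrite sqr_sqrtr //= addr_ge0 ?sqr_ge0. Qed.

End ComplexNorm.

Arguments Normc.normc : simpl never.

Section Limits.
Variable R : realType.
Local Notation C := R[i].
Local Notation nm := (@Normc.normc R).

(** Convergence is measured by the real-valued norm, so that estimates take place in [R]; [clim_lim]
    and [rlim_clim] translate to the filter limits of the statement. *)
Definition clim (u : nat -> C) (l : C) : Prop :=
  forall e : R, 0 < e -> exists N, forall n, (N <= n)%N -> nm (u n - l) < e.

Lemma clim_cst l : clim (fun=> l) l.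
Proof. by move=> e e0; exists 0%N => n _; rewrite subrr nm0. Qed.

Lemma eq_clim u v l : u =1 v -> clim u l -> clim v l.
Proof. by move=> uv h e /h [N hN]; exists N => n /hN; rewrite uv. Qed.

Lemma climW u l (B : R) : (forall e : R, 0 < e -> exists N, forall n, (N <= n)%N ->
  nm (u n - l) <= B * e) -> clim u l.
Proof.
move=> h e e0; have B1 : 0 < `|B| + 1 by apply: ltr_wpDl.
have [N hN] := h (e / (`|B| + 1)) (divr_gt0 e0 B1).
exists N => n /hN /le_lt_trans; apply.
rewrite mulrA ltr_pdivrMr // mulrC ltr_pM2l //.
by apply: le_lt_trans (ler_norm _) _; rewrite ltrDl.
Qed.

Lemma climD u v a b : clim u a -> clim v b -> clim (fun n => u n + v n) (a + b).
Proof.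
move=> ha hb; apply: (@climW _ _ 2) => e e0.
have [N1 h1] := ha e e0; have [N2 h2] := hb e e0.
exists (maxn N1 N2) => n; rewrite geq_max => /andP[/h1 {}h1 /h2 {}h2].
rewrite opprD addrACA; apply: le_trans (nmD _ _) _; lra.
Qed.

Lemma climZ u a c : clim u a -> clim (fun n => c * u n) (c * a).
Proof.
move=> ha; apply: (@climW _ _ (nm c)) => e e0.
have [N1 h1] := ha e e0; exists N1 => n /h1 h.
by rewrite -mulrBr nmM ler_wpM2l ?nm_ge0 ?ltW.
Qed.

Lemma climN u a : clim u a -> clim (fun n => - u n) (- a).
Proof. by move=> h e /h [N hN]; exists N => n /hN; rewrite -opprD nmN. Qed.

Lemma climB u v a b : clim u a -> clim v b -> clim (fun n => u n - v n) (a - b).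
Proof. by move=> ha /climN; exact: climD. Qed.

Lemma clim_bounded u l : clim u l -> exists2 N, True & forall n, (N <= n)%N -> nm (u n) <= nm l + 1.
Proof.
move=> /(_ 1 ltr01) [N h]; exists N => // n /h {}h.
by have := ler_nmB (u n) l; lra.
Qed.

Lemma climM u v a b : clim u a -> clim v b -> clim (fun n => u n * v n) (a * b).
Proof.
move=> ha hb; have [N0 _ h0] := clim_bounded ha.
apply: (@climW _ _ (nm a + 1 + nm b)) => e e0.
have [N1 h1] := ha e e0; have [N2 h2] := hb e e0.
exists (maxn N0 (maxn N1 N2)) => n; rewrite !geq_max => /and3P[/h0 {}h0 /h1 {}h1 /h2 {}h2].
have -> : u n * v n - a * b = u n * (v n - b) + (u n - a) * b by ring.
apply: le_trans (nmD _ _) _; rewrite !nmM mulrDl; apply: lerD.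
  by apply: ler_pM; rewrite ?nm_ge0 // ltW.
by rewrite mulrC; apply: ler_wpM2l; rewrite ?nm_ge0 // ltW.
Qed.

Lemma clim_sum I (r : seq I) (u : I -> nat -> C) (a : I -> C) :
  (forall i, clim (u i) (a i)) -> clim (fun n => \sum_(i <- r) u i n) (\sum_(i <- r) a i).
Proof.
move=> h; elim: r => [|i r IH].
  by rewrite big_nil; apply: eq_clim (clim_cst 0) => n; rewrite big_nil.
rewrite big_cons; apply: eq_clim (climD (h i) IH) => n.
by rewrite big_cons.
Qed.

Lemma clim_uniq u a b : clim u a -> clim u b -> a = b.
Proof.
move=> ha hb; apply/eqP; rewrite -subr_eq0 -nm_eq0.
apply/negPn/negP => h; have [e [e0 he]] : exists e : R, 0 < e /\ nm (a - b) = 2 * e.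
  exists (nm (a - b) / 2); split; last by rewrite mulrC divfK // pnatr_eq0.
  by rewrite divr_gt0 // lt_neqAle nm_ge0 eq_sym h.
have [N1 h1] := ha _ e0; have [N2 h2] := hb _ e0.
have := nmBD (u (maxn N1 N2)) a b; rewrite [nm (a - u _)]nmBC he.
by have := h1 (maxn N1 N2) (leq_maxl _ _); have := h2 (maxn N1 N2) (leq_maxr _ _); lra.
Qed.

Lemma clim_shift u a : clim u a -> clim (fun n => u n.+1) a.
Proof. by move=> h e /h [N hN]; exists N => n hn; apply: hN; exact: leqW. Qed.

Lemma clim_le u a (B : R) N : clim u a -> (forall n, (N <= n)%N -> nm (u n) <= B) -> nm a <= B.
Proof.
move=> h hB; rewrite leNgt; apply/negP => hlt.
have [M hM] := h (nm a - B) ltac:(lra).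
have := hM (maxn M N) (leq_maxl _ _); have := hB (maxn M N) (leq_maxr _ _).
by have := ler_nmB a (u (maxn M N)); rewrite nmBC; lra.
Qed.

Lemma clim_Re_le u a (B : R) N : clim u a ->
  (forall n, (N <= n)%N -> complex.Re (u n) <= B) -> complex.Re a <= B.
Proof.
move=> h hB; rewrite leNgt; apply/negP => hlt.
have [M hM] := h (complex.Re a - B) ltac:(lra).
have := hM (maxn M N) (leq_maxl _ _); have := hB (maxn M N) (leq_maxr _ _).
have := nm_Re (u (maxn M N) - a); rewrite ReB ler_norml => /andP[]; lra.
Qed.

Lemma clim_Re_ge u a (B : R) N : clim u a ->
  (forall n, (N <= n)%N -> B <= complex.Re (u n)) -> B <= complex.Re a.
Proof.
move=> /climN h hB; rewrite -lerN2 -ReN; apply: (clim_Re_le (N := N) h) => n /hB.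
by rewrite ReN lerN2.
Qed.

Lemma clim_conj u a : clim u a -> clim (fun n => (u n)^*) a^*.
Proof. by move=> h e /h [N hN]; exists N => n /hN; rewrite -rmorphB nm_conj. Qed.

Lemma clim_cvg (u : nat -> C) l : clim u l -> (u @ \oo --> l)%classic.
Proof.
move=> h; apply/(@cvgrPdist_lt _ C) => -[e e'].
rewrite ltcE /= => /andP[/eqP e'0 e0]; have [N hN] := h e e0.
exists N => // n /= /hN hn.
by rewrite distrC -nmE ltcE /= e'0 eqxx.
Qed.

Lemma clim_lim (u : nat -> C) l : clim u l -> (lim (u @ \oo) = l)%classic.
Proof. by move=> /clim_cvg h; apply: (@cvg_lim C) => //; exact: norm_hausdorff. Qed.

Lemma clim_of_Re_Im (u : nat -> C) (a b : R) :
  ((fun n => complex.Re (u n)) @ \oo --> a)%classic ->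
  ((fun n => complex.Im (u n)) @ \oo --> b)%classic -> clim u (a +i* b).
Proof.
move=> /cvgrPdist_lt ha /cvgrPdist_lt hb; apply: (@climW _ _ 2) => e e0.
have [N1 _ h1] := ha e e0; have [N2 _ h2] := hb e e0.
exists (maxn N1 N2) => n; rewrite geq_max => /andP[/h1 {}h1 /h2 {}h2].
apply: le_trans (nm_ReIm _) _.
move: h1 h2; case: (u n) => x y /=; rewrite [`|a - x|]distrC [`|b - y|]distrC; lra.
Qed.

Lemma rlim_clim (u : nat -> R) (a : R) :
  (u @ \oo --> a)%classic <-> clim (fun n => (u n)%:C) a%:C.
Proof.
split=> [/cvgrPdist_lt h e e0|h].
  have [N _ hN] := h e e0; exists N => n /hN.
  by rewrite -rmorphB nm_real distrC.
apply/cvgrPdist_lt => e e0; have [N hN] := h e e0; exists N => // n /= /hN.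
by rewrite -rmorphB nm_real distrC.
Qed.

End Limits.

Section Summable.
Variable R : realType.
Local Notation C := R[i].
Local Notation nm := (@Normc.normc R).

Lemma sum_ord_split (V : nmodType) (F : nat -> V) M N : (M <= N)%N ->
  \sum_(i < N) F i = \sum_(i < M) F i + \sum_(M <= i < N) F i.
Proof. by move=> MN; rewrite -!(big_mkord xpredT) (big_cat_nat _ MN). Qed.

Lemma partial_sum_le (b : nat -> R) M N : (forall n, 0 <= b n) -> (M <= N)%N ->
  \sum_(i < M) b i <= \sum_(i < N) b i.
Proof.
move=> b0 MN; rewrite (sum_ord_split _ MN).
by rewrite lerDl sumr_ge0.
Qed.

Lemma tail_small (b : nat -> R) (B : R) : (forall n, 0 <= b n) ->
  (forall N, \sum_(n < N) b n <= B) -> forall e, 0 < e ->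
  exists M, forall N, \sum_(M <= n < N) b n < e.
Proof.
move=> b0 hB e e0; pose E := [set x : R | exists N, x = \sum_(n < N) b n]%classic.
have hE : has_sup E.
  split; first by exists 0; exists 0%N; rewrite big_ord0.
  by exists B => x [N ->].
have [_ [M ->] hM] := sup_adherent e0 hE.
exists M => N; case: (leqP M N) => MN; last by rewrite big_geq // ltnW.
have : \sum_(n < N) b n <= sup E by apply: ub_le_sup; [case: hE|exists N].
rewrite (sum_ord_split _ MN); lra.
Qed.

Definition summable_by (u : nat -> C) (B : R) := forall N, \sum_(n < N) nm (u n) <= B.
Definition summable (u : nat -> C) := exists B, summable_by u B.

(** Total thanks to the default 0, so that terms can be rewritten under [ssum] before convergence is
    known; [summable_clim] gives its meaning for absolutely convergent series. *)
Definition ssum (u : nat -> C) : C := xget 0 [set l | clim (fun N => \sum_(n < N) u n) l]%classic.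

Lemma ssumE (u : nat -> C) l : clim (fun N => \sum_(n < N) u n) l -> ssum u = l.
Proof.
by move=> h; apply: xget_unique => // y hy; exact: clim_uniq hy h.
Qed.

Lemma real_summable_cvg (a : nat -> R) (B : R) :
  (forall N, \sum_(n < N) `|a n| <= B) -> cvgn (series a).
Proof.
move=> hB; apply: (@normed_cvg R R^o).
apply: nondecreasing_is_cvgn.
  by apply: nondecreasing_series => n _ _; exact: normr_ge0.
by exists B => _ [N _ <-] /=; have := hB N; rewrite -(big_mkord xpredT (fun n => `|a n|)).
Qed.

Lemma summable_clim u : summable u -> clim (fun N => \sum_(n < N) u n) (ssum u).
Proof.
move=> [B hB].
have h1 : cvgn (series (fun n => complex.Re (u n))).
  apply: (@real_summable_cvg _ B) => N; apply: le_trans (hB N).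
  by apply: ler_sum => i _; exact: nm_Re.
have h2 : cvgn (series (fun n => complex.Im (u n))).
  apply: (@real_summable_cvg _ B) => N; apply: le_trans (hB N).
  by apply: ler_sum => i _; exact: nm_Im.
have h : clim (fun N => \sum_(n < N) u n)
   (limn (series (fun n => complex.Re (u n))) +i* limn (series (fun n => complex.Im (u n)))).
  apply: clim_of_Re_Im.
    rewrite (_ : (fun _ => _) = series (fun n => complex.Re (u n))) //.
    by apply/funext => N; rewrite /series /= big_mkord Re_sum.
  rewrite (_ : (fun _ => _) = series (fun n => complex.Im (u n))) //.
  by apply/funext => N; rewrite /series /= big_mkord Im_sum.
by rewrite (ssumE h).
Qed.

Lemma eq_ssum u v : u =1 v -> ssum u = ssum v.
Proof. by move=> /funext ->. Qed.

Lemma summable_by_ge0 u B : summable_by u B -> 0 <= B.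
Proof. by move=> /(_ 0%N); rewrite big_ord0. Qed.

Lemma nm_ssum u B : summable_by u B -> nm (ssum u) <= B.
Proof.
move=> h; apply: (clim_le (N := 0%N) (summable_clim _)); first by exists B.
by move=> n _; apply: le_trans (nm_sum _ _ _) _; exact: h.
Qed.

Lemma summable_byW u v B : (forall n, nm (u n) <= nm (v n)) -> summable_by v B -> summable_by u B.
Proof. by move=> h hB N; apply: le_trans (hB N); apply: ler_sum. Qed.

Lemma summableW u v : (forall n, nm (u n) <= nm (v n)) -> summable v -> summable u.
Proof. by move=> h [B hB]; exists B; exact: summable_byW hB. Qed.

Lemma summableD u v : summable u -> summable v -> summable (fun n => u n + v n).
Proof.
move=> [A hA] [B hB]; exists (A + B) => N; apply: le_trans (lerD (hA N) (hB N)).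
by rewrite -big_split /=; apply: ler_sum => i _; exact: nmD.
Qed.

Lemma summable_byZ c u B : summable_by u B -> summable_by (fun n => c * u n) (nm c * B).
Proof.
move=> hA N; under eq_bigr do rewrite nmM.
by rewrite -mulr_sumr ler_wpM2l ?nm_ge0.
Qed.

Lemma summableZ c u : summable u -> summable (fun n => c * u n).
Proof. by move=> [A hA]; exists (nm c * A); exact: summable_byZ. Qed.

Lemma summableN u : summable u -> summable (fun n => - u n).
Proof. by apply: summableW => n; rewrite nmN. Qed.

Lemma ssumD u v : summable u -> summable v -> ssum (fun n => u n + v n) = ssum u + ssum v.
Proof.
move=> hu hv; apply: ssumE; apply: eq_clim (climD (summable_clim hu) (summable_clim hv)) => N.
by rewrite big_split.
Qed.

Lemma ssumZ c u : summable u -> ssum (fun n => c * u n) = c * ssum u.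
Proof.
move=> hu; apply: ssumE; apply: eq_clim (climZ c (summable_clim hu)) => N.
by rewrite mulr_sumr.
Qed.

Lemma ssumN u : summable u -> ssum (fun n => - u n) = - ssum u.
Proof.
move=> hu; apply: ssumE; apply: eq_clim (climN (summable_clim hu)) => N.
by rewrite sumrN.
Qed.

Lemma ssumB u v : summable u -> summable v -> ssum (fun n => u n - v n) = ssum u - ssum v.
Proof. by move=> hu hv; rewrite ssumD ?ssumN //; exact: summableN. Qed.

Lemma ssum_conj u : summable u -> ssum (fun n => (u n)^*) = (ssum u)^*.
Proof.
move=> hu; apply: ssumE; apply: eq_clim (clim_conj (summable_clim hu)) => N.
by rewrite rmorph_sum.
Qed.

Lemma summable_sum I (r : seq I) (u : I -> nat -> C) :
  (forall i, summable (u i)) -> summable (fun n => \sum_(i <- r) u i n).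
Proof.
move=> h; elim: r => [|i r IH].
  by exists 0 => N; rewrite big1 // => n _; rewrite big_nil nm0.
by apply: summableW (summableD (h i) IH) => n; rewrite big_cons.
Qed.

Lemma ssum_sum I (r : seq I) (u : I -> nat -> C) :
  (forall i, summable (u i)) -> ssum (fun n => \sum_(i <- r) u i n) = \sum_(i <- r) ssum (u i).
Proof.
move=> h; apply: ssumE; apply: eq_clim (clim_sum r (fun i => summable_clim (h i))) => N.
by rewrite exchange_big.
Qed.

Lemma ssum_finite u K : (forall n, (K <= n)%N -> u n = 0) -> ssum u = \sum_(n < K) u n.
Proof.
move=> h; apply: ssumE => e e0; exists K => n Kn.
rewrite (sum_ord_split _ Kn).
by rewrite [\sum_(K <= i < n) _]big_nat (big1 _ (fun i => K <= i < n)%N) ?addr0 ?subrr ?nm0 // => i /andP[/h].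
Qed.

Lemma ssum_tail u B K : summable u -> (forall N, \sum_(K <= n < N) nm (u n) <= B) ->
  nm (ssum u - \sum_(n < K) u n) <= B.
Proof.
move=> hs h.
apply: (clim_le (N := K) (climB (summable_clim hs) (clim_cst (\sum_(n < K) u n)))) => N KN.
rewrite (sum_ord_split _ KN).
rewrite addrAC subrr add0r; exact: le_trans (nm_sum _ _ _) (h N).
Qed.

(** Cauchy products and Dirichlet convolutions are both sums over regions [P N] that eventually
    contain every square. A discarded pair has [i >= M1] or [j >= M2], so the discarded part is at
    most a tail of one series times the bound of the other, in both ways. *)
Lemma prod_rect (a b : nat -> C) (P : nat -> nat -> nat -> bool) :
  summable a -> summable b ->
  (forall M, exists N0, forall N i j, (N0 <= N)%N -> (i < M)%N -> (j < M)%N -> P N i j) ->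
  clim (fun N => \sum_(i < N) \sum_(j < N | P N i j) a i * b j) (ssum a * ssum b).
Proof.
move=> ha hb hP.
have [A hA] := ha; have [B hB] := hb.
have A0 := summable_by_ge0 hA; have B0 := summable_by_ge0 hB.
have h1 := climM (summable_clim ha) (summable_clim hb).
suff h2 : clim (fun N => (\sum_(i < N) a i) * (\sum_(j < N) b j)
     - \sum_(i < N) \sum_(j < N | P N i j) a i * b j) 0.
  have := climB h1 h2; rewrite subr0; apply: eq_clim => N.
  by rewrite opprB addrC subrK.
apply: (@climW _ _ _ (A + B)) => e e0.
have [M1 hM1] := tail_small (fun n => nm_ge0 (a n)) hA e0.
have [M2 hM2] := tail_small (fun n => nm_ge0 (b n)) hB e0.
have [N0 hN0] := hP (maxn M1 M2).
exists N0 => N NN; rewrite subr0 big_distrlr -sumrB /=.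
pose T := \sum_(i < N) \sum_(j < N) (nm (a i) * (nm (b j) * (M2 <= j)%:R) +
   nm (a i) * (M1 <= i)%:R * nm (b j)).
apply: (@le_trans _ _ T).
  apply: le_trans (nm_sum _ _ _) _; apply: ler_sum => i _.
  rewrite [X in X - _](bigID (fun j : 'I_N => P N i j)) /= addrAC subrr add0r.
  apply: le_trans (nm_sum _ _ _) _; rewrite big_mkcond; apply: ler_sum => j _.
  case: ifP => [nP|_]; last by rewrite addr_ge0 ?mulr_ge0 ?nm_ge0.
  have : (M2 <= j)%N || (M1 <= i)%N.
    apply/negPn/negP; rewrite negb_or -!ltnNge => /andP[h3 h4].
    by move/negP: nP; apply; apply: hN0 => //; rewrite leq_max ?h3 ?h4 ?orbT.
  rewrite nmM => /orP[->|->]; rewrite mulr1.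
    by rewrite lerDl !mulr_ge0 ?nm_ge0.
  by rewrite lerDr !mulr_ge0 ?nm_ge0.
have -> : T = (\sum_(i < N) nm (a i)) * (\sum_(M2 <= j < N) nm (b j)) +
   (\sum_(M1 <= j < N) nm (a j)) * \sum_(j < N) nm (b j).
  rewrite !big_geq_mkord.
  rewrite [X in _ * X + _]big_mkcond /= [X in _ + X * _]big_mkcond /= !big_distrlr -big_split /=.
  apply: eq_bigr => i _; rewrite -big_split /=; apply: eq_bigr => j _.
  by case: ifP => _; case: ifP => _; rewrite ?mulr1 ?mulr0 ?mul0r.
have s0 (I : Type) (r : seq I) (F : I -> C) : 0 <= \sum_(i <- r) nm (F i).
  by apply: sumr_ge0 => *; exact: nm_ge0.
rewrite mulrDl; apply: lerD.
  by apply: ler_pM => //; exact: ltW.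
by rewrite mulrC; apply: ler_pM => //; exact: ltW.
Qed.

(** Dominated convergence: the common majorant makes all tails beyond some [M] small at once, and
    the first [M] terms converge. *)
Lemma tannery (v : nat -> nat -> C) (c : nat -> C) (b : nat -> R) (B : R) :
  (forall N j, nm (v N j) <= b j) -> (forall n, \sum_(j < n) b j <= B) ->
  (forall j, clim (fun N => v N j) (c j)) ->
  summable_by c B /\ clim (fun N => ssum (v N)) (ssum c).
Proof.
move=> hv hb hc.
have b0 j : 0 <= b j by apply: le_trans (hv 0%N j); exact: nm_ge0.
have hcb j : nm (c j) <= b j by apply: (clim_le (N := 0%N) (hc j)).
have cB : summable_by c B by move=> N; apply: le_trans (hb N); apply: ler_sum.
split => //; have cs : summable c by exists B.
have vB N : summable_by (v N) B by move=> n; apply: le_trans (hb n); apply: ler_sum.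
have vs N : summable (v N) by exists B.
apply: (@climW _ _ _ 3) => e e0.
have [M hM] := tail_small b0 hb e0.
have [N1 hN1] := clim_sum (index_enum 'I_M) (fun j : 'I_M => hc j) e0.
exists N1 => n /hN1 hn.
have tl w : summable w -> (forall j, nm (w j) <= b j) -> nm (ssum w - \sum_(j < M) w j) <= e.
  move=> hw hwb; apply: (ssum_tail hw) => N; apply: ltW.
  by apply: le_lt_trans (hM N); apply: ler_sum.
have h1 := tl _ (vs n) (hv n); have h2 := tl _ cs hcb.
have := nmBD (\sum_(j < M) v n j) (ssum (v n)) (ssum c).
have := nmBD (\sum_(j < M) c j) (\sum_(j < M) v n j) (ssum c).
move: h2; rewrite nmBC; lra.
Qed.

End Summable.

(** * Power series and Dirichlet convolution *)

Section PowerSeries.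
Variable R : realType.
Local Notation C := R[i].
Local Notation nm := (@Normc.normc R).

Lemma sum_antidiag (V : nmodType) (F : nat -> nat -> V) N :
  \sum_(n < N) \sum_(i < n.+1) F i (n - i)%N = \sum_(i < N) \sum_(j < N | (i + j < N)%N) F i j.
Proof.
transitivity (\sum_(n < N) \sum_(i < N | (i <= n)%N) F i (n - i)%N).
  apply: eq_bigr => n _.
  by rewrite (big_ord_widen N (fun i => F i (n - i)%N)) //= .
rewrite (exchange_big_dep xpredT) //=; apply: eq_bigr => i _.
rewrite -(big_geq_mkord _ _ xpredT (fun n => F i (n - i)%N)).
rewrite -{1}(add0n (i : nat)) big_addn.
under eq_bigr do rewrite addnK.
rewrite big_mkord (big_ord_widen N (fun j => F i j)) ?leq_subr //.
by apply: eq_bigl => j; rewrite ltn_subRL.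
Qed.

Definition cprod (a b : nat -> C) (n : nat) : C := \sum_(i < n.+1) a i * b (n - i)%N.

(** The coefficient of index [n] only sees indices below [m], so the ring laws of Cauchy products
    are inherited from polynomials. *)
Lemma cprod_poly a b n m : (n < m)%N ->
  cprod a b n = ((\poly_(i < m) a i) * (\poly_(i < m) b i))`_n.
Proof.
move=> nm0; rewrite coefM; apply: eq_bigr => i _.
by rewrite !coef_poly (leq_ltn_trans _ nm0) ?leq_ord // (leq_ltn_trans _ nm0) // leq_subr.
Qed.

Lemma eq_cprod a b a' b' : a =1 a' -> b =1 b' -> cprod a b =1 cprod a' b'.
Proof. by move=> /funext -> /funext ->. Qed.

Lemma cprodC a b : cprod a b =1 cprod b a.
Proof. by move=> n; rewrite !(@cprod_poly _ _ n n.+1) // mulrC. Qed.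

Lemma cprodA a b c : cprod a (cprod b c) =1 cprod (cprod a b) c.
Proof.
move=> n; rewrite !(@cprod_poly _ _ n n.+1) //.
have tr u v (w : {poly C}) : (\poly_(i < n.+1) cprod u v i * w)`_n =
    ((\poly_(i < n.+1) u i * \poly_(i < n.+1) v i) * w)`_n.
  rewrite !coefM; apply: eq_bigr => i _; rewrite coef_poly ltn_ord.
  by rewrite (@cprod_poly _ _ i n.+1).
by rewrite mulrC tr tr mulrC mulrA.
Qed.

Lemma cprodDl a b c n : cprod (fun i => a i + b i) c n = cprod a c n + cprod b c n.
Proof. by rewrite -big_split; apply: eq_bigr => i _; rewrite mulrDl. Qed.

Lemma cprod1 a : cprod (fun n => (n == 0)%N%:R) a =1 a.
Proof.
move=> n; rewrite /cprod big_ord_recl /= mul1r subn0 big1 ?addr0 // => i _.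
by rewrite mul0r.
Qed.

Lemma cprod_scale a b z n :
  cprod (fun i => a i * z ^+ i) (fun i => b i * z ^+ i) n = cprod a b n * z ^+ n.
Proof.
rewrite mulr_suml; apply: eq_bigr => i _.
by rewrite mulrACA -exprD subnKC // leq_ord.
Qed.

Lemma summable_cprod a b A B : summable_by a A -> summable_by b B ->
  summable_by (cprod a b) (A * B).
Proof.
move=> hA hB N; apply: (@le_trans _ _ (\sum_(n < N) \sum_(i < n.+1) nm (a i) * nm (b (n - i)%N))).
  apply: ler_sum => n _; apply: le_trans (nm_sum _ _ _) _.
  by apply: ler_sum => i _; rewrite nmM.
rewrite (sum_antidiag (fun i j => nm (a i) * nm (b j))).
apply: (@le_trans _ _ (\sum_(i < N) \sum_(j < N) nm (a i) * nm (b j))).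
  apply: ler_sum => i _; rewrite [leRHS](bigID (fun j : 'I_N => (i + j < N)%N)) /=.
  by rewrite lerDl sumr_ge0 // => j _; rewrite mulr_ge0 ?nm_ge0.
rewrite -big_distrlr /=; apply: ler_pM; [| |exact: hA|exact: hB];
  by apply: sumr_ge0 => *; exact: nm_ge0.
Qed.

Lemma ssum_cprod a b : summable a -> summable b -> ssum (cprod a b) = ssum a * ssum b.
Proof.
move=> ha hb; apply: ssumE.
apply: (eq_clim _ (@prod_rect R a b (fun N i j => i + j < N)%N ha hb _)).
  by move=> N; rewrite -(sum_antidiag (fun i j => a i * b j)).
by move=> M; exists (M + M)%N => N i j hN hi hj; lia.
Qed.

Definition pseval (c : nat -> C) (z : C) : C := ssum (fun n => c n * z ^+ n).

Lemma pseval_cprod a b z : summable (fun n => a n * z ^+ n) -> summable (fun n => b n * z ^+ n) ->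
  summable (fun n => cprod a b n * z ^+ n) /\ pseval (cprod a b) z = pseval a z * pseval b z.
Proof.
move=> ha hb; have [A hA] := ha; have [B hB] := hb; split.
  by exists (A * B); have := summable_cprod hA hB; apply: summable_byW => n; rewrite cprod_scale.
rewrite -ssum_cprod //; apply: eq_ssum => n; by rewrite cprod_scale.
Qed.

End PowerSeries.

(** * The complex exponential as a power series *)

Section ComplexExp.
Variable R : realType.
Local Notation C := R[i].
Local Notation nm := (@Normc.normc R).

Lemma exp_term_sum_le (x : R) N : 0 <= x -> \sum_(n < N) x ^+ n / n`!%:R <= expR x.
Proof.
move=> x0.
have := @nondecreasing_cvgn_le R (series (exp_coeff x)) _ (is_cvg_series_exp_coeff x) N.
rewrite /series /= big_mkord; apply.
apply: nondecreasing_series => n _ _; exact: exp_coeff_ge0.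
Qed.

Lemma exp_term_le (x : R) n : 0 <= x -> x ^+ n / n`!%:R <= expR x.
Proof.
move=> x0; apply: le_trans (exp_term_sum_le n.+1 x0).
rewrite big_ord_recr /= lerDr; apply: sumr_ge0 => i _.
by rewrite divr_ge0 ?exprn_ge0.
Qed.

Definition expc (z : C) : C :=
  (expR (complex.Re z) * cos (complex.Im z)) +i* (expR (complex.Re z) * sin (complex.Im z)).

Definition exp_terms (z : C) (n : nat) : C := z ^+ n / n`!%:R.

Lemma summable_exp_terms z : summable_by (exp_terms z) (expR (nm z)).
Proof.
move=> N; under eq_bigr do rewrite nmM nmX nmV nm_nat.
by apply: exp_term_sum_le; exact: nm_ge0.
Qed.

Lemma exp_term_add (F : numFieldType) (x y : F) n :
  (x + y) ^+ n / n`!%:R = \sum_(i < n.+1) (x ^+ i / i`!%:R) * (y ^+ (n - i) / (n - i)`!%:R).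
Proof.
rewrite exprDn mulr_suml.
rewrite (reindex_inj rev_ord_inj) /=; apply: eq_bigr => i _; rewrite subSS.
have h : 'C(n, n - i)%:R / n`!%:R = (i`!%:R)^-1 * ((n - i)`!%:R)^-1 :> F.
  have hi := leq_ord i; have nz m : m`!%:R != 0 :> F by rewrite pnatr_eq0 -lt0n fact_gt0.
  rewrite bin_sub // -(bin_fact hi) !natrM; field.
  rewrite !nz /= pnatr_eq0 -lt0n bin_gt0 hi //.
have e (u d : F) c : (u *+ c) / d = u * (c%:R / d) by rewrite mulrA -[u *+ c]mulr_natr.
by rewrite subKn ?leq_ord // e h; ring.
Qed.

Lemma exp_termsD x y : exp_terms (x + y) =1 cprod (exp_terms x) (exp_terms y).
Proof. by move=> n; exact: exp_term_add. Qed.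

Lemma ssum_exp_termsD x y : ssum (exp_terms (x + y)) = ssum (exp_terms x) * ssum (exp_terms y).
Proof.
rewrite -ssum_cprod; first by apply: eq_ssum; exact: exp_termsD.
  by exists (expR (nm x)); exact: summable_exp_terms.
by exists (expR (nm y)); exact: summable_exp_terms.
Qed.

Lemma imagX n : ('i : C) ^+ n =
  ((~~ odd n)%:R * (-1) ^+ n./2) +i* ((odd n)%:R * (-1) ^+ n.-1./2).
Proof.
elim: n => [|n IH]; first by rewrite expr0 /= mul1r mul0r.
rewrite exprSr IH; apply/eqP; rewrite eq_complex /= !mulr0 !mulr1 sub0r addr0; apply/eqP.
rewrite eqxx andbT negbK; case: n {IH} => [|n] /=; first by rewrite !mul0r oppr0 eqxx.
by rewrite exprS mulN1r mulrN eqxx.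
Qed.

Lemma ssum_exp_terms z : ssum (exp_terms z) = expc z.
Proof.
rewrite {1}[z]complexE ssum_exp_termsD.
have -> : ssum (exp_terms (complex.Re z)%:C) = (expR (complex.Re z))%:C.
  apply: ssumE; have /rlim_clim := is_cvg_series_exp_coeff (complex.Re z).
  apply: eq_clim => N; rewrite /series /= big_mkord rmorph_sum; apply: eq_bigr => n _.
  by rewrite /exp_terms /exp_coeff rmorphM fmorphV rmorph_nat rmorphXn.
have -> : ssum (exp_terms ('i * (complex.Im z)%:C)) = cos (complex.Im z) +i* sin (complex.Im z).
  set b := complex.Im z.
  have ib n : exp_terms ('i * b%:C) n = cos_coeff b n +i* sin_coeff b n.
    rewrite /exp_terms exprMn imagX -rmorphXn -(rmorph_nat (real_complex R)) -fmorphV /=.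
    rewrite -mulrA -rmorphM /cos_coeff /sin_coeff /=; apply/eqP; rewrite eq_complex /=.
    by rewrite -!exprnP !mulr0 subr0 add0r !mulrA !eqxx.
  apply: ssumE; apply: clim_of_Re_Im.

    have := @is_cvg_series_cos_coeff R b.
    rewrite (_ : (fun _ => _) = series (cos_coeff b)); first by rewrite cos.unlock.
    by apply/funext => N; rewrite /series /= big_mkord Re_sum; apply: eq_bigr => n _; rewrite ib.
  have := @is_cvg_series_sin_coeff R b.
  rewrite (_ : (fun _ => _) = series (sin_coeff b)); first by rewrite sin.unlock.
  by apply/funext => N; rewrite /series /= big_mkord Im_sum; apply: eq_bigr => n _; rewrite ib.
case: z => a b /=; rewrite /expc /=; congr Complex; ring.
Qed.

End ComplexExp.

(** * Dirichlet convolution of absolutely convergent series *)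

Section DirichletConv.
Variable R : realType.
Local Notation C := R[i].
Local Notation nm := (@Normc.normc R).

Definition dconv (V : pzRingType) (a b : nat -> V) (n : nat) : V :=
  \sum_(d <- divisors n) a d * b (n %/ d)%N.

Lemma sum_divisors (V : nmodType) (F : nat -> nat -> V) n N : (0 < n < N)%N ->
  \sum_(d <- divisors n) F d (n %/ d)%N = \sum_(i < N) \sum_(j < N | (i * j == n)%N) F i j.
Proof.
move=> /andP[n0 nN].
transitivity (\sum_(i < N | (i %| n)%N) F i (n %/ i)%N).
  rewrite -(big_mkord (fun i => i %| n)%N (fun i => F i (n %/ i)%N)) -big_filter.
  apply: perm_big; apply: uniq_perm; rewrite ?divisors_uniq ?filter_uniq ?iota_uniq //.
  move=> d; rewrite mem_filter mem_index_iota -dvdn_divisors //=.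
  by case: (boolP (d %| n)%N) => // /(dvdn_leq n0) h; rewrite (leq_ltn_trans h nN).
rewrite big_mkcond; apply: eq_bigr => i _; case: ifP => h; last first.
  rewrite big1 // => j /eqP e; move: h; by rewrite -e dvdn_mulr.
have i0 : (0 < i)%N by apply: dvdn_gt0 h.
have hlt : (n %/ i < N)%N by apply: leq_ltn_trans nN; exact: leq_div.
rewrite (big_pred1 (Ordinal hlt)) // => j /=.
apply/eqP/eqP => [e|->]; last by rewrite /= mulnC divnK.
by apply: val_inj => /=; rewrite -e mulKn.
Qed.

(** [divisors 0] is the list with the single element 1, so the index [n = 0] contributes [F 1 0];
    the hypothesis removes this term. *)
Lemma sum_hyperbola (V : nmodType) (F : nat -> nat -> V) N : F 1%N 0%N = 0 ->
  \sum_(n < N) \sum_(d <- divisors n) F d (n %/ d)%N =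
  \sum_(i < N) \sum_(j < N | (0 < i * j < N)%N) F i j.
Proof.
move=> F0; transitivity (\sum_(n < N | (0 < n)%N) \sum_(i < N) \sum_(j < N | (i * j == n)%N) F i j).
  rewrite [RHS]big_mkcond; apply: eq_bigr => n _; case: posnP => [->|n0].
    by rewrite big_seq1 div0n.
  by apply: sum_divisors; rewrite n0 ltn_ord.
rewrite exchange_big; apply: eq_bigr => i _ /=.
rewrite (exchange_big_dep xpredT) //= [RHS]big_mkcond; apply: eq_bigr => j _.
case: ifP => [/andP[h1 h2]|h].
  rewrite (big_pred1 (Ordinal h2)) // => n /=.
  apply/andP/eqP => [[_ /eqP e]|->]; first exact: val_inj.
  by rewrite /= eqxx h1.
rewrite big1 // => n /andP[n0 /eqP e]; move: h; by rewrite e n0 ltn_ord.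
Qed.

Lemma summable_dconv (a b : nat -> C) A B : b 0%N = 0 -> summable_by a A -> summable_by b B ->
  summable_by (dconv a b) (A * B).
Proof.
move=> b0 hA hB N; apply: (@le_trans _ _ (\sum_(n < N) \sum_(d <- divisors n) nm (a d) * nm (b (n %/ d)%N))).
  apply: ler_sum => n _; apply: le_trans (nm_sum _ _ _) _.
  by apply: ler_sum => i _; rewrite nmM.
rewrite (sum_hyperbola (F := fun i j => nm (a i) * nm (b j))); last by rewrite b0 nm0 mulr0.
apply: (@le_trans _ _ (\sum_(i < N) \sum_(j < N) nm (a i) * nm (b j))).
  apply: ler_sum => i _; rewrite [leRHS](bigID (fun j : 'I_N => (0 < i * j < N)%N)) /=.
  by rewrite lerDl sumr_ge0 // => j _; rewrite mulr_ge0 ?nm_ge0.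
rewrite -big_distrlr /=; apply: ler_pM; [| |exact: hA|exact: hB];
  by apply: sumr_ge0 => *; exact: nm_ge0.
Qed.

Lemma ssum_dconv (a b : nat -> C) : a 0%N = 0 -> b 0%N = 0 ->
  summable a -> summable b -> ssum (dconv a b) = ssum a * ssum b.
Proof.
move=> a0 b0 ha hb; apply: ssumE.
apply: (eq_clim _ (@prod_rect R a b (fun N i j => (i * j < N)%N) ha hb _)).
  move=> N; rewrite (sum_hyperbola (F := fun i j => a i * b j)) ?b0 ?mulr0 //.
  apply: eq_bigr => i _; rewrite big_mkcond [RHS]big_mkcond.
  apply: eq_bigr => j _; case: (posnP (i * j)) => //= h; rewrite h /=.
  case: ifP => // _; move/eqP: h; rewrite muln_eq0.
  by case/orP => /eqP ->; rewrite ?a0 ?b0 ?mul0r ?mulr0.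
move=> M; exists (M * M).+1 => N i j hN hi hj; apply: leq_trans hN; rewrite ltnS.
by apply: leq_mul; exact: ltnW.
Qed.

End DirichletConv.

(** * Taylor coefficients of Dirichlet series at s = 2 *)

Section RealEstimates.
Variable R : realType.

Lemma geom_sum_le (x : R) n : 0 <= x < 1 -> \sum_(j < n) x ^+ j <= (1 - x)^-1.
Proof.
move=> /andP[x0 x1]; have h : 0 < 1 - x by lra.
rewrite -[_^-1]mul1r ler_pdivlMr // mulrC.
have -> : (1 - x) * \sum_(j < n) x ^+ j = 1 - x ^+ n.
  by rewrite -[RHS]opprB subrX1 -mulNr opprB.
by rewrite gerBl exprn_ge0.
Qed.

Lemma ln_succ_diff (n : nat) : (0 < n)%N ->
  n.+1%:R^-1 <= ln (n.+1%:R : R) - ln n%:R <= n%:R^-1.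
Proof.
move=> n0; have n0' : 0 < n%:R :> R by rewrite ltr0n.
have n1' : 0 < n.+1%:R :> R by rewrite ltr0n.
rewrite -ln_div ?posrE //; apply/andP; split; last first.
  have -> : n.+1%:R / n%:R = 1 + n%:R^-1 :> R.
    by rewrite -natr1 mulrDl divff ?gt_eqF // mul1r.
  by apply: le_ln1Dx; apply: lt_trans (_ : 0 < _); rewrite ?ltrN10 ?invr_gt0.
rewrite -[X in _ <= X]opprK -lnV ?posrE ?divr_gt0 // invf_div lerNr.
have -> : n%:R / n.+1%:R = 1 + - n.+1%:R^-1 :> R.
  by rewrite -[n%:R](addrK 1) natr1 mulrDl divff ?gt_eqF // mulNr mul1r.
apply: le_ln1Dx; rewrite ltrN2 invf_lt1 //.
by rewrite ltr1n ltnS.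
Qed.

(* The junk value [powR 0 x = 0] removes the term n = 0 from such sums. *)
Lemma sum_powR_le (eta : R) N : 0 < eta ->
  \sum_(n < N) powR n%:R (- (1 + eta)) <= 1 + eta^-1.
Proof.
move=> e0.
have p0 : powR (0 : R) (- (1 + eta)) = 0.
  by rewrite powR0 // oppr_eq0 gt_eqF // addr_gt0.
have ge0 : 0 <= 1 + eta^-1 by rewrite addr_ge0 // invr_ge0 ltW.
case: N => [|N]; first by rewrite big_ord0.
rewrite big_ord_recl p0 add0r /=.
(* For n >= 1, (n+1)^{-1-eta} is at most eta^{-1} (n^{-eta} - (n+1)^{-eta}), so the sum telescopes.
   For [N = 0] the correction vanishes since [powR 0 (- eta) = 0]. *)
suff h : \sum_(i < N) powR (bump 0 i)%:R (- (1 + eta)) <= 1 + eta^-1 - eta^-1 * powR N%:R (- eta).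
  by apply: le_trans h _; rewrite gerBl mulr_ge0 ?powR_ge0 // invr_ge0 ltW.
elim: N => [|N IH].
  rewrite big_ord0 powR0 ?oppr_eq0 ?gt_eqF // mulr0 subr0 //.
rewrite big_ord_recr /= /bump leq0n add1n.
case: N IH => [|n] IH.
  by rewrite big_ord0 add0r !powR1 mulr1 addrK.
apply: le_trans (lerD IH (lexx _)) _; rewrite -lerBrDl.
set p := powR n.+1%:R _; set p' := powR n.+2%:R (- eta).
have -> : powR n.+2%:R (- (1 + eta)) = n.+2%:R^-1 * p' :> R.
  by rewrite opprD powRD ?pnatr_eq0 ?implybT // powR_inv1.
have -> : p = p' * expR (eta * (ln n.+2%:R - ln n.+1%:R)).
  rewrite /p /p' /powR !pnatr_eq0 /= -expRD; congr expR; ring.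
have h2 : 0 <= p' by exact: powR_ge0.
have /andP[h3 _] := @ln_succ_diff n.+1 isT.
have h4 := expR_ge1Dx (eta * (ln n.+2%:R - ln n.+1%:R)).
have h5 : eta * n.+2%:R^-1 <= expR (eta * (ln n.+2%:R - ln n.+1%:R)) - 1.
  by apply: le_trans (_ : eta * (ln n.+2%:R - ln n.+1%:R) <= _); [rewrite ler_wpM2l // ltW|lra].
have h6 := ler_wpM2l h2 h5.
have h7 : 0 <= eta^-1 by rewrite invr_ge0 ltW.
have := ler_wpM2l h7 h6.
have -> : eta^-1 * (p' * (eta / n.+2%:R)) = n.+2%:R^-1 * p'.
  by rewrite mulrCA mulKf ?gt_eqF // mulrC.
rewrite [p' * (_ - 1)]mulrBr mulr1 mulrBr; move: (n.+2%:R^-1 * p') (eta^-1 * (p' * _)) => A E; lra.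
Qed.

End RealEstimates.

Section Weights.
Variable R : realType.
Local Notation C := R[i].
Local Notation nm := (@Normc.normc R).

(* Taylor coefficients in z of n^{-(2 - z)}; at n = 0 the junk values make them vanish. *)
Definition wj (j n : nat) : R := n%:R^-1 ^+ 2 * ((ln n%:R) ^+ j / j`!%:R).

Lemma wj_0 j : wj j 0 = 0.
Proof. by rewrite /wj invr0 expr0n mul0r. Qed.

Lemma ln_nat_ge0 n : 0 <= ln (n%:R : R).
Proof. by case: n => [|n]; [rewrite ln0|rewrite ln_ge0 // ler1n]. Qed.

Lemma wj_ge0 j n : 0 <= wj j n.
Proof. by rewrite /wj mulr_ge0 ?divr_ge0 ?exprn_ge0 ?invr_ge0 ?ln_nat_ge0. Qed.

Lemma powR_expR (n : nat) (a : R) : (0 < n)%N -> powR n%:R a = expR (a * ln n%:R).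
Proof. by rewrite /powR pnatr_eq0; case: n. Qed.

Lemma sqr_natV (n : nat) : (0 < n)%N -> n%:R^-1 ^+ 2 = expR (- 2 * ln n%:R) :> R.
Proof.
move=> n0; rewrite mulNr expRN expRM_natl lnK ?posrE ?ltr0n //.
by rewrite exprVn.
Qed.

(** For n > 0 the left side is n^{-2} times a partial sum of the exponential series of r ln n.
    Different values of the radius [r] give all the later size bounds for the weights. *)
Lemma wj_sum_le (r : R) M n : 0 <= r -> \sum_(j < M) r ^+ j * wj j n <= powR n%:R (r - 2).
Proof.
move=> r0; case: n => [|n]; first by rewrite big1 ?powR_ge0 // => j _; rewrite wj_0 mulr0.
rewrite powR_expR // mulrBl expRD -mulNr -sqr_natV // mulrC.
have -> : \sum_(j < M) r ^+ j * wj j n.+1 =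
    n.+1%:R^-1 ^+ 2 * \sum_(j < M) (r * ln n.+1%:R) ^+ j / j`!%:R.
  by rewrite mulr_sumr; apply: eq_bigr => j _; rewrite /wj [(r * _) ^+ j]exprMn mulrCA -!mulrA.
apply: ler_wpM2l; first by rewrite exprn_ge0 // invr_ge0.
by apply: exp_term_sum_le; rewrite mulr_ge0 // ln_nat_ge0.
Qed.

Lemma wj_le (r : R) j n : 0 <= r -> r ^+ j * wj j n <= powR n%:R (r - 2).
Proof.
move=> r0; apply: le_trans (wj_sum_le j.+1 n r0); rewrite big_ord_recr /= lerDr.
by apply: sumr_ge0 => i _; rewrite mulr_ge0 ?exprn_ge0 ?wj_ge0.
Qed.

(** Binomial expansion of (ln m + ln n)^j. This is why Taylor coefficients turn Dirichlet
    convolution into a Cauchy product in [T_dconv]. *)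
Lemma wjM j m n : wj j (m * n) = \sum_(i < j.+1) wj i m * wj (j - i) n.
Proof.
case: m => [|m]; first by rewrite mul0n wj_0 big1 // => i _; rewrite wj_0 mul0r.
case: n => [|n]; first by rewrite muln0 wj_0 big1 // => i _; rewrite wj_0 mulr0.
rewrite /wj natrM lnM ?posrE ?ltr0n // exp_term_add invfM exprMn mulr_sumr.
by apply: eq_bigr => i _; rewrite mulrACA.
Qed.

Definition wt (n : nat) : R := powR n%:R (- (3 / 2)).

(* Absolute convergence of the Dirichlet series of [a] at s = 3/2. *)
Definition nice (a : nat -> C) := summable (fun n => a n * (wt n)%:C).

(** The j-th Taylor coefficient at z = 0 of the Dirichlet series of [a] at s = 2 - z. For [nice a]
    the series converges absolutely by [wj_wt], which is radius 1/2. *)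
Definition T (a : nat -> C) (j : nat) : C := ssum (fun n => a n * (wj j n)%:C).

Lemma wt_ge0 n : 0 <= wt n. Proof. exact: powR_ge0. Qed.

Lemma wt_0 : wt 0 = 0.
Proof. by rewrite /wt powR0 // oppr_eq0 mulf_neq0. Qed.

Lemma wj_wt j n : wj j n <= 2 ^+ j * wt n.
Proof.
have h : (0 : R) <= 1/2 by [].
have := wj_le j n h; rewrite (_ : 1 / 2 - 2 = - (3 / 2) :> R); last by field.
move=> /(ler_wpM2l (exprn_ge0 j (ler0n R 2))); rewrite mulrA -exprMn.
by rewrite mul1r divff ?pnatr_eq0 // expr1n mul1r.
Qed.

Lemma summable_T a j : nice a -> summable (fun n => a n * (wj j n)%:C).
Proof.
move=> /(summableZ (2 ^+ j)%:C); apply: summableW => n.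
rewrite !nmM !nm_real mulrCA; apply: ler_wpM2l; first exact: nm_ge0.
by rewrite !ger0_norm ?wj_ge0 ?wt_ge0 ?exprn_ge0 // wj_wt.
Qed.

Lemma nice_bounded a (B : R) : (forall n, nm (a n) <= B) -> nice a.
Proof.
move=> hB; have B0 : 0 <= B by apply: le_trans (nm_ge0 _) (hB 0%N).
have h : (0 : R) < 1/2 by [].
exists (B * (1 + (1/2)^-1)) => N.
apply: (le_trans _ (ler_wpM2l B0 (sum_powR_le N h))).
rewrite mulr_sumr; apply: ler_sum => n _; rewrite nmM nm_real ger0_norm ?wt_ge0 //.
rewrite /wt (_ : 3 / 2 = 1 + 1 / 2 :> R); last by field.
by apply: ler_wpM2r => //; exact: powR_ge0.
Qed.

Lemma wtM m n : wt (m * n) = wt m * wt n.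
Proof. by rewrite /wt natrM powRM. Qed.

Lemma nice_dconv a b : nice a -> nice b -> nice (dconv a b).
Proof.
move=> [A hA] [B hB]; exists (A * B).
have w0 : b 0%N * (wt 0)%:C = 0 by rewrite wt_0 mulr0.
apply: summable_byW (summable_dconv w0 hA hB) => n.
case: n => [|n]; first by rewrite wt_0 mulr0 nm0 nm_ge0.
rewrite le_eqVlt; apply/orP; left; apply/eqP; congr nm; rewrite /dconv mulr_suml !big_seq.
apply: eq_bigr => d; rewrite -dvdn_divisors // => hd.
by rewrite mulrACA -rmorphM -wtM mulnC divnK.
Qed.

Lemma T_dconv a b j : nice a -> nice b -> T (dconv a b) j = cprod (T a) (T b) j.
Proof.
move=> ha hb; rewrite /cprod /T.
under eq_bigr => i _.
  rewrite -ssum_dconv; [|by rewrite wj_0 mulr0|by rewrite wj_0 mulr0|exact: summable_T|exact: summable_T].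
  over.
rewrite -(ssum_sum (index_enum 'I_j.+1)); last first.
  move=> i; have [A hA] := summable_T i ha; have [B hB] := summable_T (j - i) hb.
  by exists (A * B); apply: summable_dconv => //; rewrite wj_0 mulr0.
apply: eq_ssum => n; rewrite /dconv exchange_big /= mulr_suml.
case: n => [|n].
  by rewrite !big_seq1 wj_0 mulr0 big1 // => i _; rewrite div0n wj_0 !mulr0.
rewrite !big_seq; apply: eq_bigr => d; rewrite -dvdn_divisors // => hd.
rewrite -{2}(divnK hd) mulnC wjM rmorph_sum mulr_sumr; apply: eq_bigr => i _.
by rewrite rmorphM mulrACA.
Qed.

End Weights.

(** * Abel summation and twists by n^{-it} *)

Section Abel.
Variable R : realType.
Local Notation C := R[i].
Local Notation nm := (@Normc.normc R).

Lemma abel_sum (a w : nat -> C) (B : R) N : (forall n, nm (\sum_(i < n) a i) <= B) ->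
  nm (\sum_(n < N) a n * w n) <= B * (\sum_(n < N) nm (w n - w n.+1) + nm (w N)).
Proof.
move=> hB; pose A n := \sum_(i < n) a i.
have -> : \sum_(n < N) a n * w n = \sum_(n < N) A n.+1 * (w n - w n.+1) + A N * w N.
  elim: N => [|N IH]; first by rewrite !big_ord0 /A big_ord0 mul0r addr0.
  rewrite !big_ord_recr /= IH {2}/A [in RHS]/A !big_ord_recr /= -/(A N); ring.
apply: le_trans (nmD _ _) _; rewrite mulrDr; apply: lerD.
  apply: le_trans (nm_sum _ _ _) _; rewrite mulr_sumr; apply: ler_sum => n _.
  by rewrite nmM; apply: ler_wpM2r; [exact: nm_ge0|exact: hB].
by rewrite nmM; apply: ler_wpM2r; [exact: nm_ge0|exact: hB].
Qed.

Lemma expcD (x y : C) : expc (x + y) = expc x * expc y.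
Proof. by rewrite -!ssum_exp_terms ssum_exp_termsD. Qed.

Lemma nm_expc (x : C) : nm (expc x) = expR (complex.Re x).
Proof.
rewrite /expc /Normc.normc !exprMn -mulrDr cos2Dsin2 mulr1 sqrtr_sqr ger0_norm // expR_ge0.
Qed.

Lemma expc0 : expc (0 : C) = 1.
Proof. by rewrite /expc /= expR0 cos0 sin0 mulr1 mulr0. Qed.

Lemma expc_real (x : R) : expc x%:C = (expR x)%:C.
Proof. by rewrite /expc /= cos0 sin0 mulr1 mulr0. Qed.

Lemma nm_expc_sub1 (x : C) : nm (expc x - 1) <= expR (nm x) - 1.
Proof.
rewrite -ssum_exp_terms.
have hs : summable (exp_terms x) by exists (expR (nm x)); exact: summable_exp_terms.
have et0 : exp_terms x 0 = 1 by rewrite /exp_terms expr0 fact0 divr1.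
have := @ssum_tail R (exp_terms x) (expR (nm x) - 1) 1 hs.
rewrite big_ord1 et0; apply => N.
case: N => [|N].
  by rewrite big_geq // subr_ge0 -expR0 ler_expR nm_ge0.
have := @summable_exp_terms R x N.+1; rewrite (sum_ord_split (fun n => nm (exp_terms x n)) (ltn0Sn N)) big_ord1.
by rewrite et0 nm1; lra.
Qed.

Lemma expR_sub1_le (x : R) : 0 <= x <= 1/2 -> expR x - 1 <= 2 * x.
Proof.
move=> /andP[x0 x1].
have h1 := expR_ge1Dx (- x).
have h2 : 0 < 1 - x by lra.
have : expR x <= (1 - x)^-1.
  by rewrite -[expR x]invrK -expRN lef_pV2 ?posrE ?expR_gt0.
move=> /le_trans h; rewrite lerBlDr; apply: h.
rewrite -[_^-1]mul1r ler_pdivrMr //.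
nra.
Qed.

Lemma nm_cis_sub (x y : R) : nm (expc ('i * x%:C) - expc ('i * y%:C)) <= 4 * `|x - y|.
Proof.
have ReI u : complex.Re ('i * u%:C) = 0 :> R by rewrite /= mul0r mulr0 subrr.
have -> : expc ('i * x%:C) - expc ('i * y%:C) = expc ('i * y%:C) * (expc ('i * (x - y)%:C) - 1).
  have e : 'i * x%:C = 'i * y%:C + 'i * (x - y)%:C :> C by rewrite -mulrDr -rmorphD addrC subrK.
  by rewrite e expcD mulrBr mulr1.
rewrite nmM nm_expc ReI expR0 mul1r.
have nI : nm ('i * (x - y)%:C) = `|x - y|.
  by rewrite nmM nm_real nm_i mul1r.
have n0 := normr_ge0 (x - y).
case: (lerP `|x - y| (1/2)) => h.
  apply: le_trans (nm_expc_sub1 _) _; rewrite nI.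
  have := @expR_sub1_le `|x - y|; rewrite n0 h => /(_ isT); lra.
by apply: le_trans (nmB _ _) _; rewrite nm_expc ReI expR0 nm1; lra.
Qed.

(** The twist n^{-it}: it moves the point 1 + it of the line Re s = 1 to s = 1. *)
Definition tw (t : R) (n : nat) : C := expc ('i * (- t * ln n%:R)%:C).

Lemma nm_tw t n : nm (tw t n) = 1.
Proof. by rewrite /tw nm_expc /= mul0r mulr0 subrr expR0. Qed.

Lemma tw_0 n : tw 0 n = 1.
Proof. by rewrite /tw oppr0 mul0r mulr0 expc0. Qed.

Lemma twM t m n : (0 < m)%N -> (0 < n)%N -> tw t (m * n) = tw t m * tw t n.
Proof.
move=> m0 n0; rewrite /tw -expcD -mulrDr -rmorphD /= natrM lnM ?posrE ?ltr0n //.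
by rewrite mulrDr.
Qed.

(* Any radius strictly between 3/2 and 2 serves: L(2 - z, chi) converges for |z| < 2 when chi is
   not principal, and Landau's argument needs z = 3/2. *)
Definition r0 : R := 7 / 4.

Lemma r0_gt0 : 0 < r0. Proof. by rewrite /r0; lra. Qed.

Lemma r0_ge0 : 0 <= r0. Proof. by rewrite /r0; lra. Qed.

Lemma pow_diff_le (x y : R) j : 0 <= x <= y ->
  y ^+ j / j`!%:R - x ^+ j / j`!%:R <= expR y * (y - x).
Proof.
move=> /andP[x0 xy]; have y0 := le_trans x0 xy.
case: j => [|j]; first by rewrite !expr0 subrr mulr_ge0 ?expR_ge0 // subr_ge0.
rewrite -mulrBl subrXX -mulrA [leRHS]mulrC; apply: ler_wpM2l; first by rewrite subr_ge0.
have hS : \sum_(i < j.+1) y ^+ (j.+1.-1 - i) * x ^+ i <= j.+1%:R * y ^+ j.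
  apply: (@le_trans _ _ (\sum_(i < j.+1) y ^+ j)); last by rewrite sumr_const card_ord mulr_natl.
  apply: ler_sum => i _; rewrite -[in leRHS](subnK (leq_ord i)) exprD; apply: ler_wpM2l.
    exact: exprn_ge0.
  by rewrite lerXn2r ?nnegrE.
apply: le_trans (exp_term_le j y0).
apply: le_trans (ler_wpM2r _ hS) _; first by rewrite invr_ge0.
by rewrite factS natrM invfM mulrACA divff ?mul1r // pnatr_eq0.
Qed.

(** Passing from n to n + 1 changes both n^{-2} and (r0 ln n)^j / j! by a relative amount O(1/n),
    measured against n^{-2} and e^{r0 ln n}. This gives n^{r0-3} = n^{-5/4}, uniformly in j. *)
Lemma wj_diff j n : (0 < n)%N ->
  r0 ^+ j * `|wj R j n - wj R j n.+1| <= 4 * powR n%:R (- (1 + 1/4)).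
Proof.
move=> n0; pose u : R := ln n%:R; pose v : R := ln n.+1%:R.
have u0 : 0 <= u := ln_nat_ge0 R n.
have n0' : 0 < n%:R :> R by rewrite ltr0n.
have uv : u <= v by rewrite ler_ln ?posrE ?ltr0n // ler_nat.
have duv : v - u <= n%:R^-1 by have /andP[] := ln_succ_diff R n0.
have rp := r0_ge0.
pose X := (r0 * u) ^+ j / j`!%:R; pose Y := (r0 * v) ^+ j / j`!%:R.
have hX0 : 0 <= X by rewrite divr_ge0 // exprn_ge0 // mulr_ge0.
have hX : X <= expR (r0 * u) by apply: exp_term_le; rewrite mulr_ge0.
have hXY : X <= Y.
  by rewrite ler_wpM2r ?invr_ge0 // lerXn2r ?nnegrE ?mulr_ge0 ?(le_trans u0 uv) // ler_wpM2l.
have hY : Y - X <= expR (r0 * v) * (r0 * v - r0 * u).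
  by apply: pow_diff_le; rewrite mulr_ge0 //= ler_wpM2l.
have eu : r0 ^+ j * wj R j n = expR (- 2 * u) * X .
  by rewrite /wj sqr_natV // mulrCA; congr (_ * _); rewrite /X [(r0 * u) ^+ j]exprMn mulrA.
have ev : r0 ^+ j * wj R j n.+1 = expR (- 2 * v) * Y
  by rewrite /wj sqr_natV // mulrCA; congr (_ * _); rewrite /Y [(r0 * v) ^+ j]exprMn mulrA.
have -> : r0 ^+ j * `|wj R j n - wj R j n.+1| = `|expR (- 2 * u) * X - expR (- 2 * v) * Y|.
  by rewrite -eu -ev -mulrBr normrM ger0_norm ?exprn_ge0.
have -> : powR n%:R (- (1 + 1 / 4)) = expR ((r0 - 2) * u) * n%:R^-1.
  rewrite opprD addrC powRD ?pnatr_eq0 -?lt0n ?n0 ?implybT // powR_inv1 ?ler0n //.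
  by rewrite powR_expR // (_ : r0 - 2 = - (1 / 4)) //; rewrite /r0; lra.
have e1 : expR (- 2 * u) - expR (- 2 * v) <= expR (- 2 * u) * (2 * (v - u)).
  have -> : - 2 * v = - 2 * u + (- 2 * (v - u)) by ring.
  rewrite expRD -{1}[expR (- 2 * u)]mulr1 -mulrBr; apply: ler_wpM2l; first exact: expR_ge0.
  by have := expR_ge1Dx (- 2 * (v - u)); lra.
have e2 : expR (- 2 * v) <= expR (- 2 * u) by rewrite ler_expR; lra.
have t1 : (expR (- 2 * u) - expR (- 2 * v)) * X <= expR ((r0 - 2) * u) * (2 * n%:R^-1).
  have -> : (r0 - 2) * u = - 2 * u + r0 * u by ring.
  rewrite expRD mulrAC; apply: ler_pM => //; first by lra.
  by apply: le_trans e1 _; apply: ler_wpM2l; [exact: expR_ge0|lra].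
have t2 : expR (- 2 * v) * (Y - X) <= expR ((r0 - 2) * u) * (2 * n%:R^-1).
  apply: le_trans (_ : expR ((r0 - 2) * v) * (r0 * v - r0 * u) <= _).
    have -> : (r0 - 2) * v = - 2 * v + r0 * v by ring.
    by rewrite expRD -mulrA ler_wpM2l ?expR_ge0.
  apply: ler_pM; [exact: expR_ge0|by rewrite subr_ge0 ler_wpM2l| |].
    by rewrite ler_expR /r0; lra.
  rewrite /r0; lra.
have -> : expR (-2 * u) * X - expR (-2 * v) * Y =
  (expR (-2 * u) - expR (-2 * v)) * X - expR (-2 * v) * (Y - X) by ring.
apply: le_trans (ler_normB _ _) _.
rewrite !ger0_norm; [|rewrite mulr_ge0 ?expR_ge0 //; lra|rewrite mulr_ge0 //; lra].
lra.
Qed.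

(** This is 1 + 5 (4 + 4 |t|) + 1: the sum of the n^{-5/4} is at most 5, and each 1 bounds an end
    term of the Abel summation, at index 0 and at index N. *)
Definition Ct (t : R) : R := 22 + 20 * `|t|.

Lemma Ct_ge0 t : 0 <= Ct t. Proof. by rewrite /Ct; have := normr_ge0 t; lra. Qed.

Lemma wj_r0 j n : r0 ^+ j * wj R j n.+1 <= 1.
Proof.
apply: le_trans (wj_le j n.+1 r0_ge0) _.
have h : (1 : R) <= n.+1%:R by rewrite ler1n.
by apply: le_trans (ler_powR (_ : 1 <= n.+1%:R) (_ : _ <= 0)) _; rewrite ?powRr0 // /r0; lra.
Qed.

(** Bounded partial sums of [a] replace absolute convergence. The bound is uniform in N and j, which
    puts the radius of convergence at least at [r0], beyond the radius 1 given by absolute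
    convergence of the Dirichlet series. *)
Lemma weighted_sum_bound (a : nat -> C) (B t : R) j N : (forall n, nm (\sum_(i < n) a i) <= B) ->
  nm (\sum_(n < N) a n * tw t n * (wj R j n)%:C) * r0 ^+ j <= B * Ct t.
Proof.
move=> hB; have B0 : 0 <= B by apply: le_trans (nm_ge0 _) (hB 0%N).
have rj : 0 <= r0 ^+ j by rewrite exprn_ge0 ?r0_ge0.
pose w n := tw t n * (wj R j n)%:C.
have nw n : nm (w n) = wj R j n by rewrite nmM nm_tw mul1r nm_real ger0_norm ?wj_ge0.
have hw1 n : nm (w n) * r0 ^+ j <= 1.
  by rewrite nw mulrC; case: n => [|n]; rewrite ?wj_0 ?mulr0 // wj_r0.
have hd n : (0 < n)%N -> nm (w n - w n.+1) * r0 ^+ j <= (4 + 4 * `|t|) * powR n%:R (- (1 + 1/4)).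
  move=> n0; have -> : w n - w n.+1 = tw t n * (wj R j n - wj R j n.+1)%:C
       + (tw t n - tw t n.+1) * (wj R j n.+1)%:C by rewrite /w rmorphB; ring.
  rewrite mulrC; apply: le_trans (ler_wpM2l rj (nmD _ _)) _.
  rewrite !nmM nm_tw mul1r !nm_real mulrDr [leRHS]mulrDl; apply: lerD; first exact: wj_diff.
  rewrite [`|wj _ _ _|]ger0_norm ?wj_ge0 // mulrCA.
  have h1 : nm (tw t n - tw t n.+1) <= 4 * `|t| * n%:R^-1.
    apply: le_trans (nm_cis_sub _ _) _; rewrite -mulrA; apply: ler_wpM2l => //.
    rewrite -mulrBr normrM normrN; apply: ler_wpM2l => //.
    have /andP[h1 h2] := ln_succ_diff R n0; rewrite distrC ger0_norm //.
    by apply: le_trans h1; rewrite invr_ge0.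
  have h2 : r0 ^+ j * wj R j n.+1 <= powR n%:R (- (1/4)).
    apply: le_trans (wj_le j n.+1 r0_ge0) _.
    rewrite !powR_expR // ler_expR (_ : r0 - 2 = - (1/4)); last by rewrite /r0; field.
    by rewrite !mulNr lerN2 ler_wpM2l // ler_ln ?posrE ?ltr0n // ler_nat.
  apply: le_trans (ler_pM _ _ h1 h2) _; [exact: nm_ge0|by rewrite mulr_ge0 ?wj_ge0|].
  rewrite opprD powRD ?pnatr_eq0 -?lt0n ?n0 ?implybT // powR_inv1 ?ler0n //.
  by rewrite !mulrA.
under eq_bigr do rewrite -mulrA -/(w _).
apply: le_trans (ler_wpM2r rj (abel_sum w N hB)) _.
rewrite -mulrA; apply: ler_wpM2l => //; rewrite mulrDl /Ct mulr_suml.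
apply: (@le_trans _ _ (1 + (4 + 4 * `|t|) * 5 + 1)); last by lra.
apply: lerD => //.
have h4 : (0 : R) < 1/4 by lra.
have t0 : 0 <= 4 + 4 * `|t| by have := normr_ge0 t; lra.
case: N => [|N]; first by rewrite big_ord0; lra.
rewrite big_ord_recl /=; apply: lerD.
  by rewrite (_ : w 0%N = 0) ?sub0r ?nmN ?hw1 // /w wj_0 mulr0.
have := ler_wpM2l t0 (sum_powR_le N.+1 h4).
rewrite (_ : 1 + (1/4)^-1 = 5 :> R); last by field.
apply: le_trans; rewrite big_ord_recl powR0 ?oppr_eq0 ?gt_eqF ?addr_gt0 // add0r mulr_sumr.
by apply: ler_sum => i _; rewrite /bump /= add1n; apply: hd.
Qed.

End Abel.

Section TwistedSeries.
Variable R : realType.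
Local Notation C := R[i].
Local Notation nm := (@Normc.normc R).
Local Notation r0 := (@r0 R).

Lemma geo_summable (c : nat -> C) (D r : R) (z : C) : 0 < r -> nm z < r ->
  (forall j, nm (c j) * r ^+ j <= D) ->
  summable_by (fun j => c j * z ^+ j) (D * (1 - nm z / r)^-1).
Proof.
move=> rp zr hD N; have D0 : 0 <= D.
  by apply: le_trans (hD 0%N); rewrite expr0 mulr1 nm_ge0.
have zr1 : 0 <= nm z / r < 1.
  by rewrite divr_ge0 ?nm_ge0 ?ltW //= ltr_pdivrMr // mul1r.
apply: le_trans (ler_wpM2l D0 (geom_sum_le N zr1)); rewrite mulr_sumr; apply: ler_sum => j _.
rewrite nmM nmX exprMn exprVn [_ ^+ j * _]mulrC mulrA.
apply: ler_wpM2r; first by rewrite exprn_ge0 ?nm_ge0.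
by rewrite ler_pdivlMr ?exprn_gt0.
Qed.

Lemma T_twist_bound (a : nat -> C) (B t : R) j : (forall n, nm (\sum_(i < n) a i) <= B) ->
  nice (fun n => a n * tw t n) -> nm (T (fun n => a n * tw t n) j) * r0 ^+ j <= B * Ct t.
Proof.
move=> hB hn; rewrite -ler_pdivlMr ?exprn_gt0 ?r0_gt0 //.
apply: (clim_le (N := 0%N) (summable_clim (summable_T j hn))) => N _.
by rewrite ler_pdivlMr ?exprn_gt0 ?r0_gt0 //; exact: weighted_sum_bound.
Qed.

(** The double series over n and j need not converge absolutely once [nm z >= 1].
    [weighted_sum_bound] provides a majorant in j that is uniform in N, so the sums are exchanged by
    [tannery]. *)
Lemma T_twist_pseval (a : nat -> C) (B t : R) (z : C) : (forall n, nm (\sum_(i < n) a i) <= B) ->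
  nice (fun n => a n * tw t n) -> nm z < r0 ->
  clim (fun N => \sum_(n < N) a n * tw t n * ((n%:R^-1 ^+ 2 : R)%:C * expc (z * (ln n%:R)%:C)))
       (pseval (T (fun n => a n * tw t n)) z).
Proof.
move=> hB hn hz.
pose v N j := (\sum_(n < N) a n * tw t n * (wj R j n)%:C) * z ^+ j.
have zr1 : 0 <= nm z / r0 < 1.
  by rewrite divr_ge0 ?nm_ge0 ?ltW ?r0_gt0 //= ltr_pdivrMr ?r0_gt0 // mul1r.
have B0 : 0 <= B * Ct t.
  by rewrite mulr_ge0 ?Ct_ge0 //; apply: le_trans (nm_ge0 _) (hB 0%N).
pose b j := B * Ct t * (nm z / r0) ^+ j.
have h1 N j : nm (v N j) <= b j.
  rewrite nmM nmX /b exprMn exprVn [_ ^+ j * _]mulrC mulrA.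
  apply: ler_wpM2r; first by rewrite exprn_ge0 ?nm_ge0.
  by rewrite ler_pdivlMr ?exprn_gt0 ?r0_gt0 //; exact: weighted_sum_bound.
have h2 N : \sum_(j < N) b j <= B * Ct t * (1 - nm z / r0)^-1.
  by rewrite -mulr_sumr ler_wpM2l // geom_sum_le.
have h3 j : clim (fun N => v N j) (T (fun n => a n * tw t n) j * z ^+ j).
  have := climZ (z ^+ j) (summable_clim (summable_T j hn)).
  by rewrite mulrC; apply: eq_clim => N; rewrite mulrC.
have [_] := tannery h1 h2 h3.
apply: eq_clim => N.
transitivity (ssum (fun j => \sum_(n < N)
    a n * tw t n * (n%:R^-1 ^+ 2 : R)%:C * exp_terms (z * (ln n%:R)%:C) j)).
  apply: eq_ssum => j; rewrite /v mulr_suml; apply: eq_bigr => n _.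
  have -> : (wj R j n)%:C = (n%:R^-1 ^+ 2 : R)%:C * ((ln n%:R : R)%:C ^+ j / j`!%:R) :> C.
    by rewrite /wj rmorphM /=; congr (_ * _); rewrite rmorphM fmorphV rmorph_nat rmorphXn.
  by rewrite /exp_terms exprMn; ring.
rewrite (ssum_sum (index_enum 'I_N)); last first.
  by move=> n; apply: summableZ; exists (expR (nm (z * (ln n%:R)%:C))); exact: summable_exp_terms.
apply: eq_bigr => n _; rewrite ssumZ ?ssum_exp_terms ?mulrA //.
by exists (expR (nm (z * (ln n%:R)%:C))); exact: summable_exp_terms.
Qed.

Lemma npow_negE n (s : C) : npow_neg n s = expc (- s * (ln n%:R)%:C).
Proof.
case: s => a b; rewrite /npow_neg /expc /=; apply/eqP; rewrite eq_complex /=.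
by rewrite !mulr0 subr0 add0r !mulNr cosN sinN mulrN !eqxx.
Qed.

Lemma npow_neg_2 n (z : C) : npow_neg n.+1 (2 - z) =
  (n.+1%:R^-1 ^+ 2 : R)%:C * expc (z * (ln n.+1%:R)%:C).
Proof.
rewrite npow_negE sqr_natV // -expc_real -expcD; congr expc.
rewrite rmorphM rmorphN rmorph_nat; ring.
Qed.

Lemma npow_negM m n (s : C) : (0 < m)%N -> (0 < n)%N ->
  npow_neg (m * n) s = npow_neg m s * npow_neg n s.
Proof.
move=> m0 n0; rewrite !npow_negE -expcD natrM lnM ?posrE ?ltr0n // rmorphD; congr expc.
ring.
Qed.

Lemma nm_npow_neg n (s : C) : nm (npow_neg n s) = expR (- complex.Re s * ln n%:R).
Proof.
rewrite npow_negE nm_expc; case: s => a b /=; rewrite mulr0 subr0 //.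
Qed.

Lemma Lfun_pseval (a : nat -> C) (B : R) (z : C) : (forall n, nm (\sum_(i < n) a i) <= B) ->
  nice a -> nm z < r0 -> Defs.Lfun a (2 - z) = pseval (T a) z.
Proof.
move=> hB hn hz; apply: clim_lim.
have ha : (fun n => a n * tw 0 n) = a by apply/funext => n; rewrite tw_0 mulr1.
have hn0 : nice (fun n => a n * tw 0 n) by rewrite ha.
(* [Lfun] starts at index 1; the term of index 0 vanishes here because [0^-1 = 0]. *)
have := clim_shift (T_twist_pseval hB hn0 hz); rewrite ha; apply: eq_clim => N.
rewrite big_ord_recl invr0 expr0n /= mul0r mulr0 add0r /series /= big_mkord.
by apply: eq_bigr => n _; rewrite npow_neg_2 tw_0 mulr1.
Qed.

End TwistedSeries.

(** * Dirichlet characters as periodic functions *)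

Section Characters.
Variable R : realType.
Local Notation C := R[i].
Local Notation nm := (@Normc.normc R).

Lemma periodic_partial_sum (a : nat -> C) m (A : R) N : (0 < m)%N ->
  (forall n, a (n + m)%N = a n) -> \sum_(n < m) a n = 0 -> (forall n, nm (a n) <= A) ->
  nm (\sum_(n < N) a n) <= A * m%:R.
Proof.
move=> m0 ha hs hA; have A0 : 0 <= A by apply: le_trans (nm_ge0 _) (hA 0%N).
elim/ltn_ind: N => N IH; case: (leqP m N) => h.
  rewrite (sum_ord_split _ h) hs add0r -{1}(add0n m) big_addn.
  under eq_bigr do rewrite ha.
  by rewrite big_mkord; apply: IH; lia.
apply: le_trans (nm_sum _ _ _) _; apply: (@le_trans _ _ (\sum_(i < N) A)).
  by apply: ler_sum.
by rewrite sumr_const card_ord -[A *+ _]mulr_natr ler_wpM2l // ler_nat ltnW.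
Qed.

Lemma coprime_mulmod_inj m a i j : coprime a m -> (i < m)%N -> (j < m)%N ->
  (a * i %% m = a * j %% m)%N -> i = j.
Proof.
move=> am; wlog ij : i j / (i <= j)%N => [hw im jm e|im jm /esym/eqP].
  by case/orP: (leq_total i j) => h; [exact: hw|apply/esym; exact: hw].
rewrite eqn_mod_dvd ?leq_mul // -mulnBr Gauss_dvdr; last by rewrite coprime_sym.
case: (posnP (j - i)) => [h _|h /dvdn_leq]; first by lia.
move=> /(_ h); lia.
Qed.

Lemma reindex_mulmod (V : nmodType) m (F : nat -> V) a : (0 < m)%N -> coprime a m ->
  \sum_(n < m) F (a * n %% m)%N = \sum_(n < m) F n.
Proof.
move=> m0 am; pose h (i : 'I_m) := Ordinal (ltn_pmod (a * i) m0).
have hi : injective h.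
  by move=> i j /(congr1 val) /= e; apply: val_inj; apply: coprime_mulmod_inj e.
by rewrite [RHS](reindex_inj hi).
Qed.

Variables (m : nat) (chi : nat -> C).
Hypotheses (m0 : (0 < m)%N) (hchi : is_dchar m chi).

Lemma dchar_add n : chi (n + m)%N = chi n. Proof. by case: hchi. Qed.
Lemma dcharM a b : chi (a * b)%N = chi a * chi b. Proof. by case: hchi. Qed.
Lemma dchar1 : chi 1%N = 1. Proof. by case: hchi. Qed.
Lemma dchar_neq0 n : (chi n != 0) = coprime n m. Proof. by case: hchi. Qed.
Lemma dchar_eq0 n : ~~ coprime n m -> chi n = 0.
Proof. by rewrite -dchar_neq0 => /negPn/eqP. Qed.

Lemma dchar_addM n k : chi (n + k * m)%N = chi n.
Proof. by elim: k => [|k IH]; rewrite ?addn0 // mulSn addnCA addnA [(m + n)%N]addnC addnAC dchar_add. Qed.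

Lemma dchar_mod n : chi (n %% m) = chi n.
Proof. by rewrite {2}(divn_eq n m) addnC dchar_addM. Qed.

Lemma dchar_eqmod n k : n = k %[mod m] -> chi n = chi k.
Proof. by move=> h; rewrite -dchar_mod h dchar_mod. Qed.

Lemma dcharX a k : chi (a ^ k)%N = chi a ^+ k.
Proof. by elim: k => [|k IH]; rewrite ?expn0 ?dchar1 // expnS dcharM IH exprS. Qed.

Lemma dchar_totient a : coprime a m -> chi a ^+ totient m = 1.
Proof. by move=> h; rewrite -dcharX (dchar_eqmod (Euler_exp_totient h)) dchar1. Qed.

Lemma nm_dchar a : coprime a m -> nm (chi a) = 1.
Proof.
move=> /dchar_totient h; apply/eqP; rewrite -(@pexpr_eq1 _ _ (totient m)) ?nm_ge0 ?totient_gt0 //.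
by rewrite -nmX h nm1.
Qed.

Lemma nm_dchar_le1 a : nm (chi a) <= 1.
Proof.
by case: (boolP (coprime a m)) => [/nm_dchar ->|/dchar_eq0 ->] //; rewrite nm0.
Qed.

Lemma dchar_conj a : coprime a m -> chi a * (chi a)^* = 1.
Proof. by move=> h; rewrite -nm_sqr nm_dchar // expr1n. Qed.

Lemma nice_dchar : nice chi.
Proof. exact: nice_bounded nm_dchar_le1. Qed.

Lemma sum_period : chi <> principal_char R m -> \sum_(n < m) chi n = 0.
Proof.
move=> hne; have [a am ha] : exists2 a, coprime a m & chi a != 1.
  apply: contra_notP hne => h; apply/funext => n; rewrite /principal_char.
  case: ifP => hn; last by rewrite dchar_eq0 ?hn.
  by apply/eqP/negPn/negP => h1; apply: h; exists n.
have e : chi a * \sum_(n < m) chi n = \sum_(n < m) chi n.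
  rewrite mulr_sumr -(reindex_mulmod chi m0 am); apply: eq_bigr => n _.
  by rewrite dchar_mod dcharM.
apply/eqP; move/eqP: e; rewrite -subr_eq0 -{2}[\sum_(n < m) _]mul1r -mulrBl mulf_eq0.
by rewrite subr_eq0 (negbTE ha).
Qed.

Lemma dchar_partial_sum : chi <> principal_char R m ->
  forall N, nm (\sum_(n < N) chi n) <= m%:R.
Proof.
move=> h N; rewrite -[m%:R]mul1r.
exact: (periodic_partial_sum N m0 dchar_add (sum_period h) nm_dchar_le1).
Qed.

End Characters.

(** * Multiplicative functions *)

Section MultiplicativeFunctions.

Lemma prime_power_ind (P : nat -> Prop) : P 1%N ->
  (forall p a M, prime p -> (0 < a)%N -> (0 < M)%N -> ~~ (p %| M)%N -> P M -> P (p ^ a * M)%N) ->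
  forall n, (0 < n)%N -> P n.
Proof.
move=> P1 hP; elim/ltn_ind => n IH n0.
have [->//|n1] : n = 1%N \/ (1 < n)%N by lia.
have pp := pdiv_prime n1; set p := pdiv n in pp.
have [m pm e] := pfactor_coprime pp n0.
have a0 : (0 < logn p n)%N by rewrite logn_gt0 mem_primes pp n0 pdiv_dvd.
have m0 : (0 < m)%N by move: n0; rewrite e muln_gt0 => /andP[].
rewrite e mulnC; apply: hP => //; first by rewrite -prime_coprime.
apply: IH => //; rewrite [X in (_ < X)%N]e -{1}[m]muln1 ltn_pmul2l //.
by rewrite -(expn0 p) ltn_exp2l // prime_gt1.
Qed.

Lemma primes_pfactor_mul p a M : prime p -> (0 < a)%N -> (0 < M)%N -> ~~ (p %| M)%N ->
  perm_eq (primes (p ^ a * M)) (p :: primes M).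
Proof.
move=> pp a0 M0 pM; apply: uniq_perm; rewrite /= ?primes_uniq //.
  by rewrite mem_primes pp M0 pM.
by move=> q; rewrite primesM ?expn_gt0 ?(prime_gt0 pp) // primesX // primes_prime // !inE.
Qed.

Lemma divisors_pfactor_mul p a M : prime p -> (0 < M)%N -> ~~ (p %| M)%N ->
  perm_eq (divisors (p ^ a * M)) [seq (p ^ i * e)%N | i <- iota 0 a.+1, e <- divisors M].
Proof.
move=> pp M0 pM; have p0 := prime_gt0 pp.
have N0 : (0 < p ^ a * M)%N by rewrite muln_gt0 expn_gt0 p0.
have pe e : (e %| M)%N -> logn p e = 0%N.
  move=> eM; apply/eqP; rewrite -leqn0 leqNgt logn_gt0 mem_primes pp /=.
  by apply: contra pM => /andP[_ h]; apply: dvdn_trans eM.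
have inM e : e \in divisors M -> (0 < e)%N /\ (e %| M)%N.
  by rewrite -dvdn_divisors // => h; split=> //; apply: dvdn_gt0 h.
apply: uniq_perm; first exact: divisors_uniq.
  apply: allpairs_uniq; [exact: iota_uniq|exact: divisors_uniq|].
  move=> [i e] [j e'] /allpairsP hie /allpairsP hje.
  move: hie hje => [[i1 e1] [_ /inM[h1 h2] [-> ->]]] [[i2 e2] [_ /inM[h3 h4] [-> ->]]] /= he.
  have : logn p (p ^ i1 * e1) = logn p (p ^ i2 * e2) by rewrite he.
  rewrite !lognM ?expn_gt0 ?p0 // !pfactorK // !pe // !addn0 => hi.
  by move/eqP: he; rewrite hi eqn_pmul2l ?expn_gt0 ?p0 // => /eqP ->.
move=> d; rewrite -dvdn_divisors //; apply/idP/allpairsP => [hd|[[i e] /= [hi /inM[e0 eM] ->]]].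
  have d0 : (0 < d)%N by apply: dvdn_gt0 hd.
  have [e pe' ed] := pfactor_coprime pp d0.
  exists (logn p d, e); split => /=; last by rewrite mulnC.
    rewrite -[0%N :: iota 1 a]/(iota 0 a.+1) mem_iota /= add0n ltnS.
    have := dvdn_leq_log p N0 hd; by rewrite lognM ?expn_gt0 ?p0 // pfactorK // (pe M) // addn0.
  rewrite -dvdn_divisors //; move: hd; rewrite ed => /(dvdn_trans (dvdn_mulr _ (dvdnn _))).
  by rewrite Gauss_dvdr // coprimeXr // coprime_sym.
move: hi; rewrite -[0%N :: iota 1 a]/(iota 0 a.+1) mem_iota /= add0n ltnS => hi.
by apply: dvdn_mul => //; rewrite dvdn_exp2l.
Qed.

Variable V : comPzRingType.

(** The multiplicative function with value [F p a] at p^a; identities between such functions reduce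
    to one prime at a time. *)
Definition mulf (F : nat -> nat -> V) (n : nat) : V := \prod_(q <- primes n) F q (logn q n).

Lemma mulf1 F : mulf F 1 = 1.
Proof. by rewrite /mulf big_nil. Qed.

Lemma mulf_pfactor F p a M : (forall q, F q 0 = 1) -> prime p -> (0 < M)%N -> ~~ (p %| M)%N ->
  mulf F (p ^ a * M) = F p a * mulf F M.
Proof.
move=> F0 pp M0 pM; case: (posnP a) => [->|a0]; first by rewrite expn0 mul1n F0 mul1r.
have p0 : (0 < p ^ a)%N by rewrite expn_gt0 prime_gt0.
rewrite /mulf (perm_big _ (primes_pfactor_mul pp a0 M0 pM)) big_cons; congr (_ * _).
  congr (F p _); rewrite lognM // pfactorK //.
  by rewrite -[RHS]addn0; congr (_ + _)%N; apply/eqP; rewrite -leqn0 leqNgt logn_gt0 mem_primes pp M0 (negbTE pM).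
rewrite !big_seq; apply: eq_bigr => q; rewrite mem_primes => /and3P[qp _ qM]; congr (F q _).
rewrite lognM // lognX logn_prime //; case: eqP => [e|_]; last by rewrite muln0.
by move: pM; rewrite -e qM.
Qed.

Lemma mulfM F G n : mulf F n * mulf G n = mulf (fun q j => F q j * G q j) n.
Proof. by rewrite /mulf -big_split. Qed.

(** The divisors of p^a M are the products p^i e with e dividing M, so a convolution splits into
    local Cauchy products, one for each prime. *)
Lemma dconv_mulf F G n : (forall q, F q 0 = 1) -> (forall q, G q 0 = 1) -> (0 < n)%N ->
  dconv (mulf F) (mulf G) n = mulf (fun q a => \sum_(j < a.+1) F q j * G q (a - j)%N) n.
Proof.
move=> F0 G0 n0; set E := fun q a => _.
have E0 q : E q 0 = 1 by rewrite /E big_ord1 F0 G0 mulr1.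
rewrite /dconv; move: n n0; apply: prime_power_ind => [|p a M pp a0 M0 pM IH].
  by rewrite mulf1 (_ : divisors 1 = [:: 1%N]) // big_seq1 !mulf1 mulr1.
rewrite (perm_big _ (divisors_pfactor_mul a pp M0 pM)) big_allpairs_dep mulf_pfactor // -IH.
rewrite /E big_distrl -[iota 0 a.+1]/(index_iota 0 a.+1) big_mkord; apply: eq_bigr => i _ /=.
rewrite mulr_sumr !big_seq; apply: eq_bigr => e; rewrite -dvdn_divisors // => eM.
have e0 : (0 < e)%N by apply: dvdn_gt0 eM.
have p0 : (0 < p ^ i)%N by rewrite expn_gt0 prime_gt0.
have -> : (p ^ a * M %/ (p ^ i * e) = p ^ (a - i) * (M %/ e))%N.
  rewrite -{1}(subnK (leq_ord i)) expnD mulnAC -{1}(divnK eM) !mulnA.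
  rewrite -[(_ * e * p ^ i)%N]mulnA [(e * _)%N]mulnC mulnK // muln_gt0 p0 e0 //.
rewrite !mulf_pfactor //; first by rewrite mulrACA.
- by rewrite divn_gt0 // dvdn_leq.
- by apply: contra pM => h; rewrite -(divnK eM) dvdn_mulr.
- by apply: contra pM => /dvdn_trans; apply.
Qed.

Lemma sum_divisors_mulf F n : (forall q, F q 0 = 1) -> (0 < n)%N ->
  \sum_(d <- divisors n) mulf F d = mulf (fun q a => \sum_(j < a.+1) F q j) n.
Proof.
move=> F0 n0; have := @dconv_mulf F (fun _ _ => 1) n F0 (fun=> erefl) n0.
rewrite /dconv; under eq_bigr do rewrite {2}/mulf big1_eq mulr1.
move=> ->; apply: eq_bigr => q _; by under eq_bigr do rewrite mulr1.
Qed.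

Lemma mulf_completely (f : nat -> V) n : f 1%N = 1 ->
  (forall a b, (0 < a)%N -> (0 < b)%N -> f (a * b)%N = f a * f b) ->
  (0 < n)%N -> mulf (fun q j => f q ^+ j) n = f n.
Proof.
move=> f1 fM n0; move: n n0; apply: prime_power_ind => [|p a M pp a0 M0 pM IH]; first by rewrite mulf1.
have p0 b : (0 < p ^ b)%N by rewrite expn_gt0 prime_gt0.
rewrite mulf_pfactor // IH fM //; congr (_ * _).
elim: a {a0} => [|a ia]; first by rewrite expr0 expn0.
by rewrite expnS exprS fM ?p0 ?prime_gt0 // ia.
Qed.

(* Coefficients of zeta(s)^{-k}. *)
Definition muk (k n : nat) : V := mulf (fun _ j => (-1) ^+ j * 'C(k, j)%:R) n.

Lemma muk_pfactor k p a M : prime p -> (0 < M)%N -> ~~ (p %| M)%N ->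
  muk k (p ^ a * M) = (-1) ^+ a * 'C(k, a)%:R * muk k M.
Proof. by move=> pp M0 pM; rewrite /muk mulf_pfactor // => q; rewrite expr0 bin0 mul1r. Qed.

Lemma muk1 k : muk k 1 = 1. Proof. exact: mulf1. Qed.

Lemma muk0 n : (0 < n)%N -> muk 0 n = (n == 1)%N%:R.
Proof.
move=> n0; move: n n0; apply: prime_power_ind => [|p a M pp a0 M0 pM _]; first by rewrite muk1.
rewrite muk_pfactor // bin0n eqn0Ngt a0 mulr0 mul0r.
have : (1 < p ^ a)%N by rewrite -(expn0 p) ltn_exp2l // prime_gt1.
by case: eqP => //; nia.
Qed.

(** At a prime power this is Pascal's rule with alternating signs; globally, zeta times zeta^{-k-1}
    is zeta^{-k}. *)
Lemma sum_muk k n : (0 < n)%N -> \sum_(d <- divisors n) muk k.+1 d = muk k n.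
Proof.
move=> n0; rewrite /muk sum_divisors_mulf //; last by move=> q; rewrite expr0 bin0 mul1r.
apply: eq_bigr => q _; move: (logn q n) => a; elim: a => [|a IH].
  by rewrite big_ord1 !expr0 !bin0.
by rewrite big_ord_recr /= IH binS natrD exprS; ring.
Qed.

End MultiplicativeFunctions.

(** * Growth of the coefficients, and the Dirichlet inverse of L *)

Section MukBounds.
Variable R : realType.
Local Notation C := R[i].
Local Notation nm := (@Normc.normc R).

Lemma muk_le k n : (0 < n)%N -> `|muk R k n| <= (2 ^+ k) ^+ size (primes n).
Proof.
move=> n0; move: n n0; apply: prime_power_ind => [|p a M pp a0 M0 pM IH].
  by rewrite muk1 normr1.
rewrite muk_pfactor // (perm_size (primes_pfactor_mul pp a0 M0 pM)) /= exprS !normrM.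
apply: ler_pM => //; rewrite normrX normrN1 expr1n mul1r ger0_norm // -natrX ler_nat.
elim: k a {a0 IH} => [|k IH] [|a]; rewrite ?bin0 ?bin0n ?expn_gt0 // binS expnS mul2n -addnn.
exact: leq_add.
Qed.

Lemma muk1_le n : (0 < n)%N -> `|muk R 1 n| <= 1.
Proof.
move=> n0; move: n n0; apply: prime_power_ind => [|p a M pp a0 M0 pM IH].
  by rewrite muk1 normr1.
rewrite muk_pfactor // normrM mulr_ile1 // normrM normrX normrN1 expr1n mul1r ger0_norm //.
by case: a a0 => [|[|a]] // _; rewrite ?bin1 // bin_small.
Qed.

Lemma prod_primes_le n (eps : R) : (0 < n)%N -> 0 < eps ->
  \prod_(q <- primes n) powR q%:R eps <= powR n%:R eps.
Proof.
move=> n0 e0; move: n n0; apply: prime_power_ind => [|p a M pp a0 M0 pM IH].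
  by rewrite big_nil powR1.
rewrite (perm_big _ (primes_pfactor_mul pp a0 M0 pM)) big_cons natrM powRM // -[X in X <= _]/(_ * _).
apply: ler_pM => //.
  by apply: prodr_ge0 => q _; exact: powR_ge0.
apply: ge0_ler_powR; rewrite ?nnegrE ?ler_nat ?(ltW e0) //.
by rewrite -{1}[p]expn1 leq_pexp2l // prime_gt0.
Qed.

(* Only the boundedly many primes with p^eps < A contribute more than p^eps. *)
Lemma exp_omega_le (A eps : R) : 1 <= A -> 0 < eps ->
  exists2 D : R, 0 < D & forall n, (0 < n)%N -> A ^+ size (primes n) <= D * powR n%:R eps.
Proof.
move=> A1 e0; have A0 : 0 < A by lra.
have [P hP] : exists P : nat, forall q, (P <= q)%N -> A <= powR q%:R eps.
  exists (Num.bound (powR A eps^-1)) => q hq.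
  have h := archi_boundP (powR_ge0 A eps^-1).
  rewrite -[A](@powRr1 _) ?(ltW A0) // -[X in powR A X](mulVf (lt0r_neq0 e0)) powRrM.
  apply: ge0_ler_powR; rewrite ?nnegrE ?powR_ge0 ?(ltW e0) //.
  by apply: le_trans (ltW h) _; rewrite ler_nat.
exists (A ^+ P); first by rewrite exprn_gt0.
move=> n n0; apply: le_trans (ler_wpM2l (exprn_ge0 P (ltW A0)) (prod_primes_le n0 e0)).
apply: (@le_trans _ _ (\prod_(q <- primes n) ((if (q < P)%N then A else 1) * powR q%:R eps))).
  have -> : A ^+ size (primes n) = \prod_(q <- primes n) A.
    by rewrite big_const_seq count_predT iter_mulr_1.
  rewrite !big_seq; apply: ler_prod => q; rewrite mem_primes => /and3P[qp _ _].
  rewrite ltW //=; case: ifP => [qP|/negbT]; last by rewrite -leqNgt mul1r => /hP.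
  rewrite -{1}[A]mulr1 ler_pM2l //.
  have q1 : 1 <= q%:R :> R by rewrite ler1n prime_gt0.
  by have := ler_powR q1 (ltW e0); rewrite powRr0.
rewrite big_split /=; apply: ler_wpM2r; first by apply: prodr_ge0 => q _; exact: powR_ge0.
rewrite -big_mkcond /= big_const_seq iter_mulr_1; apply: ler_weXn2l => //.
rewrite -size_filter -{2}(size_iota 0 P); apply: uniq_leq_size.
  by rewrite filter_uniq // primes_uniq.
by move=> q; rewrite mem_filter mem_iota => /andP[].
Qed.

Lemma muk_powR_le k (eps : R) : 0 < eps ->
  exists2 D : R, 0 < D & forall n, (0 < n)%N -> `|muk R k n| <= D * powR n%:R eps.
Proof.
move=> e0; have [|D D0 hD] := @exp_omega_le (2 ^+ k) eps _ e0; first by rewrite exprn_ege1 // ler1n.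
by exists D => // n n0; apply: le_trans (muk_le k n0) (hD n n0).
Qed.

Lemma nice_powR_le (a : nat -> C) (D : R) :
  (forall n, (0 < n)%N -> nm (a n) <= D * powR n%:R (1/4)) -> nice a.
Proof.
move=> hD; have h : (0 : R) < 1/4 by lra.
exists (D * (1 + (1/4)^-1)) => N.
have D0 : 0 <= D.
  have := hD 1%N isT; rewrite powR1 mulr1; apply: le_trans; exact: nm_ge0.
apply: (le_trans _ (ler_wpM2l D0 (sum_powR_le N h))).
rewrite mulr_sumr; apply: ler_sum => -[[|n] /= hn] _.
  by rewrite wt_0 mulr0 nm0 mulr_ge0 // powR_ge0.
rewrite nmM nm_real ger0_norm ?wt_ge0 //.
apply: le_trans (ler_wpM2r (wt_ge0 _ _) (hD n.+1 isT)) _.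
rewrite -mulrA /wt -powRD ?pnatr_eq0 ?implybT //.
by rewrite (_ : 1/4 + - (3/2) = - (1 + 1/4) :> R) //; lra.
Qed.

Lemma eq_T (a b : nat -> C) j : (forall n, (0 < n)%N -> a n = b n) -> T a j = T b j.
Proof.
by move=> h; apply: eq_ssum => -[|n]; rewrite ?wj_0 ?mulr0 // h.
Qed.

Variables (m : nat) (chi : nat -> C).
Hypotheses (m0 : (0 < m)%N) (hchi : is_dchar m chi).

(** Coefficients of L(s, chi)^{-k}. *)
Definition mukchi k n : C := (muk R k n)%:C * chi n.

Lemma nm_mukchi k n : nm (mukchi k n) <= `|muk R k n|.
Proof.
rewrite nmM nm_real -{2}[`|_|]mulr1; apply: ler_wpM2l => //.
exact: nm_dchar_le1 m0 hchi n.
Qed.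

Lemma nice_mukchi k : nice (mukchi k).
Proof.
have h : (0 : R) < 1/4 by lra.
have [D _ hD] := @muk_powR_le k _ h.
by apply: (@nice_powR_le _ D) => n n0; apply: le_trans (nm_mukchi k n) (hD n n0).
Qed.

(** The completely multiplicative weight [w] serves twice: as the constant 1 for Taylor
    coefficients, and as n^{-s} for the Dirichlet series itself. *)
Lemma dconv_mukchi (w : nat -> C) k n : (forall a b, (0 < a)%N -> (0 < b)%N -> w (a * b)%N = w a * w b) ->
  (0 < n)%N ->
  dconv (fun n => mukchi k.+1 n * w n) (fun n => chi n * w n) n = mukchi k n * w n.
Proof.
move=> hw n0; rewrite /dconv /mukchi -(sum_muk _ k n0) rmorph_sum -mulrA mulr_suml.
rewrite !big_seq; apply: eq_bigr => d; rewrite -dvdn_divisors // => hd.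
have d0 : (0 < d)%N by apply: dvdn_gt0 hd.
have nd0 : (0 < n %/ d)%N by rewrite divn_gt0 // dvdn_leq.
rewrite -{3 4}(divnK hd) mulnC (dcharM hchi) hw //; ring.
Qed.

Lemma T_mukchi k j : cprod (T (mukchi k.+1)) (T chi) j = T (mukchi k) j.
Proof.
rewrite -T_dconv; [|exact: nice_mukchi|exact: nice_dchar m0 hchi].
apply: eq_T => n n0.
have := @dconv_mukchi (fun=> 1) k n (fun _ _ _ _ => esym (mul1r 1)) n0.
rewrite mulr1 => <-; rewrite /dconv; apply: eq_bigr => d _; by rewrite !mulr1.
Qed.

Lemma T_mukchi0 j : T (mukchi 0) j = (j == 0)%N%:R.
Proof.
rewrite /T (@ssum_finite _ _ 2).
  rewrite !big_ord_recl big_ord0 wj_0 mulr0 add0r addr0 /mukchi /= muk1 (dchar1 hchi) !mul1r.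
  by rewrite /wj ln1 invr1 expr1n mul1r expr0n; case: j => [|j] /=; rewrite ?divr1 ?mul0r.
by case=> [|[|n]] // _; rewrite /mukchi muk0 // !mul0r.
Qed.

(** Here Re s > 1, so the series of chi and of mu chi converge absolutely, and their product is
    1. *)
Lemma pseval_T_neq0_right z : nm z < r0 R -> complex.Re z < 1 ->
  (forall n, nm (\sum_(i < n) chi i) <= m%:R) -> pseval (T chi) z != 0.
Proof.
(* [npow_neg 0 s] equals 1, as [ln 0 = 0]; index 0 is therefore excluded by hand. *)
move=> hz hz1 hps; pose w n := if n == 0%N then 0 else npow_neg n (2 - z).
have hw a b : (0 < a)%N -> (0 < b)%N -> w (a * b)%N = w a * w b.
  by rewrite /w muln_eq0; case: a b => [|a] [|b] // _ _; rewrite /= npow_negM.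
pose eta := 1 - complex.Re z; have eta0 : 0 < eta by rewrite /eta; lra.
have nw n : nm (w n) = powR n%:R (- (1 + eta)).
  case: n => [|n]; first by rewrite /w nm0 powR0 // oppr_eq0 gt_eqF // addr_gt0.
  have -> : - (1 + eta) = - complex.Re (2 - z).
    by rewrite ReB -(rmorph_nat (real_complex R) 2) /eta /=; ring.
  by rewrite /w /= nm_npow_neg powR_expR.
have hs (a : nat -> C) : (forall n, (0 < n)%N -> nm (a n) <= 1) -> summable (fun n => a n * w n).
  move=> ha; exists (1 + eta^-1) => N; apply: le_trans (sum_powR_le N eta0).
  apply: ler_sum => -[[|n] /= hn] _; first by rewrite /w eqxx mulr0 nm0 powR_ge0.
  by rewrite nmM nw -[leRHS]mul1r ler_wpM2r ?powR_ge0 // ha.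
have h1 : summable (fun n => chi n * w n) by apply: hs => n _; exact: nm_dchar_le1 m0 hchi n.
have h2 : summable (fun n => mukchi 1 n * w n).
  by apply: hs => n n0; apply: le_trans (nm_mukchi 1 n) (muk1_le n0).
have w0 : w 0%N = 0 by [].
have hp := ssum_dconv (_ : mukchi 1 0 * w 0%N = 0) (_ : chi 0%N * w 0%N = 0) h2 h1.
rewrite w0 !mulr0 in hp; have {hp} := hp erefl erefl.
have -> : ssum (dconv (fun n => mukchi 1 n * w n) (fun n => chi n * w n)) = 1.
  rewrite (@ssum_finite _ _ 2).
    have d0 : dconv (fun n => mukchi 1 n * w n) (fun n => chi n * w n) 0 = 0.
      by rewrite /dconv big_seq1 div0n w0 !mulr0.
    have d1 : dconv (fun n => mukchi 1 n * w n) (fun n => chi n * w n) 1 = 1.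
      rewrite dconv_mukchi // /mukchi muk1 (dchar1 hchi) !mul1r /w /= npow_negE ln1 mulr0.
      exact: expc0.
    by rewrite !big_ord_recl big_ord0 /= d0 d1 add0r addr0.
  by case=> [|[|n]] // _; rewrite dconv_mukchi // /mukchi muk0 // !mul0r.
move=> e1; have -> : pseval (T chi) z = ssum (fun n => chi n * w n).
  have ha : (fun n => chi n * tw 0 n) = chi by apply/funext => n; rewrite tw_0 mulr1.
  have hn0 : nice (fun n => chi n * tw 0 n) by rewrite ha; exact: nice_dchar m0 hchi.
  have := T_twist_pseval hps hn0 hz; rewrite ha => h3.
  apply: clim_uniq h3 _; apply: eq_clim (summable_clim h1) => N.
  apply: eq_bigr => -[[|n] hn] _ /=; first by rewrite w0 invr0 expr0n mul0r !mulr0.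
  by rewrite /w /= npow_neg_2 tw_0 mulr1.
by apply/eqP => e2; move/eqP: e1; rewrite e2 mulr0 oner_eq0.
Qed.

End MukBounds.

(** * Non-vanishing of L(s, chi) *)

Section LocalCoefficients.
Variable R : realType.
Local Notation C := R[i].

(* [E a] is the coefficient of x^a in 1/((1-x)^2 (1-hx) (1-h^*x)); for |h| = 1 Ramanujan's
   identity expresses it as the sum of the |v (a - 2l)|^2. *)
Lemma ramanujan_coeff (h : C) (v E : nat -> C) : h * h^* = 1 ->
  v 0%N = 1 -> (forall a, v a.+1 = 1 + h * v a) ->
  (forall a, E a = \sum_(i < a.+1) v i * (v (a - i)%N)^*) ->
  forall a, E a.+2 = E a + v a.+2 * (v a.+2)^*.
Proof.
move=> h1 v0 vS hE a.
have sq n : v n.+1 * (v n.+1)^* = v n * (v n)^* + v n.+1 + (v n.+1)^* - 1.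
  rewrite !vS rmorphD rmorphM rmorph1 /=.
  have -> : (1 + h * v n) * (1 + h^* * (v n)^*) =
     1 + h * v n + h^* * (v n)^* + (h * h^*) * (v n * (v n)^*) by ring.
  rewrite h1; ring.
have sqsum n : v n * (v n)^* = 1 + \sum_(i < n) (v i.+1 + (v i.+1)^* - 1).
  elim: n => [|n IH]; first by rewrite big_ord0 v0 rmorph1 mulr1 addr0.
  by rewrite big_ord_recr /= sq IH; ring.
rewrite !hE big_ord_recl big_ord_recr /= subn0 subnn v0 rmorph1 mul1r mulr1.
have -> : \sum_(i < a.+1) v (bump 0 i) * (v (a.+2 - bump 0 i)%N)^* =
  \sum_(i < a.+1) v i * (v (a - i)%N)^* + \sum_(i < a.+1) (v i.+1 + (v i.+1)^* - 1).
  have -> : \sum_(i < a.+1) (v i.+1 + (v i.+1)^* - 1) =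
      \sum_(i < a.+1) (v i.+1 + (v (a - i).+1)^* - 1).
    rewrite !big_split /=; congr (_ + _ + _).
    by rewrite [LHS](reindex_inj rev_ord_inj) /=; apply: eq_bigr => i _; rewrite subSS.
  rewrite -big_split /=; apply: eq_bigr => i _; rewrite /bump add1n.
  have -> : (a.+2 - i.+1 = (a - i).+1)%N by have := ltn_ord i; lia.
  rewrite !vS rmorphD rmorphM rmorph1 /=.
  have -> : (1 + h * v i) * (1 + h^* * (v (a - i)%N)^*) =
     1 + h * v i + h^* * (v (a - i)%N)^* + (h * h^*) * (v i * (v (a - i)%N)^*) by ring.
  rewrite h1; ring.
rewrite sqsum [\sum_(i < a.+2) _]big_ord_recr /= (_ : bump 0 a.+1 = a.+2) //; ring.
Qed.

(** The recursion moves in steps of two and adds squared norms. It starts from [E 0 = 1] and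
    [E 1 = |1 + h|^2], so even indices stay at least 1. *)
Lemma ramanujan_pos (h : C) (v E : nat -> C) : h * h^* = 1 ->
  v 0%N = 1 -> (forall a, v a.+1 = 1 + h * v a) ->
  (forall a, E a = \sum_(i < a.+1) v i * (v (a - i)%N)^*) ->
  (forall a, 0 <= E a) /\ (forall a, 1 <= E (a.*2)).
Proof.
move=> h1 v0 vS hE.
have rec := ramanujan_coeff h1 v0 vS hE.
have E0 : E 0%N = 1 by rewrite hE big_ord1 v0 rmorph1 mulr1.
have E1 : 0 <= E 1%N.
  have -> : E 1%N = (1 + h) * (1 + h)^*.
    have v1 : v 1%N = 1 + h by rewrite vS v0 mulr1.
    rewrite hE !big_ord_recl big_ord0 /= v0 (_ : bump 0 0 = 1%N) // v1 !rmorphD !rmorph1 mulr1.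
    have -> : (1 + h) * (1 + h^*) = 1 + h + h^* + h * h^* by ring.
    by rewrite h1; ring.
  exact: mulcJ_ge0.
have pos a : 0 <= E a /\ 0 <= E a.+1.
  elim: a => [|a [h2 h3]]; first by rewrite E0.
  by split => //; rewrite rec addr_ge0 // mulcJ_ge0.
split=> [a|]; first by case: (pos a).
elim=> [|a IH]; first by rewrite E0.
by rewrite doubleS rec -[1]addr0 lerD // mulcJ_ge0.
Qed.

Lemma clim_ge0 (u : nat -> C) (l : C) : clim u l -> (forall n, 0 <= u n) -> 0 <= l.
Proof.
move=> hl h; have hr n : u n = (complex.Re (u n))%:C.
  by have := h n; rewrite lecE => /andP[/eqP e _]; move: e; case: (u n) => a b /= ->.
have hl2 : clim (fun n => (complex.Re (u n))%:C) (complex.Re l)%:C.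
  move=> e /hl [N hN]; exists N => n /hN; apply: le_lt_trans.
  by rewrite -rmorphB nm_real -ReB nm_Re.
have -> : l = (complex.Re l)%:C by apply: clim_uniq hl _; apply: eq_clim hl2 => n.
rewrite ler0c; apply: (clim_Re_ge (N := 0%N) hl) => n _.
by have := h n; rewrite lecE => /andP[].
Qed.

Lemma ssum_ge (u : nat -> C) N : summable u -> (forall n, 0 <= u n) -> \sum_(n < N) u n <= ssum u.
Proof.
move=> hu h; rewrite -subr_ge0.
have hM : clim (fun M => \sum_(n < M + N) u n) (ssum u).
  by move=> e /(summable_clim hu) [M hM]; exists M => n hn; apply: hM; rewrite (leq_trans hn) // leq_addr.
apply: clim_ge0 (climB hM (clim_cst _)) _ => M.
rewrite (sum_ord_split _ (leq_addl M N)) addrAC subrr add0r; exact: sumr_ge0.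
Qed.

Lemma sum_subset_le (V : numDomainType) (s t : seq nat) (F : nat -> V) : uniq s -> uniq t ->
  {subset s <= t} -> (forall n, 0 <= F n) -> \sum_(n <- s) F n <= \sum_(n <- t) F n.
Proof.
move=> us ut sub F0; rewrite [leRHS](bigID (mem s) xpredT) /= -[X in _ <= X + _]big_filter.
have pe : perm_eq [seq n <- t | n \in s] s.
  by apply: uniq_perm; rewrite ?filter_uniq // => n; rewrite mem_filter; apply: andb_idr; exact: sub.
by rewrite (perm_big _ pe) /= lerDl sumr_ge0.
Qed.

Lemma sum_inj_le (V : numDomainType) (F : nat -> V) (g : nat -> nat) L N : injective g ->
  (forall l, (l < L)%N -> (g l < N)%N) -> (forall n, 0 <= F n) ->
  \sum_(l < L) F (g l) <= \sum_(n < N) F n.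
Proof.
move=> gi gN F0.
rewrite -(big_mkord xpredT (fun l => F (g l))) -(big_map g xpredT) -(big_mkord xpredT F).
apply: sum_subset_le; rewrite ?map_inj_uniq ?iota_uniq // => n /mapP[l].
by rewrite !mem_index_iota /= => /gN h ->.
Qed.

Lemma nm_le_ge0 (x y : C) : 0 <= x -> x <= y -> Normc.normc x <= Normc.normc y.
Proof. by move=> x0 xy; rewrite nm_le !ger0_norm // (le_trans x0). Qed.

End LocalCoefficients.

Section PrincipalChar.
Variable R : realType.
Local Notation C := R[i].
Local Notation nm := (@Normc.normc R).

Lemma coprime_mul_add n m : coprime (n + m) m = coprime n m.
Proof. by rewrite /coprime !(gcdnC _ m) gcdnDr. Qed.

Lemma principal_is_dchar m : is_dchar m (principal_char R m).
Proof.
split=> [n|a b||n]; rewrite /principal_char ?coprime_mul_add //.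
- by rewrite coprimeMl; case: (coprime a m); case: (coprime b m); rewrite ?mulr0 ?mul0r ?mulr1.
- by rewrite coprime1n.
- by case: ifP; rewrite ?oner_eq0 ?eqxx.
Qed.

(* Coefficients of 1 - 2^(z-1), which cancels the pole of zeta (2 - z). *)
Definition etaP (j : nat) : C := (j == 0)%N%:R - 2 * (wj R j 2)%:C.

(** Multiplication by 1 - 2^{z-1} replaces the coefficient c0 n by c0 n - 2 c0 (n/2), the second
    term being present for even n only. The result has period 2 m, sum 0 over a period and norm at
    most 3, so Abel summation applies as for a non-principal character. *)
Lemma etaP_principal_bound m j : (0 < m)%N ->
  nm (cprod etaP (T (principal_char R m)) j) * r0 R ^+ j <= 3 * (2 * m)%:R * Ct 0.
Proof.
move=> m0; set c0 := principal_char R m.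
have nc0 : nice c0 := nice_dchar m0 (principal_is_dchar m).
pose d2 (n : nat) : C := (n == 2)%N%:R.
have nd2 : nice d2.
  by apply: (@nice_bounded _ _ 1) => n; rewrite /d2 nm_nat; case: (n == 2)%N.
have Td2 i : T d2 i = (wj R i 2)%:C.
  rewrite /T (@ssum_finite _ _ 3); last by case=> [|[|[|n]]] // _; rewrite /d2 mul0r.
  by rewrite !big_ord_recl big_ord0 /d2 /= !mul0r mul1r !add0r addr0.
pose a n : C := c0 n - 2 * (if odd n then 0 else c0 n./2).
have ba n : nm (a n) <= 3.
  have b1 k : nm (c0 k) <= 1 by exact: nm_dchar_le1 m0 (principal_is_dchar m) k.
  apply: le_trans (nmB _ _) _; rewrite nmM nm_nat.
  have : nm (if odd n then 0 else c0 n./2) <= 1 by case: ifP; rewrite ?nm0.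
  by have := b1 n; lra.
have na : nice a := nice_bounded ba.
have pa n : a (n + 2 * m)%N = a n.
  rewrite /a mul2n oddD odd_double addbF halfD odd_double andbF add0n doubleK.
  have c0a k : c0 (k + m)%N = c0 k := dchar_add (principal_is_dchar m) k.
  by rewrite c0a -addnn addnA !c0a.
have split2 (F : nat -> C) k : \sum_(n < k.*2) F n = \sum_(n < k) (F n.*2 + F n.*2.+1).
  elim: k => [|k IH]; first by rewrite !big_ord0.
  by rewrite doubleS !big_ord_recr /= IH addrA.
have sa : \sum_(n < 2 * m) a n = 0.
  rewrite /a sumrB -mulr_sumr mul2n -addnn (sum_ord_split _ (leq_addr m m)).
  have -> : \sum_(m <= i < m + m) c0 i = \sum_(i < m) c0 i.
    rewrite -{1}(add0n m) big_addn addnK big_mkord.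
    by apply: eq_bigr => i _; exact: dchar_add (principal_is_dchar m) i.
  rewrite addnn (split2 (fun n => if odd n then 0 else c0 n./2)).
  have -> : \sum_(n < m) ((if odd n.*2 then 0 else c0 (n.*2)./2) +
     (if odd n.*2.+1 then 0 else c0 (n.*2.+1)./2)) = \sum_(n < m) c0 n.
    by apply: eq_bigr => n _; rewrite /= odd_double doubleK addr0.
  by ring.
have m20 : (0 < 2 * m)%N by rewrite muln_gt0.
have hps N := periodic_partial_sum N m20 pa sa ba.
have -> : cprod etaP (T c0) j = T (fun n => a n * tw 0 n) j.
  have -> : T (fun n => a n * tw 0 n) j = T (fun n => c0 n - 2 * dconv d2 c0 n) j.
    apply: eq_T => n n0; rewrite tw_0 mulr1 /a; congr (_ - 2 * _).
    rewrite /dconv /d2; case: ifP => ho.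
      rewrite big_seq big1 // => d; rewrite -dvdn_divisors //.
      by case: eqP => [->|]; rewrite ?mul0r // dvdn2 ho.
    rewrite (bigD1_seq 2) ?divisors_uniq //=; last by rewrite -dvdn_divisors // dvdn2 ho.
    rewrite mul1r divn2 big1 ?addr0 // => d /negbTE ->.
    by rewrite mul0r.
  have nd : nice (dconv d2 c0) := nice_dconv nd2 nc0.
  have -> : T (fun n => c0 n - 2 * dconv d2 c0 n) j = T c0 j - 2 * T (dconv d2 c0) j.
    rewrite /T -(ssumZ 2 (summable_T j nd)) -ssumB; last by apply: summableZ; exact: summable_T.
      by apply: eq_ssum => n; rewrite mulrBl mulrA.
    exact: summable_T.
  rewrite T_dconv // /cprod /etaP.
  under eq_bigr do rewrite mulrBl.
  rewrite sumrB big_ord_recl /= mul1r subn0 big1 ?addr0; last by move=> i _; rewrite mul0r.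
  congr (_ - _); rewrite mulr_sumr; apply: eq_bigr => i _; by rewrite Td2 mulrA.
apply: T_twist_bound => [N|]; first exact: hps.
by rewrite (_ : (fun _ => _) = a) //; apply/funext => n; rewrite tw_0 mulr1.
Qed.

End PrincipalChar.

(** * Landau's theorem on the line Re s = 1 *)

Section Landau.
Variable R : realType.
Local Notation C := R[i].
Local Notation nm := (@Normc.normc R).

Lemma conj_mul_real (x : C) (a : R) : (x * a%:C)^* = x^* * a%:C.
Proof. by case: x => u v; apply/eqP; rewrite eq_complex /= !mulr0 !subr0 !add0r mulNr !eqxx. Qed.

Lemma cprod_comm : commutative (@cprod R).
Proof. by move=> a b; apply/funext; exact: cprodC. Qed.

Lemma cprod_assoc : associative (@cprod R).
Proof. by move=> a b c; apply/funext; exact: cprodA. Qed.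

Lemma cprodACA (a b c d : nat -> C) : cprod (cprod a b) (cprod c d) = cprod (cprod a c) (cprod b d).
Proof. by rewrite -!cprod_assoc (cprod_assoc b) [cprod b c]cprod_comm -cprod_assoc. Qed.

(** Absolute convergence at z = 3/2, that is, at s = 1/2. *)
Definition geo (c : nat -> C) := summable (fun j => c j * ((3 / 2 : R)%:C) ^+ j).

Lemma nm32 : nm (3 / 2 : R)%:C = 3 / 2.
Proof. by rewrite nm_real ger0_norm. Qed.

Lemma geo_cprod a b : geo a -> geo b -> geo (cprod a b).
Proof. by move=> ha hb; have [] := pseval_cprod ha hb. Qed.

Lemma geo_bound c (D : R) : (forall j, nm (c j) * r0 R ^+ j <= D) -> geo c.
Proof.
move=> h; eexists; apply: geo_summable h; first exact: r0_gt0.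
by rewrite nm32 /r0; lra.
Qed.

(** The Cauchy product with the constant 1 is division by 1 - z and lists the partial sums of [c].
    As the total sum is 0, each partial sum is minus a tail and keeps the decay of [c]. *)
Lemma partial_sums_bound (c : nat -> C) (D : R) : (forall j, nm (c j) * r0 R ^+ j <= D) ->
  pseval c 1 = 0 ->
  forall j, nm (cprod c (fun=> 1) j) * r0 R ^+ j <= D * ((r0 R)^-1 / (1 - (r0 R)^-1)).
Proof.
move=> hD h0 j; set x := (r0 R)^-1.
have rp := r0_gt0 R; have D0 : 0 <= D.
  by apply: le_trans (hD 0%N); rewrite expr0 mulr1 nm_ge0.
have x0 : 0 < x by rewrite invr_gt0.
have x1 : x < 1 by rewrite invf_lt1 // /r0; lra.
have hc i : nm (c i) <= D * x ^+ i.
  by rewrite /x exprVn ler_pdivlMr ?exprn_gt0.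
have hs : summable c.
  have : summable (fun j => c j * 1 ^+ j).
    eexists; apply: geo_summable hD; first exact: rp.
    by rewrite nm1 /r0; lra.
  by apply: summableW => n; rewrite expr1n mulr1.
have s0 : ssum c = 0 by rewrite -h0; apply: eq_ssum => n; rewrite expr1n mulr1.
have := @ssum_tail R c (D * (x ^+ j.+1 / (1 - x))) j.+1 hs.
rewrite s0 sub0r nmN => h; rewrite /cprod; under eq_bigr do rewrite mulr1.
apply: le_trans (ler_wpM2r _ (h _)) _; first by rewrite exprn_ge0 // ltW.
  move=> N; case: (leqP N j.+1) => hN.
    have x1' : 0 <= 1 - x by lra.
    by rewrite big_geq // mulr_ge0 // divr_ge0 // exprn_ge0 // ltW.
  apply: (@le_trans _ _ (\sum_(j.+1 <= i < N) D * x ^+ i)); first exact: ler_sum.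
  rewrite -mulr_sumr ler_wpM2l // -{1}(add0n j.+1) big_addn big_mkord.
  under eq_bigr do rewrite exprD mulrC.
  rewrite -mulr_sumr ler_wpM2l ?exprn_ge0 ?(ltW x0) // geom_sum_le // (ltW x0) //=.
rewrite -mulrA ler_wpM2l // exprS -!mulrA ler_wpM2l ?(ltW x0) //.
rewrite mulrCA -exprMn mulVf ?gt_eqF // expr1n mulr1 //.
Qed.

Lemma eq_dconv (a b a' b' : nat -> C) n : (0 < n)%N -> (forall d, (0 < d)%N -> a d = a' d) ->
  (forall d, (0 < d)%N -> b d = b' d) -> dconv a b n = dconv a' b' n.
Proof.
move=> n0 ha hb; rewrite /dconv !big_seq; apply: eq_bigr => d; rewrite -dvdn_divisors // => hd.
by rewrite ha ?hb ?divn_gt0 ?(dvdn_leq n0 hd) ?(dvdn_gt0 n0 hd).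
Qed.

(** These are the coefficients of (1 - 2^{z-1}) / (1 - z). *)
Lemma etaP_sum j : cprod (@etaP R) (fun=> 1) j = (1 - 2 * \sum_(i < j.+1) wj R i 2)%:C.
Proof.
rewrite /cprod rmorphB rmorph1 rmorphM rmorph_nat rmorph_sum mulr_sumr.
under eq_bigr do rewrite mulr1 /etaP.
rewrite sumrB big_ord_recl /= big1 ?addr0 //.
Qed.

(** The sum of the [wj i 2] is a quarter of a partial exponential series of ln 2, hence at most
    1/2. *)
Lemma etaP_sum_ge0 j : 0 <= cprod (@etaP R) (fun=> 1) j.
Proof.
rewrite etaP_sum ler0c /wj -mulr_sumr.
have l2 : 0 <= ln (2%:R : R) by exact: ln_nat_ge0.
have := exp_term_sum_le j.+1 l2; rewrite lnK ?posrE ?ltr0n // => h.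
have -> : 2%:R^-1 ^+ 2 = 1 / 4 :> R by field.
lra.
Qed.

Lemma etaP_sum_0 : cprod (@etaP R) (fun=> 1) 0 = (1 / 2 : R)%:C.
Proof.
rewrite etaP_sum big_ord1; congr (_%:C).
by rewrite /wj expr0 fact0 divr1 mulr1; field.
Qed.

Variables (m : nat) (chi : nat -> C) (t : R).
Hypotheses (m0 : (0 < m)%N) (hchi : is_dchar m chi) (hne : chi <> principal_char R m).

Let h n : C := chi n * tw t n.
Let hb n : C := (h n)^*.
Let c0 := principal_char R m.
Let one := principal_char R 1.
Let e := dconv (dconv one h) (dconv c0 hb).

Lemma twist_mul a b : (0 < a)%N -> (0 < b)%N -> h (a * b)%N = h a * h b.
Proof. by move=> a0 b0; rewrite /h (dcharM hchi) twM // mulrACA. Qed.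

Lemma twist_one : h 1%N = 1.
Proof. by rewrite /h (dchar1 hchi) mul1r /tw ln1 mulr0 mulr0 expc0. Qed.

Lemma nm_twist n : nm (h n) <= 1.
Proof. by rewrite nmM nm_tw mulr1; exact: nm_dchar_le1 m0 hchi n. Qed.

(* With h = chi n^{-it}, the Dirichlet series of e is zeta(s) L(s, chi_0) H(s) Hbar(s).
   If H vanished on the line Re s = 1, both poles would cancel and the nonnegative series of e
   would converge at s = 1/2, although e (d ^ 2) >= 1 for d coprime to m. *)
Let Vl (x y : C) (a : nat) : C := \sum_(j < a.+1) x ^+ j * y ^+ (a - j).

(** [Vl x y a] is the coefficient of X^a in 1/((1 - x X)(1 - y X)), so the local series of [e] at q
    is the product of two such fractions. *)
Lemma landau_coeff n : (0 < n)%N ->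
  e n = mulf (fun q a => \sum_(j < a.+1) Vl 1 (h q) j * Vl (c0 q) (hb q) (a - j)) n.
Proof.
have one1 q : one q = 1 by rewrite /one /principal_char coprimen1.
have Vl0 x y : Vl x y 0 = 1 by rewrite /Vl big_ord1 mulr1.
have hc0 := principal_is_dchar R m.
move=> n0; rewrite -(dconv_mulf (F := fun q => Vl 1 (h q)) (G := fun q => Vl (c0 q) (hb q))) //.
apply: eq_dconv => // d d0.
  rewrite -(dconv_mulf (F := fun q j => 1 ^+ j) (G := fun q j => h q ^+ j)) //; apply: eq_dconv => // k k0.
    by rewrite (mulf_completely (f := fun=> 1)) // => *; rewrite mulr1.
  by rewrite (mulf_completely twist_one twist_mul).
rewrite -(dconv_mulf (F := fun q j => c0 q ^+ j) (G := fun q j => hb q ^+ j)) //.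
apply: eq_dconv => // k k0.
  by rewrite (mulf_completely (dchar1 hc0) (fun a b _ _ => dcharM hc0 a b)).
rewrite (mulf_completely (f := hb)) // /hb; first by rewrite twist_one conjc1.
by move=> a b a0 b0; rewrite twist_mul // rmorphM.
Qed.

(** If q is coprime to m, the two [Vl] are complex conjugates with |h q| = 1 and Ramanujan's
    recursion applies. Otherwise [c0 q] and [h q] vanish, and only the factor 1/(1 - X) remains. *)
Lemma landau_local q : let E a := \sum_(j < a.+1) Vl 1 (h q) j * Vl (c0 q) (hb q) (a - j) in
  (forall a, 0 <= E a) /\ (coprime q m -> forall a, 1 <= E a.*2).
Proof.
move=> E; case: (boolP (coprime q m)) => hq.
  have c1 : c0 q = 1 by rewrite /c0 /principal_char hq.
  have hh : h q * (h q)^* = 1.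
    by rewrite -nm_sqr /h nmM nm_tw mulr1 (nm_dchar m0 hchi hq) expr1n.
  have v0 : Vl 1 (h q) 0 = 1 by rewrite /Vl big_ord1 mulr1.
  have vS a : Vl 1 (h q) a.+1 = 1 + h q * Vl 1 (h q) a.
    rewrite {1}/Vl big_ord_recr /= subnn expr1n mulr1 addrC; congr (_ + _).
    rewrite /Vl mulr_sumr; apply: eq_bigr => i _.
    by rewrite !expr1n !mul1r subSn ?leq_ord // exprS.
  have hE a : E a = \sum_(i < a.+1) Vl 1 (h q) i * (Vl 1 (h q) (a - i))^*.
    apply: eq_bigr => i _; congr (_ * _); rewrite c1 /Vl rmorph_sum; apply: eq_bigr => j _.
    by rewrite rmorphM !rmorphXn rmorph1.
  by have [h1 h2] := ramanujan_pos hh v0 vS hE.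
have c1 : c0 q = 0 by rewrite /c0 /principal_char (negbTE hq).
have h1 : h q = 0 by rewrite /h (dchar_eq0 hchi hq) mul0r.
have V1 a : Vl 1 (h q) a = 1.
  rewrite /Vl h1 big_ord_recr /= subnn expr1n mulr1 big1 ?add0r // => i _.
  by rewrite expr0n subn_eq0 leqNgt ltn_ord mulr0.
have V2 a : 0 <= Vl (c0 q) (hb q) a.
  rewrite /Vl c1 /hb h1 conjc0; apply: sumr_ge0 => i _.
  by rewrite mulr_ge0 // exprn_ge0.
split=> // a; apply: sumr_ge0 => i _; by rewrite V1 mul1r.
Qed.

Lemma landau_ge0 n : (0 < n)%N -> 0 <= e n.
Proof.
move=> n0; rewrite landau_coeff //; apply: prodr_ge0 => q _.
by have [] := landau_local q.
Qed.

Lemma landau_sqr_ge1 d : (0 < d)%N -> coprime d m -> 1 <= e (d ^ 2)%N.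
Proof.
move=> d0 dm; rewrite landau_coeff ?expn_gt0 ?d0 // /mulf primesX // big_seq.
apply: (big_ind (fun x : C => 1 <= x)) => //; first by move=> x y; exact: mulr_ege1.
move=> q; rewrite mem_primes => /and3P[qp _ qd].
have [_ hq] := landau_local q; rewrite lognX mul2n; apply: hq.
exact: coprime_dvdl qd dm.
Qed.

Lemma twisted_L_neq0 : pseval (T h) 1 != 0.
Proof.
apply/negP => /eqP hz.
have nh : nice h := nice_bounded nm_twist.
have nhb : nice hb by apply: (@nice_bounded _ _ 1) => n; rewrite nm_conj nm_twist.
have nc0 : nice c0 := nice_dchar m0 (principal_is_dchar R m).
have no : nice one := nice_dchar (ltn0Sn 0) (principal_is_dchar R 1).
have hps := dchar_partial_sum m0 hchi hne.
have hD j : nm (T h j) * r0 R ^+ j <= m%:R * Ct t by exact: T_twist_bound.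
have Thb j : T hb j = (T h j)^*.
  rewrite /T -ssum_conj; last exact: summable_T.
  by apply: eq_ssum => n; rewrite conj_mul_real.
have hDb j : nm (T hb j) * r0 R ^+ j <= m%:R * Ct t by rewrite Thb nm_conj hD.
have hzb : pseval (T hb) 1 = 0.
  rewrite -conjc0 -hz /pseval -ssum_conj.
    by apply: eq_ssum => j; rewrite Thb !expr1n !mulr1.
  eexists; apply: geo_summable hD; first exact: r0_gt0.
  by rewrite nm1 /r0; lra.
pose J (n : nat) : C := 1.
(* Each factor converges absolutely at 3/2: [etaP] cancels the poles of the two principal series,
   and [T h] and [T hb] may be divided by 1 - z because both vanish at z = 1. *)
pose X := cprod (cprod (cprod (@etaP R) (T one)) (cprod (T h) J))
                (cprod (cprod (@etaP R) (T c0)) (cprod (T hb) J)).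
have gX : geo X.
  apply: geo_cprod; apply: geo_cprod.
  - exact: geo_bound (fun j => etaP_principal_bound R j (ltn0Sn 0)).
  - exact: geo_bound (partial_sums_bound hD hz).
  - exact: geo_bound (fun j => etaP_principal_bound R j m0).
  - exact: geo_bound (partial_sums_bound hDb hzb).
pose Q := cprod (@etaP R) J.
have ne : nice e by apply: nice_dconv; exact: nice_dconv.
(* Regrouped, the same series is [T e] times a square with nonnegative coefficients and constant
   term 1/4, whence [X j] is at least a quarter of [T e j]. *)
have eX : X = cprod (T e) (cprod Q Q).
  rewrite /X /Q [cprod _ (T one)]cprod_comm [cprod _ (T c0)]cprod_comm !(cprodACA (T _) (@etaP R)).
  rewrite [LHS]cprodACA; congr cprod; apply/funext => j.
  rewrite /e T_dconv; [|exact: nice_dconv|exact: nice_dconv].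
  by apply: eq_cprod => i; rewrite T_dconv.
have Te0 j n : 0 <= e n * (wj R j n)%:C.
  case: n => [|n]; first by rewrite wj_0 mulr0.
  by rewrite mulr_ge0 ?landau_ge0 // ler0c wj_ge0.
have Tpos j : 0 <= T e j.
  by have := ssum_ge 0 (summable_T j ne) (Te0 j); rewrite big_ord0.
have Q0 i : 0 <= Q i by exact: etaP_sum_ge0.
have QQ0 i : 0 <= cprod Q Q i by apply: sumr_ge0 => k _; rewrite mulr_ge0.
have TX j : T e j * (1 / 4 : R)%:C <= X j.
  rewrite eX -[cprod (T e) _ j]/(\sum_(i < j.+1) T e i * cprod Q Q (j - i)%N) big_ord_recr /= subnn.
  have -> : cprod Q Q 0 = (1 / 4 : R)%:C.
    rewrite /cprod big_ord1 /= /Q etaP_sum_0 -rmorphM /=; congr (_%:C); by field.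
  by rewrite lerDr; apply: sumr_ge0 => k _; rewrite mulr_ge0.
have [B hB] := gX.
(* In [T e j] only the squares of the numbers 1 + l m are kept; these numbers are coprime to m, so
   [e] is at least 1 at their squares. *)
have bound L J' : \sum_(l < L) \sum_(j < J') wj R j ((1 + l * m) ^ 2) * (3 / 2) ^+ j <= 4 * B.
  rewrite exchange_big /= -ler_pdivrMl //.
  apply: le_trans (hB J'); rewrite mulr_sumr; apply: ler_sum => j _.
  rewrite nmM nmX nm32 -mulr_suml mulrA; apply: ler_wpM2r; first by rewrite exprn_ge0.
  have h1 : (\sum_(l < L) wj R j ((1 + l * m) ^ 2))%:C <= T e j.
    apply: le_trans (ssum_ge ((1 + L * m) ^ 2) (summable_T j ne) (Te0 j)).
    have gi : injective (fun l => (1 + l * m) ^ 2)%N.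
      by move=> a b /eqP; rewrite eqn_exp2r // eqn_add2l eqn_pmul2r // => /eqP.
    have gN l : (l < L)%N -> ((1 + l * m) ^ 2 < (1 + L * m) ^ 2)%N.
      by move=> lL; rewrite ltn_exp2r // ltn_add2l ltn_pmul2r.
    apply: le_trans (sum_inj_le gi gN (Te0 j)); rewrite rmorph_sum; apply: ler_sum => l _.
    rewrite -[X in X <= _]mul1r ler_wpM2r ?ler0c ?wj_ge0 // landau_sqr_ge1 //.
    by rewrite addnC coprime_sym /coprime gcdnMDl gcdn1.
  have s0 : 0 <= \sum_(l < L) wj R j ((1 + l * m) ^ 2) by apply: sumr_ge0 => l _; exact: wj_ge0.
  have h2 : ((1 / 4) * \sum_(l < L) wj R j ((1 + l * m) ^ 2))%:C <= X j.
    apply: le_trans (TX j); rewrite rmorphM mulrC; apply: ler_wpM2r => //.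
    by rewrite ler0c.
  have := nm_le_ge0 _ h2; rewrite ler0c mulr_ge0 // nm_real ger0_norm ?mulr_ge0 // => /(_ isT).
  by rewrite (_ : 1 / 4 = 4^-1) // mul1r.
(* At s = 1/2 the square of d contributes 1/d. *)
have lim_l d : (0 < d)%N -> clim (fun J' => (\sum_(j < J') wj R j (d ^ 2) * (3 / 2) ^+ j)%:C) (d%:R^-1)%:C.
  move=> d0; set x : R := 3 / 2 * ln (d ^ 2)%:R.
  have hx : d%:R^-1 = (d ^ 2)%:R^-1 ^+ 2 * expR x :> R.
    have dn : d%:R != 0 :> R by rewrite pnatr_eq0 -lt0n.
    have -> : x = ln d%:R *+ 3.
      by rewrite /x natrX lnXn ?ltr0n // -[ln _ *+ 2]mulr_natl -[RHS]mulr_natl; field.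
    rewrite -[ln _ *+ 3]mulr_natl expRM_natl lnK ?posrE ?ltr0n // natrX; field.
    exact: dn.
  have -> : (d%:R^-1)%:C = ((d ^ 2)%:R^-1 ^+ 2)%:C * ssum (exp_terms x%:C) :> C.
    by rewrite hx ssum_exp_terms expc_real -rmorphM.
  have hs : summable (exp_terms x%:C) by eexists; exact: summable_exp_terms.
  apply: eq_clim (climZ _ (summable_clim hs)) => J'.
  rewrite mulr_sumr rmorph_sum; apply: eq_bigr => j _.
  rewrite /exp_terms -rmorphXn -(rmorph_nat (real_complex R)) -fmorphV -!rmorphM /wj /x exprMn.
  by congr (_%:C); ring.
have bound2 L : \sum_(l < L) (1 + l * m)%:R^-1 <= 4 * B.
  have := clim_sum (index_enum 'I_L) (fun l : 'I_L => lim_l (1 + l * m)%N (ltn0Sn _)).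
  rewrite -rmorph_sum => hcl; have := clim_Re_le (B := 4 * B) (N := 0%N) hcl.
  apply => J' _; rewrite -rmorph_sum; exact: bound.
apply: (@dvg_harmonic R); apply: nondecreasing_is_cvgn.
  by apply: nondecreasing_series => n _ _; exact: harmonic_ge0.
(* The inequality 1 + l m <= m (l + 1) compares with the harmonic series, which would thus be
   bounded. *)
exists (m%:R * (4 * B)) => _ [N _ <-]; rewrite /series /= big_mkord.
apply: le_trans (ler_wpM2l (ler0n R m) (bound2 N)); rewrite mulr_sumr; apply: ler_sum => l _.
rewrite /harmonic ler_pdivlMr ?ltr0n // mulrC ler_pdivrMr ?ltr0n // -natrM ler_nat.
nia.
Qed.

End Landau.

(** * The zero-free disc, for L and for its truncations *)

Section ZeroFree.
Variable R : realType.
Local Notation C := R[i].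
Local Notation nm := (@Normc.normc R).

(** For Re z < 1 one has Re s > 1. For Re z > 1 the hypothesis would put a zero at Re s = 1/2, that
    is Re z = 3/2 > 5/4. For Re z = 1 a twist moves the point to s = 1, where [twisted_L_neq0]
    applies. *)
Lemma pseval_T_neq0 m (chi : nat -> C) z : GRH R -> (0 < m)%N -> is_dchar m chi ->
  chi <> principal_char R m -> nm z <= 5 / 4 -> pseval (T chi) z != 0.
Proof.
move=> [_ hGRH] m0 hchi hne hz.
have hz0 : nm z < r0 R by rewrite /r0; lra.
have hps := dchar_partial_sum m0 hchi hne.
have nchi := nice_dchar m0 hchi.
have := nm_Re z; rewrite ler_norml => /andP[_ hRe].
case: (ltgtP (complex.Re z) 1) => h1.
- by apply: (pseval_T_neq0_right m0 hchi hz0 h1) => n; exact: hps.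
- apply/eqP => h0; have e := Lfun_pseval hps nchi hz0; rewrite h0 in e.
  have Re2 : complex.Re (2 - z) = 2 - complex.Re z.
    by rewrite ReB -(rmorph_nat (real_complex R) 2).
  have := hGRH m chi m0 hchi hne (2 - z); rewrite Re2 => /(_ _ e) h.
  have : 0 < 2 - complex.Re z < 1 by apply/andP; split; lra.
  by move=> /h; lra.
pose t := - complex.Im z.
have nh : nice (fun n => chi n * tw t n).
  by apply: (@nice_bounded _ _ 1) => n; exact: nm_twist m0 hchi n.
have h11 : nm 1 < r0 R by rewrite nm1 /r0; lra.
suff -> : pseval (T chi) z = pseval (T (fun n => chi n * tw t n)) 1.
  exact: twisted_L_neq0 m0 hchi hne.
have ha : (fun n => chi n * tw 0 n) = chi by apply/funext => n; rewrite tw_0 mulr1.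
have hn0 : nice (fun n => chi n * tw 0 n) by rewrite ha.
have := T_twist_pseval hps hn0 hz0; rewrite ha => h2.
apply: clim_uniq h2 _; apply: eq_clim (T_twist_pseval hps nh h11) => N.
apply: eq_bigr => n _; rewrite tw_0 mulr1 -mulrA; congr (_ * _); rewrite mulrCA; congr (_ * _).
rewrite /tw -expcD mul1r; congr expc.
rewrite [in RHS](_ : z = 1 + 'i * (- t)%:C); last by rewrite {1}[z]complexE h1 /t opprK.
by rewrite rmorphM; ring.
Qed.

Lemma pow_lipschitz (z w : C) (r : R) j : nm z <= r -> nm w <= r ->
  nm (z ^+ j - w ^+ j) <= nm (z - w) * (j%:R * r ^+ j.-1).
Proof.
move=> hz hw; rewrite subrXX nmM; apply: ler_wpM2l; first exact: nm_ge0.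
apply: le_trans (nm_sum _ _ _) _.
apply: (@le_trans _ _ (\sum_(i < j) r ^+ j.-1)); last by rewrite sumr_const card_ord mulr_natl.
apply: ler_sum => i _; rewrite nmM !nmX.
have e : (j.-1 = (j.-1 - i) + i)%N by have := ltn_ord i; lia.
rewrite [in leRHS]e exprD.
by apply: ler_pM; rewrite ?exprn_ge0 ?nm_ge0 // lerXn2r ?nnegrE ?nm_ge0 // (le_trans (nm_ge0 z)).
Qed.

Lemma bounded_cluster_point (zs : nat -> C) (r : R) : (forall k, nm (zs k) <= r) ->
  exists z : C, forall d, 0 < d -> forall K, exists2 k, (K <= k)%N & nm (zs k - z) < d.
Proof.
move=> hz; pose g k : R * R := (complex.Re (zs k), complex.Im (zs k)).
have hc : compact (`[- r, r]%classic `*` `[- r, r]%classic : set (R * R)).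
  by apply: compact_setX; exact: segment_compact.
have [|[x y] [_ hcl]] := hc (g @ \oo)%classic _.
  exists 0%N => // k _ /=; split; rewrite /= in_itv /=.
    by have := le_trans (nm_Re (zs k)) (hz k); rewrite ler_norml.
  by have := le_trans (nm_Im (zs k)) (hz k); rewrite ler_norml.
exists (x +i* y) => d d0 K.
have d2 : 0 < d / 2 by rewrite divr_gt0.
have [||[u v] /= [[k Kk [<- <-]] [h1 h2]]] := hcl [set g k | k in [set k | (K <= k)%N]]%classic
  (ball x (d / 2) `*` ball y (d / 2))%classic.
- by exists K => // k /= hk; exists k.
- by exists (ball x (d / 2), ball y (d / 2)) => //=; split; exact: nbhsx_ballx.
exists k => //; apply: le_lt_trans (nm_ReIm _) _.
have -> : complex.Re (zs k - (x +i* y)) = complex.Re (zs k) - x by rewrite ReB.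
have -> : complex.Im (zs k - (x +i* y)) = complex.Im (zs k) - y by case: (zs k).
move: h1 h2; rewrite /ball /= [`|x - _|]distrC [`|y - _|]distrC; lra.
Qed.

(* Replaces f by polynomials without roots in the disc, whose factorisation can then be used
   instead of the logarithm of f. *)
Lemma truncation_zero_free (c : nat -> C) (D : R) : (forall j, nm (c j) * r0 R ^+ j <= D) ->
  (forall z, nm z <= 5 / 4 -> pseval c z != 0) ->
  exists n0, forall n, (n0 <= n)%N -> forall z, nm z <= 5 / 4 -> \sum_(j < n) c j * z ^+ j != 0.
Proof.
move=> hD h0; apply: contrapT => hno.
have D0 : 0 <= D by apply: le_trans (hD 0%N); rewrite expr0 mulr1 nm_ge0.
have /choice [zs hzs] : forall k, exists zn : C * nat,
    [/\ (k <= zn.2)%N, nm zn.1 <= 5 / 4 & \sum_(j < zn.2) c j * zn.1 ^+ j = 0].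
  move=> k; apply: contrapT => hk; apply: hno; exists k => n kn z hz.
  by apply/eqP => hs; apply: hk; exists (z, n).
have [|z hz] := @bounded_cluster_point (fun k => (zs k).1) (5 / 4); first by move=> k; case: (hzs k).
have hzr : nm z <= 5 / 4.
  rewrite leNgt; apply/negP => hlt.
  have [k _ hk] := hz (nm z - 5 / 4) ltac:(lra) 0%N.
  have [_ h1 _] := hzs k; have := ler_nmB z (zs k).1; rewrite nmBC; lra.
have rp := r0_gt0 R.
pose x : R := 5 / 4 / r0 R.
have x01 : 0 <= x < 1.
  apply/andP; split; first by rewrite /x divr_ge0 // ltW.
  by rewrite /x ltr_pdivrMr // mul1r /r0; lra.
have term w j : nm w <= 5 / 4 -> nm (c j * w ^+ j) <= D * x ^+ j.
  move=> hw; rewrite nmM nmX /x expr_div_n mulrA ler_pdivlMr ?exprn_gt0 // mulrAC.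
  apply: ler_pM; rewrite ?mulr_ge0 ?exprn_ge0 ?nm_ge0 ?(ltW rp) //.
  by apply: lerXn2r => //; rewrite nnegrE ?nm_ge0.
have hgeo N : \sum_(j < N) D * x ^+ j <= D * (1 - x)^-1.
  by rewrite -mulr_sumr ler_wpM2l // geom_sum_le.
suff : pseval c z = 0 by move=> e; have := h0 z hzr; rewrite e eqxx.
apply/eqP; rewrite -nm_eq0 eq_le nm_ge0 andbT leNgt; apply/negP => fpos.
set e := nm (pseval c z) in fpos; have e3 : 0 < e / 3 by rewrite divr_gt0.
have g0 n : 0 <= D * x ^+ n by rewrite mulr_ge0 // exprn_ge0 //; case/andP: x01.
have [M hM] := tail_small g0 hgeo e3.
have tail w : nm w <= 5 / 4 -> forall N, \sum_(M <= j < N) nm (c j * w ^+ j) <= e / 3.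
  move=> hw N; apply: ltW; apply: le_lt_trans (hM N); apply: ler_sum => j _; exact: term.
(* A Lipschitz constant on the disc for the partial sum of length [M]. At the cluster point [z], two
   tails and the move from [z] to a nearby root cost [e / 3] each, the last one strictly less. *)
pose Lp := \sum_(j < M) nm (c j) * (j%:R * (5 / 4) ^+ j.-1).
have Lp0 : 0 <= Lp.
  by apply: sumr_ge0 => j _; rewrite !mulr_ge0 ?nm_ge0 ?exprn_ge0.
have d0 : 0 < e / 3 / (Lp + 1) by rewrite divr_gt0 // ltr_wpDl.
have [k Mk hk] := hz _ d0 M.
have [kn hzk hsk] := hzs k.
have hs : summable (fun j => c j * z ^+ j).
  by exists (D * (1 - x)^-1) => N; apply: le_trans (hgeo N); apply: ler_sum => j _; exact: term.
have h1 : nm (pseval c z - \sum_(j < M) c j * z ^+ j) <= e / 3 := ssum_tail hs (tail z hzr).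
have h2 : nm (\sum_(j < M) c j * (zs k).1 ^+ j) <= e / 3.
  have := hsk; rewrite (sum_ord_split (fun j => c j * (zs k).1 ^+ j) (leq_trans Mk kn)) => /eqP; rewrite addr_eq0 => /eqP ->.
  by rewrite nmN; apply: le_trans (nm_sum _ _ _) _; exact: tail.
have h3 : nm (\sum_(j < M) c j * z ^+ j - \sum_(j < M) c j * (zs k).1 ^+ j) < e / 3.
  rewrite -sumrB; apply: (@le_lt_trans _ _ (nm ((zs k).1 - z) * Lp)).
    apply: le_trans (nm_sum _ _ _) _; rewrite /Lp mulr_sumr; apply: ler_sum => j _.
    rewrite -mulrBr nmM mulrCA; apply: ler_wpM2l; first exact: nm_ge0.
    by rewrite nmBC; apply: pow_lipschitz.
  apply: (@le_lt_trans _ _ (nm ((zs k).1 - z) * (Lp + 1))).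
    by rewrite ler_wpM2l ?nm_ge0 // lerDl.
  by rewrite -ltr_pdivlMr // ltr_wpDl.
have := nmD (pseval c z - \sum_(j < M) c j * z ^+ j) (\sum_(j < M) c j * z ^+ j).
rewrite subrK -/e.
have := nmD (\sum_(j < M) c j * z ^+ j - \sum_(j < M) c j * (zs k).1 ^+ j) (\sum_(j < M) c j * (zs k).1 ^+ j).
rewrite subrK; lra.
Qed.

End ZeroFree.

(** * Power sums of the zeros and coefficients of 1/L *)

Section BorelCaratheodory.
Variable R : realType.
Local Notation C := R[i].
Local Notation nm := (@Normc.normc R).

(* Truncated expansion of log |1 - u|, from the mean value theorem along the segment [0, u]. *)
Lemma log_series (u : C) (kappa : R) n : nm u <= kappa -> kappa < 1 ->
  `|ln (nm (1 - u)) + complex.Re (\sum_(j < n) u ^+ j.+1 / j.+1%:R)| <=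
  kappa ^+ n.+1 / (1 - kappa).
Proof.
move=> hu k1; have k0 : 0 <= kappa by apply: le_trans hu; exact: nm_ge0.
pose a := complex.Re u; pose b := complex.Im u.
(* [p.[x]] is |1 - x u|^2, so [G x] below is ln |1 - x u| plus the real part of the truncated series
   at x u. *)
pose p : {poly R} := 1%:P - (2 * a) *: 'X + (a ^+ 2 + b ^+ 2) *: 'X^2.
pose S : {poly R} := \sum_(j < n) (complex.Re (u ^+ j.+1) / j.+1%:R) *: 'X^(j.+1).
pose v (x : R) : C := x%:C * u.
have pE x : p.[x] = (1 - x * a) ^+ 2 + (x * b) ^+ 2.
  rewrite /p !(hornerD, hornerN, hornerC, hornerZ, hornerX, hornerXn); ring.
have nmv x : (1 - v x) * (1 - v x)^* = (p.[x])%:C.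
  rewrite -nm_sqr nm_sqrE pE ReB ImB /v ReZ ImZ /= sub0r sqrrN //.
have nmv2 x : nm (1 - v x) ^+ 2 = p.[x].
  by apply: (@complexI R); rewrite nm_sqr nmv.
have hv x : 0 <= x <= 1 -> nm (v x) <= kappa.
  move=> /andP[x0 x1]; rewrite nmM nm_real ger0_norm //.
  by apply: le_trans hu; rewrite ler_piMl ?nm_ge0.
have hv1 x : 0 <= x <= 1 -> 1 - kappa <= nm (1 - v x).
  by move=> /hv h; have := ler_nmB 1 (v x); rewrite nm1; lra.
have pp x : 0 <= x <= 1 -> 0 < p.[x].
  move=> hx; rewrite -nmv2 exprn_gt0 //; have := hv1 x hx; lra.
pose G x := 2^-1 * ln p.[x] + S.[x].
pose dG x := 2^-1 * (p.[x]^-1 * p^`().[x]) + S^`().[x].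
have hG (x : R) : 0 <= x <= 1 -> is_derive x 1 G (dG x).
  move=> hx; have h1 : is_derive x 1 (@ln R \o horner p) (p.[x]^-1 * p^`().[x]).
    by apply: is_derive1_comp; apply: is_derive1_ln; exact: pp.
  exact: (is_deriveD (is_deriveZ 2^-1 h1) (is_derive_poly S x)).
have [||c hc] := @MVT_segment R G dG 0 1 ler01 _ _.
- by move=> x; rewrite in_itv /= => /andP[x0 x1]; apply: hG; rewrite !ltW.
- apply: derivable_within_continuous => x; rewrite in_itv /= => hx.
  by have [] := hG x hx.
rewrite in_itv /= in hc.
have -> : G 0 = 0.
  rewrite /G (_ : p.[0] = 1) ?ln1 ?mulr0 ?add0r; last by rewrite pE !mul0r subr0 expr1n expr0n addr0.
  by rewrite /S horner_sum big1 // => j _; rewrite !hornerE expr0n mulr0.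
have -> : G 1 = ln (nm (1 - u)) + complex.Re (\sum_(j < n) u ^+ j.+1 / j.+1%:R).
  rewrite /G; congr (_ + _).
    have v1 : v 1 = u by rewrite /v mul1r.
    have h1 : 0 < nm (1 - u).
      by have := hv1 1; rewrite v1 ler01 lexx => /(_ isT); lra.
    rewrite -nmv2 v1 lnXn // -[ln _ *+ 2]mulr_natl mulrA mulVf ?mul1r // pnatr_eq0.
  rewrite Re_sum /S horner_sum; apply: eq_bigr => j _.
  rewrite !hornerE expr1n mulr1 -(rmorph_nat (real_complex R)) -fmorphV mulrC.
  by rewrite [u ^+ _ * _]mulrC ReZ.
rewrite !subr0 mulr1 => ->.
have nz : 1 - v c != 0.
  by rewrite -nm_gt0; have := hv1 c hc; lra.
(* The truncated series cancels the first n terms of the geometric series in the derivative of ln |1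
   - x u|, and only the remainder is left. *)
have -> : dG c = complex.Re (- (u * v c ^+ n / (1 - v c))).
  have -> : - (u * v c ^+ n / (1 - v c)) = u * \sum_(i < n) v c ^+ i - u / (1 - v c).
    have := subrX1 (v c) n => e.
    have -> : \sum_(i < n) v c ^+ i = (1 - v c ^+ n) / (1 - v c).
      by apply: (mulIf nz); rewrite divfK // -[RHS]opprB e; ring.
    by field.
  rewrite ReB /dG addrC; congr (_ + _).
    rewrite mulr_sumr Re_sum /S (raddf_sum (@deriv R)) horner_sum; apply: eq_bigr => j _.
    rewrite /= derivZ derivXn hornerZ hornerMn hornerXn /= -[c ^+ j *+ _]mulr_natl.
    rewrite mulrA divfK ?pnatr_eq0 // mulrC -ReZ; congr complex.Re.
    by rewrite /v exprMn rmorphXn exprS mulrCA.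
  have -> : u / (1 - v c) = (p.[c]^-1)%:C * (u * (1 - v c)^*).
    have nz' : (1 - v c)^* != 0 by rewrite conjc_eq0.
    rewrite fmorphV /= -nmv invfM; move: nz'; set d := (1 - v c)^* => nz'.
    by rewrite mulrCA -mulrA mulVf // mulr1.
  rewrite ReZ (_ : p^`().[c] = - 2 * complex.Re (u * (1 - v c)^*)).
    by rewrite mulrCA mulNr mulrN mulKf // mulrN.
  have -> : complex.Re (u * (1 - v c)^*) = a * (1 - c * a) - b * (c * b).
    rewrite /v {2}[u]complexE /a /b; case: (u) => x y /=; ring.
  rewrite /p derivD derivB derivC derivZ derivX derivZ derivXn sub0r /= expr1 mulr2n.
  by rewrite !(hornerD, hornerN, hornerZ, hornerX) -polyC1 hornerC; ring.
apply: le_trans (nm_Re _) _; rewrite nmN !nmM nmV nmX exprS.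
apply: ler_pM; rewrite ?mulr_ge0 ?exprn_ge0 ?nm_ge0 ?invr_ge0 ?nm_ge0 //.
  by apply: ler_pM; rewrite ?exprn_ge0 ?nm_ge0 // lerXn2r ?nnegrE ?nm_ge0 // hv.
rewrite lef_pV2 ?posrE ?hv1 //; first by have := hv1 c hc; lra.
lra.
Qed.

Lemma prim_root_exists N : (0 < N)%N -> exists w : C, N.-primitive_root w.
Proof.
move=> N0; have e1 : 'X^N - 1 = 'X^N - 1%:P :> {poly C} by rewrite polyC1.
have [rs] := closed_field_poly_normal ('X^N - 1 : {poly C}).
rewrite e1 lead_coefXnsubC // scale1r => e.
have urs : uniq rs.
  rewrite -separable_prod_XsubC -e -e1.
  by apply: separable_Xn_sub_1; rewrite pnatr_eq0 -lt0n.
have sz : size rs = N.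
  by apply/eqP; rewrite -eqSS -(size_prod_XsubC rs id) -e size_XnsubC.
have ars : all N.-unity_root rs.
  by apply/allP => x xr; rewrite /root_of_unity e1 e root_prod_XsubC.
have /hasP[w _ hw] : has N.-primitive_root rs by apply: has_prim_root; rewrite ?sz.
by exists w.
Qed.

Lemma nm_prim_root (w : C) N : N.-primitive_root w -> nm w = 1.
Proof.
move=> h; have N0 := prim_order_gt0 h; have := prim_expr_order h => e.
apply/eqP; rewrite -(@pexpr_eq1 _ _ N) ?nm_ge0 //.
by rewrite -nmX e nm1.
Qed.

Lemma sum_prim_root (w : C) N k : N.-primitive_root w -> ~~ (N %| k)%N ->
  \sum_(m < N) (w ^+ k) ^+ m = 0.
Proof.
move=> h hk; have := subrX1 (w ^+ k) N.
rewrite -exprM mulnC exprM (prim_expr_order h) expr1n subrr => /esym/eqP.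
rewrite mulf_eq0 subr_eq0 -(prim_order_dvd h) (negbTE hk) /= => /eqP //.
Qed.

Lemma pow_small (kappa K : R) l : 0 <= kappa < 1 -> forall e, 0 < e ->
  exists2 n, (l <= n)%N & K * kappa ^+ n.+1 <= e.
Proof.
move=> hk e e0; have k0 n : 0 <= kappa ^+ n by rewrite exprn_ge0 //; case/andP: hk.
have K1 : 0 < `|K| + 1 by rewrite ltr_wpDl.
have [M hM] := tail_small k0 (fun N => geom_sum_le N hk) (divr_gt0 e0 K1).
exists (maxn l M); first exact: leq_maxl.
apply: (@le_trans _ _ ((`|K| + 1) * kappa ^+ (maxn l M).+1)).
  by apply: ler_wpM2r => //; have := ler_norm K; lra.
rewrite mulrC -ler_pdivlMr //; apply: ltW; apply: le_lt_trans (hM (maxn l M).+2).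
rewrite big_nat_recr /=; last by rewrite (leq_trans (leq_maxr l M)).
by rewrite lerDr sumr_ge0.
Qed.

(* The coefficients of log prod (1 - w z) are -P_l / l; each is recovered from log |.| on the
   circle by averaging over N-th roots of unity. *)
Lemma power_sum_bound (ws : seq C) (c : C) (rho kappa B : R) l :
  0 < rho -> 0 <= kappa < 1 -> (forall w, w \in ws -> rho * nm w <= kappa) -> c != 0 ->
  (forall z, nm z = rho -> nm (c * \prod_(w <- ws) (1 - w * z)) <= B) -> (0 < l)%N ->
  nm (\sum_(w <- ws) w ^+ l) * rho ^+ l <= l%:R * (2 * (ln B - ln (nm c))).
Proof.
move=> rho0 /andP[k0 k1] hws c0 hB l0.
pose P j : C := \sum_(w <- ws) w ^+ j.
pose s (j : nat) : C := P j.+1 * (rho ^+ j.+1)%:C / j.+1%:R.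
suff : nm (s l.-1) <= 2 * (ln B - ln (nm c)).
  rewrite /s prednK // nmM nmV nm_nat nmM nm_real ger0_norm; last by rewrite exprn_ge0 // ltW.
  by rewrite ler_pdivrMr ?ltr0n // [_ * l%:R]mulrC.
apply/ler_addgt0Pr => e e0.
have k01 : 0 <= kappa < 1 by rewrite k0.
have e4 : 0 < e / 4 by rewrite divr_gt0.
(* The final bound is 2 (A + 2 eps), hence the quarter of [e]; [l <= n] keeps the wanted coefficient
   in the truncation. *)
have [n ln_ hn] := @pow_small kappa ((size ws)%:R / (1 - kappa)) l k01 _ e4.
(* The frequencies from -n to n are distinct modulo 2 n + 1, so [T] and its conjugate do not
   alias. *)
pose N := n.*2.+1; have N0 : (0 < N)%N by [].
have [w hw] := prim_root_exists N0.
have wN := prim_expr_order hw; have nw := nm_prim_root hw.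
have wJ k : (k <= N)%N -> (w ^+ k)^* = w ^+ (N - k).
  move=> kN; have u1 : w ^+ k * (w ^+ k)^* = 1 by rewrite -nm_sqr nmX nw !expr1n.
  have wk0 : w ^+ k != 0 by apply/eqP => e1; move/eqP: u1; rewrite e1 mul0r eq_sym oner_eq0.
  by apply: (mulfI wk0); rewrite u1 -exprD subnKC.
pose z m : C := rho%:C * w ^+ m.
have nz m : nm (z m) = rho by rewrite nmM nmX nw expr1n mulr1 nm_real gtr0_norm.
pose F m := ln (nm (c * \prod_(v <- ws) (1 - v * z m))).
pose T m : C := \sum_(j < n) s j * (w ^+ j.+1) ^+ m.
pose eps := (size ws)%:R / (1 - kappa) * kappa ^+ n.+1.
have hvz v m : v \in ws -> nm (v * z m) <= kappa.
  by move=> hv; rewrite nmM nz mulrC hws.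
have npos v m : v \in ws -> 0 < nm (1 - v * z m).
  by move=> /hvz h; have := h m; have := ler_nmB 1 (v * z m); rewrite nm1; lra.
have prodpos m : 0 < nm (\prod_(v <- ws) (1 - v * z m)).
  rewrite nm_prod big_seq; apply: (big_ind (fun x : R => 0 < x)) => //; first by move=> x y; exact: mulr_gt0.
  by move=> v hv; exact: npos.
have hF m : `|F m - (ln (nm c) - complex.Re (T m))| <= eps.
  have -> : F m = ln (nm c) + \sum_(v <- ws) ln (nm (1 - v * z m)).
    rewrite /F nmM lnM ?posrE ?nm_gt0 //; last by rewrite -nm_gt0.
    rewrite nm_prod; congr (_ + _).
    have : all (fun v => 0 < nm (1 - v * z m)) ws by apply/allP => v hv; exact: npos.
    elim: (ws) => [|v r IH] /=; first by rewrite !big_nil ln1.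
    move=> /andP[h1 h2]; rewrite !big_cons lnM ?posrE ?IH //.
    rewrite big_seq; apply: (big_ind (fun x : R => 0 < x)) => //; first by move=> x y; exact: mulr_gt0.
    by move=> u hu; exact: (allP h2).
  have -> : T m = \sum_(v <- ws) \sum_(j < n) (v * z m) ^+ j.+1 / j.+1%:R.
    rewrite exchange_big; apply: eq_bigr => j _; rewrite /s /P -mulr_suml -!mulrA mulr_suml.
    rewrite mulr_suml; apply: eq_bigr => v _.
    rewrite /z !exprMn rmorphXn -exprM mulnC exprM; ring.
  have -> : forall A B D : R, A + B - (A - D) = B + D by move=> *; ring.
  rewrite Re_sum -big_split /=; apply: le_trans (ler_norm_sum _ _ _) _.
  have -> : eps = \sum_(v <- ws) kappa ^+ n.+1 / (1 - kappa).
    by rewrite big_const_seq count_predT iter_addr_0 -[RHS]mulr_natl /eps mulrAC mulrA.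
  rewrite !big_seq.
  by apply: ler_sum => v hv; apply: log_series => //; exact: hvz.
have hFB m : F m <= ln B.
  rewrite /F ler_ln ?posrE ?hB //; first by rewrite nmM mulr_gt0 // nm_gt0.
  apply: lt_le_trans (hB _ (nz m)); by rewrite nmM mulr_gt0 // nm_gt0.
have ndiv k : (0 < k < N)%N -> ~~ (N %| k)%N.
  by move=> /andP[k1' k2]; rewrite gtnNdvd.
have sumT : \sum_(m < N) T m = 0.
  rewrite exchange_big big1 // => j _; rewrite -mulr_sumr (sum_prim_root hw) ?mulr0 //.
  by apply: ndiv; have := ltn_ord j; rewrite /N; lia.
pose g m : C := (w ^+ (N - l)) ^+ m.
have sumg : \sum_(m < N) g m = 0.
  by apply: (sum_prim_root hw); apply: ndiv; rewrite /N; lia.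
have ng m : nm (g m) = 1 by rewrite !nmX nw !expr1n.
have sumgT : \sum_(m < N) g m * T m = N%:R * s l.-1.
  under eq_bigr do rewrite mulr_sumr.
  have l1n : (l.-1 < n)%N by lia.
  rewrite exchange_big (bigD1 (Ordinal l1n)) //= [X in _ + X]big1 ?addr0.
    under eq_bigr => m _.
      rewrite mulrCA /g -exprMn prednK // -exprD subnK; last by rewrite /N; lia.
      rewrite wN expr1n mulr1; over.
    by rewrite sumr_const card_ord mulr_natl.
  move=> j jl; under eq_bigr do rewrite mulrCA /g -exprMn -exprD.
  rewrite -mulr_sumr (sum_prim_root hw) ?mulr0 //.
  have jl' : (j : nat) != l.-1 by apply: contra jl => /eqP h; apply/eqP; apply: val_inj.
  have hj := ltn_ord j; case: (ltnP (N - l + j.+1) N) => h; first by apply: ndiv; lia.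
  have e1 : (N - l + j.+1 = (j.+1 - l) + N)%N by rewrite /N in h *; lia.
  by rewrite e1 dvdn_addl // ndiv // /N in h *; lia.
have sumgTJ : \sum_(m < N) g m * (T m)^* = 0.
  have TJ m : (T m)^* = \sum_(j < n) (s j)^* * (w ^+ (N - j.+1)) ^+ m.
    rewrite rmorph_sum; apply: eq_bigr => j _; rewrite rmorphM rmorphXn /= wJ //.
    by have := ltn_ord j; rewrite /N; lia.
  transitivity (\sum_(m < N) \sum_(j < n) g m * ((s j)^* * (w ^+ (N - j.+1)) ^+ m)).
    by apply: eq_bigr => m _; rewrite -mulr_sumr; congr (_ * _); exact: TJ.
  rewrite exchange_big big1 // => j _.
  under eq_bigr do rewrite mulrCA /g -exprMn -exprD.
  rewrite -mulr_sumr (sum_prim_root hw) ?mulr0 //.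
  have hj := ltn_ord j.
  have e1 : (N - l + (N - j.+1) = (N - l - j.+1) + N)%N by rewrite /N; lia.
  by rewrite e1 dvdn_addl // ndiv // /N; lia.
have sumgRe : \sum_(m < N) g m * (complex.Re (T m))%:C = N%:R / 2 * s l.-1.
  under eq_bigr do rewrite ReJ_add mulrA mulrDr.
  by rewrite -mulr_suml big_split /= sumgT sumgTJ addr0 mulrAC.
pose A := ln B - ln (nm c).
(* As the [g m] sum to 0, the constant ln B can be inserted freely. Now ln B - F m is nonnegative,
   so the sum of its absolute values is N times its mean, and there the mean of Re T is 0. This is
   how an upper bound for |f| alone controls the coefficients. *)
have key : N%:R / 2 * s l.-1 = \sum_(m < N) g m * (ln B - F m)%:C +
   \sum_(m < N) g m * (F m - (ln (nm c) - complex.Re (T m)))%:C.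
  rewrite -sumgRe -big_split /=; apply/eqP; rewrite -subr_eq0 -sumrB.
  have -> : \sum_(i < N) (g i * (complex.Re (T i))%:C - (g i * (ln B - F i)%:C
     + g i * (F i - (ln (nm c) - complex.Re (T i)))%:C)) = - (\sum_(i < N) g i) * A%:C.
    rewrite mulNr mulr_suml -sumrN; apply: eq_bigr => m _; rewrite /A !rmorphB; ring.
  by rewrite sumg oppr0 mul0r.
have b1 : nm (\sum_(m < N) g m * (F m - (ln (nm c) - complex.Re (T m)))%:C) <= N%:R * eps.
  apply: le_trans (nm_sum _ _ _) _.
  apply: (@le_trans _ _ (\sum_(m < N) eps)); last by rewrite sumr_const card_ord mulr_natl.
  by apply: ler_sum => m _; rewrite nmM ng mul1r nm_real.
have b2 : nm (\sum_(m < N) g m * (ln B - F m)%:C) <= N%:R * (A + eps).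
  apply: le_trans (nm_sum _ _ _) _.
  apply: (@le_trans _ _ (\sum_(m < N) (A + complex.Re (T m) + eps))).
    apply: ler_sum => m _; rewrite nmM ng mul1r nm_real ger0_norm ?subr_ge0 //.
    by have := hF m; rewrite ler_norml /A => /andP[]; lra.
  rewrite !big_split /= -Re_sum sumT /= addr0 !sumr_const card_ord -mulrnDl.
  by rewrite -mulrnDl -[_ *+ N]mulr_natl.
have NR : 0 < N%:R :> R by rewrite ltr0n.
have : N%:R / 2 * nm (s l.-1) <= N%:R * (A + 2 * eps).
  have -> : N%:R / 2 * nm (s l.-1) = nm (N%:R / 2 * s l.-1).
    have e2 : nm (N%:R / 2) = N%:R / 2 by rewrite nmM nmV !nm_nat.
    by rewrite [RHS]nmM e2.
  rewrite key; apply: le_trans (nmD _ _) _.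
  have -> : N%:R * (A + 2 * eps) = N%:R * (A + eps) + N%:R * eps by ring.
  exact: lerD.
rewrite -mulrA ler_pM2l // ler_pdivrMl // => h; apply: le_trans h _.
by rewrite /A; move: hn; rewrite -/eps; lra.
Qed.

End BorelCaratheodory.

(** * From power sums to the coefficients of the inverse *)

Section Newton.
Variable R : realType.
Local Notation C := R[i].
Local Notation nm := (@Normc.normc R).

(** Coefficients of the formal derivative. *)
Definition dseq (a : nat -> C) (i : nat) : C := i.+1%:R * a i.+1.

Lemma dseq_cprod a b i : dseq (cprod a b) i = cprod (dseq a) b i + cprod a (dseq b) i.
Proof.
pose p (u : nat -> C) := \poly_(j < i.+2) u j.
have pE u j : (j < i.+2)%N -> (p u)`_j = u j by move=> h; rewrite coef_poly h.
rewrite /dseq (@cprod_poly _ a b _ i.+2) // mulr_natl -coef_deriv derivM coefD !coefM.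
congr (_ + _); apply: eq_bigr => j _; rewrite coef_deriv ?pE ?mulr_natl //.
all: by have := ltn_ord j; lia.
Qed.

Lemma eq_cprod_le (a a' b b' : nat -> C) i : (forall j, (j <= i)%N -> a j = a' j) ->
  (forall j, (j <= i)%N -> b j = b' j) -> cprod a b i = cprod a' b' i.
Proof.
move=> ha hb; apply: eq_bigr => j _; have := ltn_ord j => hj.
by rewrite ha ?hb //; lia.
Qed.

(** This is the logarithmic derivative of the product: each factor contributes - w / (1 - w z), and
    multiplying by 1 - w z collapses the geometric series of w to a constant. *)
Lemma newton_identity (ws : seq C) (p := \prod_(w <- ws) (1 - w *: 'X)) i :
  p^`()`_i = - cprod (fun l => \sum_(w <- ws) w ^+ l.+1) (fun j => p`_j) i.
Proof.
rewrite {}/p; elim: ws i => [|w ws IH] i.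
  by rewrite big_nil -polyC1 derivC coef0 /cprod big1 ?oppr0 // => j _; rewrite big_nil mul0r.
set p := \prod_(w <- ws) (1 - w *: 'X) in IH.
set P := fun l => \sum_(w <- ws) w ^+ l.+1 in IH.
have -> : cprod (fun l => \sum_(v <- w :: ws) v ^+ l.+1)
            (fun j => (\prod_(v <- w :: ws) (1 - v *: 'X))`_j) i =
    cprod (fun l => w ^+ l.+1 + P l) (cprod (fun j => (1 - w *: 'X)`_j) (fun j => p`_j)) i.
  by apply: eq_cprod => j; rewrite ?big_cons ?coefM.
rewrite cprodDl.
have h1 : cprod (fun l => w ^+ l.+1) (fun j => (1 - w *: 'X)`_j) =1 fun l => w * (l == 0)%N%:R.
  move=> j; rewrite /cprod; case: j => [|j].
    by rewrite big_ord1 coefB coef1 coefZ coefX mulr0 subr0 !mulr1 expr1.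
  rewrite mulr0 !big_ord_recr /= big1 => [|l _].
    rewrite !coefB !coef1 !coefZ !coefX /= subnn subSnn /= !exprS; ring.
  have e : (j.+1 - l = (j - l).-1.+2)%N by have := ltn_ord l; lia.
  by rewrite coefB coef1 coefZ coefX e /= mulr0 subr0 mulr0.
rewrite cprodA (eq_cprod h1 (frefl _)).
have -> : cprod (fun l : nat => w * (l == 0)%N%:R) (fun j => p`_j) i = w * p`_i.
  by rewrite -[in RHS](cprod1 (fun j => p`_j)) /cprod mulr_sumr; apply: eq_bigr => l _; rewrite mulrA.
rewrite (_ : cprod P _ = cprod (fun j => (1 - w *: 'X)`_j) (cprod P (fun j => p`_j))); last first.
  by rewrite cprod_assoc [cprod P _]cprod_comm -cprod_assoc.
rewrite big_cons derivM derivB derivC derivZ derivX sub0r mulNr -scalerAl mul1r.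
rewrite coefD coefN coefZ opprD; congr (_ + _).
by rewrite coefM /cprod -sumrN; apply: eq_bigr => l _; rewrite IH mulrN.
Qed.

Lemma reciprocal_factorization (p : {poly C}) : p.[0] != 0 ->
  exists2 ws : seq C, p = p.[0] *: \prod_(w <- ws) (1 - w *: 'X) &
    forall w, w \in ws -> w != 0 /\ root p w^-1.
Proof.
move=> p0; have [rs e] := closed_field_poly_normal p.
have l0 : lead_coef p != 0.
  by rewrite lead_coef_eq0; apply: contra p0 => /eqP ->; rewrite horner0.
have rsr z : z \in rs -> z != 0 /\ root p z.
  move=> hz; have rz : root p z by rewrite e rootZ // root_prod_XsubC.
  by split => //; apply: contra p0 => /eqP z0; rewrite z0 in rz.
exists [seq z^-1 | z <- rs]; last first.
  by move=> w /mapP[z hz ->]; rewrite invrK invr_eq0; exact: rsr.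
have : exists d, p = d *: \prod_(w <- [seq z^-1 | z <- rs]) (1 - w *: 'X).
  exists (lead_coef p * \prod_(z <- rs) - z); rewrite big_map {1}e -scalerA; congr (_ *: _).
  rewrite -scaler_prod big_seq [RHS]big_seq; apply: eq_bigr => z /rsr [z0 _].
  by rewrite scaleNr scalerBr scalerA mulfV // scale1r opprB alg_polyC.
move=> [d hd]; suff -> : p.[0] = d by [].
rewrite hd hornerZ horner_prod big1 ?mulr1 // => w _.
by rewrite hornerD hornerN hornerZ hornerX mulr0 subr0 hornerE.
Qed.

Lemma seq_bound_lt1 (s : seq C) (f : C -> R) : (forall w, w \in s -> f w < 1) ->
  exists2 kappa, 0 <= kappa < 1 & forall w, w \in s -> f w <= kappa.
Proof.
elim: s => [|v s IH] h; first by exists 0; rewrite ?lexx ?ltr01.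
have [|k /andP[k0 k1] hk] := IH; first by move=> w hw; rewrite h // inE hw orbT.
exists (Num.max k (f v)); first by rewrite le_max k0 gt_max k1 h // mem_head.
move=> w; rewrite inE le_max => /orP[/eqP ->|/hk ->//]; first by rewrite lexx orbT.
Qed.

(** 90 is the value of the full series, x / (1 - x)^2 at x = 9/10. *)
Lemma sum_arith_geom_le m : \sum_(l < m) l.+1%:R * (9 / 10) ^+ l.+1 <= 90 :> R.
Proof.
have e : \sum_(l < m) l.+1%:R * (9 / 10) ^+ l.+1 = 90 - (9 * m%:R + 90) * (9 / 10) ^+ m :> R.
  elim: m => [|m IH]; first by rewrite big_ord0 expr0; ring.
  rewrite big_ord_recr /= IH exprS -[m.+1]addn1 natrD; by field.
by rewrite e gerBl mulr_ge0 ?exprn_ge0 // ?addr_ge0 ?mulr_ge0 //; lra.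
Qed.

(** The majorant [M i] equals D^i / i! while i <= D and is constant afterwards, so it never exceeds
    e^D. With D of order log q this is a power of q, uniformly in j. *)
Lemma newton_growth (y b : nat -> R) (D : R) N :
  (forall j, 0 <= y j) -> (forall l, 0 <= b l) -> (forall m, \sum_(l < m) b l <= D) ->
  (forall i, (i < N)%N -> i.+1%:R * y i.+1 <= \sum_(l < i.+1) b l * y (i - l)%N) ->
  forall j, (j <= N)%N -> y j <= y 0%N * expR D.
Proof.
move=> y0 b0 hD hrec; have D0 : 0 <= D by have := hD 0%N; rewrite big_ord0.
pose M i : R := \prod_(m < i) Num.max 1 (D / m.+1%:R).
have M1 i : 0 <= M i by apply: prodr_ge0 => m _; rewrite le_max ler01.
have Mle i : M i <= M i.+1.
  by rewrite /M big_ord_recr /= -/(M i) ler_peMr // le_max lexx.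
have Mexp i : M i <= expR D /\ (i%:R <= D -> M i = D ^+ i / i`!%:R).
  elim: i => [|i [IH1 IH2]]; first by rewrite /M big_ord0 expr0 invr1 mulr1 -expR0 ler_expR.
  have e : M i.+1 = M i * Num.max 1 (D / i.+1%:R) by rewrite /M big_ord_recr.
  have [h|h] := leP i.+1%:R D; last first.
    by split=> //; rewrite e max_l ?mulr1 // ler_pdivrMr ?mul1r ?ltW.
  have e2 : M i.+1 = D ^+ i.+1 / i.+1`!%:R.
    rewrite e IH2; last by apply: le_trans h; rewrite ler_nat.
    rewrite max_r; last by rewrite ler_pdivlMr ?mul1r.
    by rewrite factS natrM invfM exprSr mulrACA [_^-1 * _]mulrC.
  by split => // ; rewrite e2; exact: exp_term_le.
have key i : (i <= N)%N -> forall m, (m <= i)%N -> y m <= y 0%N * M i.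
  elim: i => [|i IH] iN m; first by rewrite leqn0 => /eqP ->; rewrite /M big_ord0 mulr1.
  have {}IH := IH (ltnW iN).
  rewrite leq_eqVlt => /orP[/eqP ->|mi]; last first.
    by apply: le_trans (IH _ mi) _; exact: ler_wpM2l.
  have h : i.+1%:R * y i.+1 <= D * (y 0%N * M i).
    apply: le_trans (hrec i iN) _.
    apply: (@le_trans _ _ (\sum_(l < i.+1) b l * (y 0%N * M i))).
      by apply: ler_sum => l _; apply: ler_wpM2l => //; apply: IH; exact: leq_subr.
    by rewrite -mulr_suml; apply: ler_wpM2r; rewrite ?mulr_ge0.
  rewrite -ler_pdivlMl ?ltr0n // in h; apply: le_trans h _.
  rewrite (_ : _ * (D * _) = y 0%N * (M i * (D / i.+1%:R))); last by ring.
  rewrite ler_wpM2l // /M big_ord_recr /= -/(M i) ler_wpM2l //.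
  by rewrite le_max lexx orbT.
move=> j jN; apply: le_trans (key j jN j (leqnn _)) _.
by apply: ler_wpM2l => //; case: (Mexp j).
Qed.

(* The power sums P_l of the inverse roots satisfy |P_l| (9/8)^l <= 2 A l (9/10)^l, which sums to
   180 A; 7/2 is the value of 1/(1 - (5/4)/(7/4)). *)
Lemma inverse_coeff_bound (a c : nat -> C) (D : R) :
  (forall j, nm (c j) * r0 R ^+ j <= D) -> (forall z, nm z <= 5 / 4 -> pseval c z != 0) ->
  (forall j, cprod a c j = (j == 0)%N%:R) ->
  forall j, nm (a j) * (9 / 8) ^+ j <= nm (a 0%N) * expR (180 * (ln (7 / 2 * D) - ln (nm (c 0%N)))).
Proof.
move=> hc hz hac j.
have [n0 hn0] := truncation_zero_free hc hz.
(* The truncation is long enough to be zero-free and to share with [c] all coefficients up to index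
   j + 1. *)
pose n := (maxn n0 j.+2); have n0n : (n0 <= n)%N by rewrite leq_maxl.
have jn : (j.+1 < n)%N by rewrite leq_maxr.
pose p : {poly C} := \poly_(i < n) c i.
have pz z : p.[z] = \sum_(i < n) c i * z ^+ i by rewrite horner_poly.
have pc i : (i < n)%N -> p`_i = c i by move=> h; rewrite coef_poly h.
have p0 : p.[0] = c 0%N by rewrite horner_coef0 pc //; lia.
have c0 : c 0%N != 0.
  apply/eqP => h; move: (hac 0%N); rewrite /cprod big_ord1 h mulr0 => /esym/eqP.
  by rewrite oner_eq0.
have [|ws hp hws] := @reciprocal_factorization p; first by rewrite p0.
rewrite p0 in hp.
have rootp z : root p z -> 5 / 4 < nm z.
  move=> /rootP h; rewrite ltNge; apply/negP => hz'.
  by have := hn0 n n0n z hz'; rewrite -pz h eqxx.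
(* Finitely many roots strictly outside the closed disc leave a positive margin; the bound of
   [power_sum_bound] is uniform in it. *)
have [|kappa hk hkw] := @seq_bound_lt1 ws (fun w => 5 / 4 * nm w).
  move=> w /hws [w0 /rootp]; rewrite nmV => h.
  have w1 : 0 < nm w by rewrite nm_gt0.
  by rewrite -ltr_pdivlMr // mul1r.
pose A := ln (7 / 2 * D) - ln (nm (c 0%N)).
pose P l : C := \sum_(w <- ws) w ^+ l.+1.
have hP l : nm (P l) * (9 / 8) ^+ l.+1 <= 2 * A * (l.+1%:R * (9 / 10) ^+ l.+1).
  have -> : (9 / 8 : R) = 5 / 4 * (9 / 10) by field.
  rewrite exprMn !mulrA; apply: ler_wpM2r; first by rewrite exprn_ge0 //; lra.
  rewrite [2 * A * _]mulrC.
  apply: (@power_sum_bound R ws (c 0%N) (5 / 4) kappa (7 / 2 * D) l.+1) => //.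
  move=> z nz; have -> : c 0%N * \prod_(w <- ws) (1 - w * z) = p.[z].
    rewrite hp hornerZ horner_prod; congr (_ * _); apply: eq_bigr => w _.
    by rewrite hornerD hornerN hornerZ hornerX hornerE.
  rewrite pz; apply: le_trans (nm_sum _ _ _) _.
  have := @geo_summable R c D (r0 R) z (r0_gt0 R) _ hc n; rewrite nz => /(_ _) h.
  apply: le_trans (h _) _; first by rewrite /r0; lra.
  by rewrite mulrC le_eqVlt; apply/orP; left; apply/eqP; congr (_ * _); rewrite /r0; field.
have hA : 0 <= A.
  rewrite subr_ge0 ler_ln ?posrE ?nm_gt0 //.
    have := hc 0%N; rewrite expr0 mulr1; have := nm_ge0 (c 0%N); lra.
  have := hc 0%N; rewrite expr0 mulr1; have : 0 < nm (c 0%N) by rewrite nm_gt0.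
  by lra.
have dc i : (i < j.+1)%N -> dseq c i = - cprod P c i.
  move=> ij; have := newton_identity ws i; rewrite -/P => h.
  have : (c 0%N)*: (\prod_(w <- ws) (1 - w *: 'X))^`() = p^`() by rewrite -derivZ -hp.
  move=> /(congr1 (fun q : {poly C} => q`_i)); rewrite coefZ h coef_deriv pc; last by lia.
  rewrite /dseq mulr_natl => <-; rewrite mulrN; congr (- _).
  rewrite /cprod mulr_sumr; apply: eq_bigr => l _; rewrite mulrCA; congr (_ * _).
  by rewrite -coefZ -hp pc //; have := ltn_ord l; lia.
(* From a c = 1 and c' = - P c follows a' c = - a c' = P a c, and multiplication by a gives a' = P
   a, all up to index j. *)
have da i : (i < j.+1)%N -> dseq a i = cprod P a i.
  move=> ij.
  have h1 k : (k <= i)%N -> cprod (dseq a) c k = cprod (cprod P a) c k.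
    move=> ki; have := dseq_cprod a c k.
    have -> : dseq (cprod a c) k = 0 by rewrite /dseq hac mulr0.
    rewrite (@eq_cprod_le a a (dseq c) (fun l => - cprod P c l)) //; last first.
      by move=> l lk; apply: dc; lia.
    move=> /esym/eqP; rewrite addr_eq0 => /eqP ->.
    rewrite -[cprod P a]cprod_comm -cprod_assoc.
    by rewrite /cprod -sumrN; apply: eq_bigr => l _; rewrite mulrN opprK.
  have h2 u : cprod (cprod u c) a i = u i.
    rewrite -cprod_assoc cprod_comm -[RHS](cprod1 u); apply: eq_cprod => // l.
    by rewrite cprod_comm hac.
  by rewrite -h2 -[RHS]h2; apply: eq_cprod_le.
pose y i := nm (a i) * (9 / 8) ^+ i; pose b l := nm (P l) * (9 / 8) ^+ l.+1.
have r0 i : 0 <= (9 / 8 : R) ^+ i by rewrite exprn_ge0 //; lra.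
have -> : nm (a 0%N) = y 0%N by rewrite /y expr0 mulr1.
rewrite -/(y j); apply: (@newton_growth y b _ j) => // [i|l|m|i ij].
- by rewrite /y mulr_ge0 ?nm_ge0.
- by rewrite /b mulr_ge0 ?nm_ge0.
- apply: (@le_trans _ _ (\sum_(l < m) 2 * A * (l.+1%:R * (9 / 10) ^+ l.+1))).
    by apply: ler_sum => l _; exact: hP.
  rewrite -mulr_sumr (_ : 180 = 2 * 90); last by ring.
  rewrite -/A [leRHS]mulrAC; apply: ler_wpM2l; rewrite ?mulr_ge0 //; exact: sum_arith_geom_le.
rewrite /y mulrA -nm_nat -nmM -/(dseq a i) da; last by lia.
apply: (@le_trans _ _ ((\sum_(l < i.+1) nm (P l * a (i - l)%N)) * (9 / 8) ^+ i.+1)).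
  by apply: ler_wpM2r => //; exact: nm_sum.
rewrite mulr_suml; apply: ler_sum => l _; rewrite /b nmM.
have e : i.+1 = (l.+1 + (i - l))%N by have := ltn_ord l; lia.
have -> : (9 / 8 : R) ^+ i.+1 = (9 / 8) ^+ l.+1 * (9 / 8) ^+ (i - l) by rewrite -exprD -e.
by rewrite mulrACA.
Qed.

End Newton.

(** * Orthogonality of characters *)

Section Orthogonality.
Variable R : realType.
Local Notation C := R[i].

(** The kernels of the irreducible characters meet trivially. Their values are algebraic numbers,
    here |G|-th roots of unity; they are carried to [C] through exponents with respect to primitive
    roots [w] and [W] of the same order in the two fields. *)
Lemma abelian_separation (gT : finGroupType) (G : {group gT}) (x : gT) :
  abelian G -> x \in G -> x != 1%g ->
  exists f : gT -> C, [/\ f 1%g = 1, {in G &, forall g h, f (g * h)%g = f g * f h},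
    forall g, f g != 0 & f x != 1].
Proof.
move=> abG xG x1; have N0 := cardG_gt0 G.
have [i hi] : exists i : Iirr G, ('chi[G]_i x != 1)%R.
  apply/existsP; apply: contraNT x1 => /existsPn h.
  suff : x \in \bigcap_(i : Iirr G) cfker 'chi[G]_i by rewrite TI_cfker_irr inE.
  apply/bigcapP => i _; rewrite cfkerEirr inE lin_char1; last exact/char_abelianP.
  by have := h i; rewrite negbK.
have li : 'chi[G]_i \is a linear_char by exact/char_abelianP.
have [w hw] := C_prim_root_exists N0; have [W hW] := prim_root_exists R N0.
have hr g : g \in G -> exists e : nat, 'chi[G]_i g = w ^+ e.
  move=> gG; have [|e ->] := prim_rootP hw (x := 'chi[G]_i g); last by exists e.
  by rewrite -lin_charX // (expg_cardG gG) lin_char1.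
pose e g : nat := xget 0%N [set e | 'chi[G]_i g = w ^+ e]%classic.
have he g : g \in G -> 'chi[G]_i g = w ^+ e g.
  by move=> /hr [n hn]; exact: (@xgetI _ 0%N [set e | 'chi[G]_i g = w ^+ e]%classic n hn).
have eqW m n : w ^+ m = w ^+ n -> W ^+ m = W ^+ n.
  by move=> /eqP; rewrite (eq_prim_root_expr hw) -(eq_prim_root_expr hW) => /eqP.
exists (fun g => W ^+ e g); split.
- rewrite -[RHS](expr0 W); apply: eqW; rewrite -he ?group1 // expr0; exact: lin_char1.
- move=> g h gG hG; rewrite -exprD; apply: eqW.
  by rewrite exprD -!he ?groupM // lin_charM.
- by move=> g; rewrite expf_neq0 // -nm_gt0 (nm_prim_root hW).
- apply: contra hi => /eqP h; rewrite (he x xG) -(expr0 w).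
  by rewrite (eq_prim_root_expr hw) -(eq_prim_root_expr hW) h expr0.
Qed.

Variable q : nat.
Hypothesis q1 : (1 < q)%N.

Let q0 : (0 < q)%N. Proof. exact: ltnW. Qed.

Definition unitZ (n : nat) : {unit 'Z_q} := insubd (1%g : {unit 'Z_q}) (n%:R : 'Z_q).

Lemma val_unitZ n : coprime n q -> val (unitZ n) = n%:R :> 'Z_q.
Proof. by move=> h; rewrite val_insubd unitZpE // coprime_sym h. Qed.

Lemma dchar_separation n : coprime n q -> n != 1 %[mod q] ->
  exists2 chi : nat -> C, is_dchar q chi & chi n != 1.
Proof.
move=> cn n1; have [|f [f1 fM f0 fn]] := @abelian_separation _ _ (unitZ n) (units_Zp_abelian q) (finset.in_setT _).
  apply: contra n1 => /eqP h; have e : n%:R = 1%:R :> 'Z_q by rewrite -(val_unitZ cn) h.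
  by have := congr1 (@nat_of_ord _) e; rewrite !val_Zp_nat // => ->.
exists (fun k => if coprime k q then f (unitZ k) else 0); last by rewrite cn.
split=> [k|a b||k].
- rewrite coprime_mul_add; case: ifP => // ck; congr f; apply: val_inj.
  by rewrite !val_unitZ ?coprime_mul_add // natrD pchar_Zp // addr0.
- rewrite coprimeMl; case: (boolP (coprime a q)) => ca; last by rewrite mul0r.
  case: (boolP (coprime b q)) => cb; last by rewrite mulr0.
  rewrite /= -fM ?inE //; congr f; apply: val_inj.
  by rewrite /= !val_unitZ ?coprimeMl ?ca ?cb // natrM.
- rewrite coprime1n -f1; congr f; apply: val_inj.
  by rewrite val_unitZ ?coprime1n.
- by case: ifP => _; rewrite ?f0 ?eqxx.
Qed.

(* A character is determined by its exponents with respect to a fixed root of unity of order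
   phi(q), so there are finitely many. *)
Lemma dchar_finite : exists2 s : seq (nat -> C), uniq s & forall chi, chi \in s <-> is_dchar q chi.
Proof.
have t0 : (0 < totient q)%N by rewrite totient_gt0.
have [W hW] := prim_root_exists R t0.
pose chr (g : {ffun 'I_q -> 'I_(totient q)}) (n : nat) : C :=
  if coprime n q then W ^+ g (Ordinal (ltn_pmod n q0)) else 0.
pose s := undup [seq chi <- [seq chr g | g <- enum {ffun 'I_q -> 'I_(totient q)}] | `[< is_dchar q chi >]].
exists s; first exact: undup_uniq.
move=> chi; rewrite mem_undup mem_filter; split=> [/andP[/asboolP //]|h].
apply/andP; split; first exact/asboolP.
have hr n : exists e : 'I_(totient q), coprime n q -> chi n = W ^+ e.
  case: (boolP (coprime n q)) => cn; last by exists (Ordinal t0).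
  by have [e he] := prim_rootP hW (dchar_totient h cn); exists e.
have [e he] := boolp.choice hr.
apply/mapP; exists [ffun i : 'I_q => e i]; first by rewrite mem_enum.
apply/funext => n; rewrite /chr ffunE /=; case: ifP => cn.
  by rewrite -(dchar_mod h) he // coprime_modl.
by rewrite (dchar_eq0 h) // cn.
Qed.

Lemma dchar_mul (chi psi : nat -> C) : is_dchar q chi -> is_dchar q psi ->
  is_dchar q (fun n => chi n * psi n).
Proof.
move=> [a1 a2 a3 a4] [b1 b2 b3 b4]; split=> [n|m n||n].
- by rewrite a1 b1.
- by rewrite a2 b2 mulrACA.
- by rewrite a3 b3 mulr1.
- by rewrite mulf_eq0 negb_or a4 b4 andbb.
Qed.

Lemma sum_dchar_mul (s : seq (nat -> C)) (psi : nat -> C) (F : (nat -> C) -> C) :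
  uniq s -> (forall chi, chi \in s <-> is_dchar q chi) -> is_dchar q psi ->
  \sum_(chi <- s) F (fun n => psi n * chi n) = \sum_(chi <- s) F chi.
Proof.
move=> us hs hpsi; rewrite -(big_map (fun chi n => psi n * chi n) xpredT F).
apply: perm_big; have inj : {in s &, injective (fun (chi : nat -> C) n => psi n * chi n)}.
  move=> chi chi' /hs hc /hs hc' e; apply/funext => n.
  case: (boolP (coprime n q)) => cn; last by rewrite !(dchar_eq0 _ cn).
  have : psi n != 0 by rewrite (dchar_neq0 hpsi).
  by move=> /mulfI; apply; exact: (congr1 (fun g => g n) e).
apply: uniq_perm => //; first by rewrite map_inj_in_uniq.
have sub : {subset [seq (fun n => psi n * chi n) | chi <- s] <= s}.
  by move=> _ /mapP[chi /hs hc ->]; apply/hs; exact: dchar_mul.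
have us2 : uniq [seq (fun n => psi n * chi n) | chi <- s] by rewrite map_inj_in_uniq.
by have [|] := uniq_min_size us2 sub; rewrite ?size_map.
Qed.

Lemma sum_dchar_eq0 (s : seq (nat -> C)) n : uniq s ->
  (forall chi, chi \in s <-> is_dchar q chi) -> n != 1 %[mod q] -> \sum_(chi <- s) chi n = 0.
Proof.
move=> us hs n1; case: (boolP (coprime n q)) => cn; last first.
  by rewrite big_seq big1 // => chi /hs h; rewrite (dchar_eq0 h).
have [psi hpsi pn] := dchar_separation cn n1.
have := sum_dchar_mul (fun chi => chi n) us hs hpsi.
rewrite -mulr_sumr => /eqP; rewrite -subr_eq0 -[X in _ - X]mul1r -mulrBl mulf_eq0 subr_eq0.
by rewrite (negbTE pn) => /eqP.
Qed.

(** Sum chi(n) over all characters and a full period in two ways: for fixed chi only the principal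
    character contributes, for fixed n only n = 1. *)
Lemma size_dchar (s : seq (nat -> C)) : uniq s ->
  (forall chi, chi \in s <-> is_dchar q chi) -> size s = totient q.
Proof.
move=> us hs; apply/eqP; rewrite -(eqr_nat C); apply/eqP.
have e1 : \sum_(chi <- s) \sum_(n < q) chi n = (totient q)%:R.
  rewrite (bigD1_seq (principal_char R q)) //=; last by apply/hs; exact: principal_is_dchar.
  rewrite [X in _ + X]big_seq_cond [X in _ + X]big1 ?addr0 => [|chi /andP[/hs h1 /eqP h2]]; last first.
    by rewrite (sum_period q0 h1).
  rewrite totient_count_coprime natr_sum big_mkord; apply: eq_bigr => i _.
  by rewrite /principal_char coprime_sym; case: coprime.
rewrite -e1 exchange_big (bigD1 (Ordinal q1)) //= [X in _ + X]big1 ?addr0.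
  rewrite big_seq (eq_bigr (fun=> 1)); last by move=> chi /hs h; rewrite (dchar1 h).
  by rewrite -big_seq big_const_seq count_predT iter_addr_0.
move=> i i1; apply: sum_dchar_eq0 => //.
by rewrite !modn_small.
Qed.

Lemma dchar_orthogonality (s : seq (nat -> C)) a b : uniq s ->
  (forall chi, chi \in s <-> is_dchar q chi) -> coprime a q -> coprime b q ->
  \sum_(chi <- s) chi a * (chi b)^* = (totient q)%:R * (a == b %[mod q])%:R.
Proof.
move=> us hs ca cb; case: eqP => /= h.
  rewrite mulr1 -(size_dchar us hs) big_seq (eq_bigr (fun=> 1)).
    by rewrite -big_seq big_const_seq count_predT iter_addr_0.
  move=> chi /hs hc; rewrite (dchar_eqmod hc h) //.
  exact: (dchar_conj q0 hc).
pose c := (b ^ (totient q).-1)%N.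
have t0 : (0 < totient q)%N by rewrite totient_gt0.
have bc : (b * c = 1 %[mod q])%N by rewrite /c -expnS prednK // Euler_exp_totient.
rewrite mulr0 -[RHS](@sum_dchar_eq0 s (a * c)) //.
  rewrite big_seq [RHS]big_seq; apply: eq_bigr => chi /hs hc.
  rewrite (dcharM hc); congr (_ * _).
  have nb : chi b != 0 by rewrite (dchar_neq0 hc).
  apply: (mulfI nb); rewrite (dchar_conj q0 hc) // -(dcharM hc).
  by rewrite (dchar_eqmod hc bc) (dchar1 hc).
apply/eqP => h2; apply: h; rewrite -[a]muln1 -modnMmr -bc modnMmr mulnCA.
by rewrite -modnMmr h2 modnMmr muln1.
Qed.

(** Evenness is detected by (1 + chi(-1)) / 2, as chi(-1) is 1 or -1; the second half is
    orthogonality for the pair -a, b. *)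
Lemma even_orthogonality (s : seq (nat -> C)) a b : uniq s ->
  (forall chi, chi \in s <-> is_dchar q chi) -> coprime a q -> coprime b q ->
  \sum_(chi <- s | chi (q - 1)%N == 1) chi a * (chi b)^* =
  (totient q)%:R / 2 * ((a == b %[mod q])%:R + (q %| a + b)%:R).
Proof.
move=> us hs ca cb.
have cq : coprime (q - 1) q by rewrite -{2}(subnK q0) addn1 coprimenS.
have cqa : coprime ((q - 1) * a) q by rewrite coprimeMl cq.
have e1 : (q %| a + b)%N = ((q - 1) * a == b %[mod q])%N.
  by rewrite -(eqn_modDr a) -mulSnr subn1 prednK // addnC /dvdn [(b + a)%N]addnC modnMr eq_sym.
rewrite mulrDr e1 ![_ / 2 * _]mulrAC -!(dchar_orthogonality us hs) // -mulrDl.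
rewrite -big_split big_mkcond /= mulr_suml big_seq [RHS]big_seq; apply: eq_bigr => chi /hs hc.
rewrite (dcharM hc).
have : chi (q - 1)%N ^+ 2 = 1.
  rewrite expr2 -(dcharM hc) -(dchar1 hc); apply: (dchar_eqmod hc).
  have -> : ((q - 1) * (q - 1) = (q - 2) * q + 1)%N by nia.
  by rewrite modnMDl.
have n2 : (2 : C) != 0 by rewrite pnatr_eq0.
move=> /eqP; rewrite sqrf_eq1 => /orP[/eqP ->|/eqP ->].
  by rewrite eqxx mul1r -mulr2n -[_ *+ 2]mulr_natr mulfK.
have -> : (-1 == 1 :> C) = false.
  by rewrite -subr_eq0 -opprD oppr_eq0; exact: (negbTE n2).
by rewrite mulN1r mulNr subrr mul0r.
Qed.

End Orthogonality.

(** * Truncation of L(1, chi)^{-k} *)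

Section TruncatedWeight.
Variable R : realType.

(* Partial sums in [j] of the expansion 1/n = sum_j n^-2 (ln n)^j / j! of n^{-s} at s = 1
   around s = 2. *)
Definition om (J n : nat) : R := \sum_(j < J) wj R j n.

Lemma om_ge0 J n : 0 <= om J n.
Proof. by apply: sumr_ge0 => j _; exact: wj_ge0. Qed.

Lemma om_0 J : om J 0 = 0.
Proof. by rewrite /om big1 // => j _; exact: wj_0. Qed.

(** Rankin's trick: for j < J and r <= 1 the factor r^{j-J} is at least 1, and the full sum of the
    r^j [wj] is at most n^{r-2}. *)
Lemma om_le (r : R) J n : 0 < r <= 1 -> om J n <= r^-1 ^+ J * powR n%:R (r - 2).
Proof.
move=> /andP[r0 r1]; rewrite exprVn mulrC ler_pdivlMr ?exprn_gt0 //.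
apply: le_trans (wj_sum_le J n (ltW r0)); rewrite mulr_suml; apply: ler_sum => j _.
rewrite mulrC; apply: ler_wpM2r; first exact: wj_ge0.
by apply: ler_wiXn2l; rewrite ?(ltW r0) // ltnW.
Qed.

Lemma om_le_inv J n : om J n <= n%:R^-1.
Proof.
have := @om_le 1 J n; rewrite ltr01 lexx invr1 expr1n mul1r => /(_ isT) h; apply: le_trans h _.
by rewrite (_ : 1 - 2 = -1 :> R) ?powR_inv1 //; ring.
Qed.

(** The same trick for the omitted terms j >= J, now with r >= 1. *)
Lemma om_tail (r : R) J n : 1 <= r -> n%:R^-1 - om J n <= r^-1 ^+ J * powR n%:R (r - 2).
Proof.
move=> r1; have r0 : 0 < r by apply: lt_le_trans r1.
case: n => [|n]; first by rewrite om_0 invr0 subr0 mulr_ge0 ?powR_ge0 ?exprn_ge0 ?invr_ge0 ?(ltW r0).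
set x := ln (n.+1%:R : R); set B := _ * powR _ _.
have n0 : 0 < n.+1%:R ^+ 2 :> R by rewrite exprn_gt0.
suff : expR x <= n.+1%:R ^+ 2 * (om J n.+1 + B).
  rewrite /x lnK ?posrE // expr2 -mulrA -[X in X <= _]mulr1 ler_pM2l // -ler_pdivrMl //.
  by rewrite mulr1 lerBlDl.
have hM M : (J <= M)%N -> \sum_(j < M) x ^+ j / j`!%:R <= n.+1%:R ^+ 2 * (om J n.+1 + B).
  move=> JM; rewrite -ler_pdivrMl // mulr_sumr.
  rewrite (eq_bigr (fun j : 'I_M => wj R j n.+1)); last by move=> j _; rewrite /wj exprVn.
  rewrite (@sum_ord_split _ (fun j => wj R j n.+1) _ _ JM) lerD2l.
  rewrite /B exprVn mulrC ler_pdivlMr ?exprn_gt0 //.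
  apply: le_trans (wj_sum_le M n.+1 (ltW r0)).
  rewrite (@sum_ord_split _ (fun j => r ^+ j * wj R j n.+1) _ _ JM).
  apply: le_trans (_ : _ <= \sum_(J <= j < M) r ^+ j * wj R j n.+1) _; last first.
    by rewrite lerDr sumr_ge0 // => j _; rewrite mulr_ge0 ?wj_ge0 // exprn_ge0 // ltW.
  rewrite mulr_suml big_nat [leRHS]big_nat; apply: ler_sum => j /andP[Jj _].
  rewrite mulrC; apply: ler_wpM2r; first exact: wj_ge0.
  exact: ler_weXn2l.
apply: limr_le; first exact: is_cvg_series_exp_coeff.
by exists J => // M /= JM; rewrite /series /= big_mkord; exact: hM.
Qed.

End TruncatedWeight.

Section InverseL.
Variable R : realType.
Local Notation C := R[i].
Local Notation nm := (@Normc.normc R).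

(* 154 = 2 * (7/2) * 22 and 36 = 2 / (1 - (17/16)/(9/8)). *)
Definition invL_bound (m : nat) : R := 36 * (154 * m%:R) ^+ 180.

Variables (m : nat) (chi : nat -> C).
Hypotheses (HG : GRH R) (m0 : (0 < m)%N) (hchi : is_dchar m chi) (hne : chi <> principal_char R m).

Lemma T_dchar_bound j : nm (T chi j) * r0 R ^+ j <= m%:R * 22.
Proof.
have ha : (fun n => chi n * tw 0 n) = chi by apply/funext => n; rewrite tw_0 mulr1.
have hn0 : nice (fun n => chi n * tw 0 n) by rewrite ha; exact: nice_dchar m0 hchi.
have := T_twist_bound j (dchar_partial_sum m0 hchi hne) hn0.
by rewrite ha /Ct normr0 mulr0 addr0.
Qed.

Lemma T_mukchi_inverse j : cprod (T (mukchi chi 1)) (T chi) j = (j == 0)%N%:R.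
Proof. by rewrite (T_mukchi m0 hchi) (T_mukchi0 hchi). Qed.

Lemma T_mukchi1_0 : nm (T (mukchi chi 1) 0%N) <= 2.
Proof.
apply: nm_ssum => N.
apply: (@le_trans _ _ (\sum_(n < N) powR n%:R (- (1 + 1)))); last first.
  by apply: le_trans (sum_powR_le N ltr01) _; rewrite invr1.
apply: ler_sum => n _; rewrite nmM nm_real ger0_norm ?wj_ge0 //.
have h := @wj_le R 0 0 n (lexx _); rewrite expr0 mul1r sub0r in h; apply: le_trans h.
case: (posnP n) => [->|n0]; first by rewrite wj_0 mulr0.
apply: ler_piMl; first exact: wj_ge0.
by apply: le_trans (nm_mukchi m0 hchi 1 n) _; exact: muk1_le.
Qed.

(** [T chi 0] is L(2, chi). Its inverse has norm at most 2, so its own norm is at least 1/2, and the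
    exponential bound becomes a power of m. *)
Lemma T_mukchi1_bound j : nm (T (mukchi chi 1) j) * (9 / 8) ^+ j <= 2 * (154 * m%:R) ^+ 180.
Proof.
have hz z : nm z <= 5 / 4 -> pseval (T chi) z != 0 by exact: pseval_T_neq0 HG m0 hchi hne.
apply: le_trans (inverse_coeff_bound T_dchar_bound hz T_mukchi_inverse j) _.
apply: ler_pM; rewrite ?nm_ge0 ?expR_ge0 ?T_mukchi1_0 //.
have mR : 0 < m%:R :> R by rewrite ltr0n.
have c0 : 2^-1 <= nm (T chi 0%N).
  have := T_mukchi_inverse 0; rewrite /cprod big_ord1 subnn => /(congr1 nm); rewrite nmM nm1.
  move=> e; have h := T_mukchi1_0; have c1 := nm_ge0 (T chi 0%N).
  by have := ler_wpM2r c1 h; rewrite e; lra.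
have c1 : 0 < nm (T chi 0%N) by apply: lt_le_trans c0; rewrite invr_gt0.
have p0 : 0 < 154 * m%:R :> R by rewrite mulr_gt0.
rewrite -[X in _ <= X ^+ _](@lnK R) ?posrE // -expRM_natl ler_expR ler_wpM2l //.
have -> : 154 * m%:R = 7 / 2 * (m%:R * 22) * 2 :> R by field.
rewrite [ln (_ * 2)]lnM ?posrE ?mulr_gt0 // lerD2l.
by rewrite lerNl -lnV ?posrE // ler_ln ?posrE.
Qed.

(** At 17/16 < 9/8 the bounds of [T_mukchi1_bound] sum to [invL_bound]. Such constants multiply
    under Cauchy products, which gives the k-th power. *)
Lemma T_mukchi_summable k :
  summable_by (fun j => T (mukchi chi k) j * (17 / 16 : R)%:C ^+ j) (invL_bound m ^+ k).
Proof.
have n17 : nm (17 / 16 : R)%:C = 17 / 16 by rewrite nm_real ger0_norm.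
elim: k => [|k IH].
  move=> N; rewrite expr0; case: N => [|N]; first by rewrite big_ord0.
  rewrite big_ord_recl (T_mukchi0 hchi) /= expr0 mul1r nm1 big1 ?addr0 // => j _.
  by rewrite (T_mukchi0 hchi) /= mul0r nm0.
have h1 : summable_by (fun j => T (mukchi chi 1) j * (17 / 16 : R)%:C ^+ j) (invL_bound m).
  have h98 : (0 : R) < 9 / 8 by [].
  have h17 : nm (17 / 16 : R)%:C < 9 / 8 by rewrite n17; lra.
  have := geo_summable h98 h17 T_mukchi1_bound; rewrite n17.
  have -> : 2 * (154 * m%:R) ^+ 180 / (1 - 17 / 16 / (9 / 8)) = invL_bound m :> R.
    by rewrite /invL_bound mulrAC; congr (_ * _); field.
  by [].
have e : T (mukchi chi k.+1) =1 cprod (T (mukchi chi k)) (T (mukchi chi 1)).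
  have e0 : T (mukchi chi k) = cprod (T (mukchi chi k.+1)) (T chi).
    by apply/funext => j; rewrite (T_mukchi m0 hchi).
  move=> j; rewrite e0 -cprod_assoc [cprod (T chi) _]cprod_comm.
  have -> : cprod (T (mukchi chi 1)) (T chi) = fun j => (j == 0)%N%:R.
    by apply/funext => i; exact: T_mukchi_inverse.
  by rewrite cprod_comm cprod1.
rewrite exprSr; have := summable_cprod IH h1; apply: summable_byW => j.
by rewrite cprod_scale e.
Qed.

Lemma summable_T_mukchi k z : nm z <= 17 / 16 -> summable (fun j => T (mukchi chi k) j * z ^+ j).
Proof.
move=> hz; exists (invL_bound m ^+ k); have := T_mukchi_summable k; apply: summable_byW => j.
rewrite !nmM !nmX; apply: ler_wpM2l; first exact: nm_ge0.
by rewrite nm_real ger0_norm // lerXn2r ?nnegrE ?nm_ge0.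
Qed.

Lemma Lfun_inv k : (Defs.Lfun chi 1)^-1 ^+ k = ssum (T (mukchi chi k)).
Proof.
have hps := dchar_partial_sum m0 hchi hne; have nchi := nice_dchar m0 hchi.
have h1 : nm 1 < r0 R by rewrite nm1 /r0; lra.
have eL : Defs.Lfun chi 1 = pseval (T chi) 1.
  by rewrite -(Lfun_pseval hps nchi h1); congr (Defs.Lfun _ _); ring.
have L0 : Defs.Lfun chi 1 != 0.
  by rewrite eL; apply: (pseval_T_neq0 HG m0 hchi hne); rewrite nm1; lra.
have -> : ssum (T (mukchi chi k)) = pseval (T (mukchi chi k)) 1.
  by apply: eq_ssum => j; rewrite expr1n mulr1.
have hc : summable (fun j => T chi j * 1 ^+ j).
  by eexists; apply: (geo_summable (r0_gt0 R) h1 T_dchar_bound).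
have h17 : nm 1 <= 17 / 16 by rewrite nm1; lra.
elim: k => [|k IH].
  rewrite expr0 /pseval (@ssum_finite _ _ 1) ?big_ord1 ?(T_mukchi0 hchi) ?expr0 ?mulr1 //.
  by case=> // n _; rewrite (T_mukchi0 hchi) mul0r.
apply: (mulIf L0); rewrite exprSr -mulrA mulVf // mulr1 IH eL.
have [_ <-] := pseval_cprod (summable_T_mukchi k.+1 h17) hc.
by apply: eq_ssum => j; rewrite (T_mukchi m0 hchi).
Qed.

Lemma Lfun_inv_truncation k J :
  nm ((Defs.Lfun chi 1)^-1 ^+ k - \sum_(j < J) T (mukchi chi k) j) <=
  invL_bound m ^+ k * (16 / 17) ^+ J.
Proof.
have h17 : nm 1 <= 17 / 16 by rewrite nm1; lra.
have hs : summable (T (mukchi chi k)).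
  by apply: summableW (summable_T_mukchi k h17) => j; rewrite expr1n mulr1.
rewrite Lfun_inv; apply: ssum_tail => // N.
have e : (16 / 17 : R) = (17 / 16)^-1 by rewrite invf_div.
have p j : 0 < (17 / 16 : R) ^+ j by rewrite exprn_gt0.
rewrite e exprVn ler_pdivlMr //.
case: (leqP J N) => [JN|NJ]; last first.
  rewrite big_geq 1?ltnW // mul0r.
  by apply: le_trans (T_mukchi_summable k 0); rewrite big_ord0.
apply: le_trans (T_mukchi_summable k N).
rewrite (@sum_ord_split _ (fun j => nm (T (mukchi chi k) j * (17 / 16 : R)%:C ^+ j)) _ _ JN).
apply: le_trans (_ : _ <= \sum_(J <= j < N) nm (T (mukchi chi k) j * (17 / 16 : R)%:C ^+ j)) _; last first.
  by rewrite lerDr sumr_ge0 // => j _; exact: nm_ge0.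
rewrite mulr_suml big_nat [leRHS]big_nat; apply: ler_sum => j /andP[Jj _].
rewrite nmM nmX nm_real ger0_norm //; apply: ler_wpM2l; first exact: nm_ge0.
by apply: ler_weXn2l => //; lra.
Qed.

Lemma sum_T_mukchi k J :
  \sum_(j < J) T (mukchi chi k) j = ssum (fun n => mukchi chi k n * (om R J n)%:C) /\
  summable (fun n => mukchi chi k n * (om R J n)%:C).
Proof.
have hn := nice_mukchi m0 hchi k.
have e n : \sum_(j < J) mukchi chi k n * (wj R j n)%:C = mukchi chi k n * (om R J n)%:C.
  by rewrite -mulr_sumr /om rmorph_sum.
have hs (j : 'I_J) : summable (fun n => mukchi chi k n * (wj R j n)%:C) by exact: summable_T.
split.
  rewrite -(ssum_sum (index_enum 'I_J) hs).
  by apply: eq_ssum => n; rewrite e.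
by apply: summableW (summable_sum (index_enum 'I_J) hs) => n; rewrite e.
Qed.

End InverseL.

(** * The diagonal contribution *)

Section EulerProduct.
Variable R : realType.

Lemma prime_dvdn_fact p n : prime p -> (p %| n`!)%N = (p <= n)%N.
Proof.
move=> pp; apply/idP/idP => [|pn]; last by rewrite dvdn_fact // prime_gt0.
elim: n => [|n IH]; first by rewrite fact0 dvdn1 => /eqP e; rewrite e in pp.
rewrite factS Euclid_dvdM // => /orP[/dvdn_leq ->//|/IH h]; exact: leqW.
Qed.

(** The diagonal term with the full weight 1/n. At p^j the square of [muk] is the squared binomial
    coefficient, so the sum is the Euler product over the primes not dividing q. *)
Definition diag_term (q k n : nat) : R :=
  if coprime n q then muk R k n ^+ 2 * n%:R^-1 ^+ 2 else 0.

Lemma diag_term_ge0 q k n : 0 <= diag_term q k n.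
Proof. by rewrite /diag_term; case: ifP => // _; rewrite mulr_ge0 ?sqr_ge0. Qed.

Let lf (q k p j : nat) : R := ((-1) ^+ j * 'C(k, j)%:R) * ((-1) ^+ j * 'C(k, j)%:R) *
  (p%:R^-1 ^+ 2) ^+ j * (coprime p q)%:R ^+ j.

Lemma diag_term_mulf q k n : (0 < n)%N -> diag_term q k n = mulf (lf q k) n.
Proof.
move=> n0; rewrite /lf -!mulfM.
have e1 := @mulf_completely R (fun p => p%:R^-1 ^+ 2) n _ _ n0.
have e2 := @mulf_completely R (fun p => (coprime p q)%:R) n _ _ n0.
rewrite e1; last 2 first.
- by rewrite invr1 expr1n.
- by move=> a b _ _; rewrite natrM invfM exprMn.
rewrite e2; last 2 first.
- by rewrite coprime1n.
- by move=> a b _ _; rewrite coprimeMl -natrM mulnb.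
by rewrite /diag_term /muk -mulfM expr2; case: ifP => _; rewrite ?mulr1 ?mulr0.
Qed.

Lemma local_factor_sum q k p a : (k <= a)%N ->
  \sum_(j < a.+1) lf q k p j = if coprime p q then local_factor R k p else 1.
Proof.
move=> ka; rewrite /lf; case: coprime; last first.
  rewrite big_ord_recl /= !expr0 bin0 !mulr1 big1 ?addr0 // => j _.
  by rewrite [0 ^+ _]expr0n /= mulr0.
rewrite (@sum_ord_split _ (fun j => (-1) ^+ j * 'C(k, j)%:R * ((-1) ^+ j * 'C(k, j)%:R) *
  (p%:R^-1 ^+ 2) ^+ j * true%:R ^+ j) k.+1) //.
rewrite [X in _ + X]big_nat [X in _ + X]big1 ?addr0 => [|j /andP[kj _]]; last first.
  by rewrite bin_small // mulr0 !mul0r.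
rewrite /local_factor big_mkord; apply: eq_bigr => j _.
rewrite expr1n mulr1 mulrACA -exprMn mulrNN mulr1 expr1n mul1r -exprM exprVn.
by rewrite natrX expr2.
Qed.

Lemma local_factor_ge1 k p : 1 <= local_factor R k p.
Proof.
rewrite /local_factor big_nat_recl // bin0 muln0 expr0 divr1 lerDl.
by apply: sumr_ge0 => j _; rewrite divr_ge0 ?exprn_ge0.
Qed.

Let eprod q k N := \prod_(0 <= p < N | prime p) if coprime p q then local_factor R k p else 1.

(* The partial product is the sum of [diag_term] over the divisors of (N-1)!^k, as 'C(k, j) = 0
   for j > k. *)
Lemma euler_squeeze q k N : (0 < k)%N ->
  \sum_(n < N) diag_term q k n <= eprod q k N <=
  \sum_(n < ((N.-1)`! ^ k).+1) diag_term q k n.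
Proof.
move=> k0; set M := ((N.-1)`! ^ k)%N.
have M0 : (0 < M)%N by rewrite expn_gt0 fact_gt0.
have d0 : diag_term q k 0 = 0 by rewrite /diag_term invr0 expr0n mulr0 if_same.
have e : \sum_(d <- divisors M) diag_term q k d = eprod q k N.
  rewrite big_seq (eq_bigr (mulf (lf q k))); last first.
    move=> d; rewrite -dvdn_divisors // => dM; apply: diag_term_mulf; exact: dvdn_gt0 dM.
  rewrite -big_seq sum_divisors_mulf //; last by move=> p; rewrite /lf !expr0 bin0 !mulr1.
  rewrite /mulf /eprod -[RHS]big_filter.
  have pp : perm_eq (primes M) [seq p <- index_iota 0 N | prime p].
    apply: uniq_perm; rewrite ?primes_uniq ?filter_uniq ?iota_uniq // => p.
    rewrite mem_primes mem_filter mem_index_iota M0 /=; case: (boolP (prime p)) => // pp /=.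
    rewrite Euclid_dvdX // k0 andbT prime_dvdn_fact //.
    by case: (N) => [|n] //; rewrite leqNgt prime_gt0.
  rewrite (perm_big _ pp) /= big_seq [RHS]big_seq; apply: eq_bigr => p.
  rewrite -(perm_mem pp) mem_primes => /and3P[hp _ hM]; apply: local_factor_sum.
  rewrite lognX leq_pmulr // logn_gt0 mem_primes hp fact_gt0.
  by move: hM; rewrite Euclid_dvdX // k0 andbT.
rewrite -e; apply/andP; split.
  case: N @M M0 e => [|N] M M0 e; first by rewrite big_ord0 sumr_ge0 // => d _; exact: diag_term_ge0.
  rewrite -(big_mkord xpredT) big_ltn // d0 add0r.
  apply: sum_subset_le; rewrite ?iota_uniq ?divisors_uniq //; last exact: diag_term_ge0.
  move=> n; rewrite mem_index_iota => /andP[n0 nN]; rewrite -dvdn_divisors //.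
  by rewrite (dvdn_trans (dvdn_fact _) (dvdn_exp k0 (dvdnn _))) // n0.
rewrite -(big_mkord xpredT); apply: sum_subset_le; rewrite ?iota_uniq ?divisors_uniq //.
  by move=> n; rewrite -dvdn_divisors // mem_index_iota ltnS => /dvdn_leq ->.
exact: diag_term_ge0.
Qed.

Lemma diag_term_bounded q k : exists B : R, forall N, \sum_(n < N) diag_term q k n <= B.
Proof.
have h4 : (0 : R) < 1 / 4 by [].
have [D D0 hD] := muk_powR_le k h4.
exists (D ^+ 2 * (1 + 2^-1^-1)) => N.
apply: (@le_trans _ _ (\sum_(n < N) D ^+ 2 * powR n%:R (- (1 + 2^-1)))); last first.
  by rewrite -mulr_sumr ler_wpM2l ?sqr_ge0 //; apply: sum_powR_le; rewrite invr_gt0.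
apply: ler_sum => n _; rewrite /diag_term; case: ifP => _; last by rewrite mulr_ge0 ?sqr_ge0 ?powR_ge0.
case: (posnP n) => [->|n0]; first by rewrite invr0 expr0n mulr0 mulr_ge0 ?sqr_ge0 ?powR_ge0.
have -> : powR n%:R (- (1 + 2^-1)) = powR n%:R (1 / 4) ^+ 2 * n%:R^-1 ^+ 2 :> R.
  rewrite sqr_natV // !powR_expR // -expRM_natl -expRD; congr expR.
  by rewrite mulrA -mulrDl; congr (_ * _); field.
rewrite mulrA; apply: ler_wpM2r; first by rewrite sqr_ge0.
rewrite -exprMn -real_normK ?num_real // lerXn2r ?nnegrE ?normr_ge0 ?hD //.
by rewrite mulr_ge0 ?powR_ge0 ?ltW.
Qed.

Lemma euler_product q k : (0 < k)%N -> exists D : R,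
  [/\ 1 <= D, ((fun N => \sum_(n < N) diag_term q k n) @ \oo --> D)%classic &
  (eprod q k @ \oo --> D)%classic].
Proof.
move=> k0; have [B hB] := diag_term_bounded q k; pose u N := \sum_(n < N) diag_term q k n.
have ud : nondecreasing_seq u.
  by move=> a b ab; apply: partial_sum_le => // n; exact: diag_term_ge0.
have cu : cvgn u by apply: nondecreasing_is_cvgn => //; exists B => _ [N _ <-]; exact: hB.
exists (lim (u @ \oo)%classic); have hle := nondecreasing_cvgn_le ud cu; split=> //.
  apply: le_trans (hle 2%N); rewrite /u !big_ord_recr big_ord0 /= add0r.
  rewrite {2}/diag_term coprime1n muk1 invr1 !expr1n mulr1 lerDr; exact: diag_term_ge0.
apply: (@squeeze_cvgr _ _ _ _ u (cst (lim (u @ \oo)%classic))) => //; last exact: cvg_cst.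
by apply: nearW => N; have /andP[-> h] := euler_squeeze q N k0; apply: le_trans h (hle _).
Qed.

Lemma diag_sum q k : (0 < q)%N -> (0 < k)%N -> exists D : R,
  [/\ 1 <= D, ((fun N => \sum_(n < N) diag_term q k n) @ \oo --> D)%classic &
   D = Ck R k * \prod_(p <- primes q) (local_factor R k p)^-1].
Proof.
move=> q0 k0; have [D1 [_ _ h1]] := euler_product 1 k0; have [D [hD hd h2]] := euler_product q k0.
exists D; split=> //.
have -> : Ck R k = D1.
  apply: cvg_lim => //; have -> // : (fun N => \prod_(0 <= p < N | prime p) local_factor R k p) = eprod 1 k.
  by apply/funext => N; apply: eq_bigr => p _; rewrite coprimen1.
have l0 p : local_factor R k p != 0.
  by have := local_factor_ge1 k p; apply: contraTneq => ->; rewrite -ltNge ltr01.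
pose L := \prod_(p <- primes q) local_factor R k p.
have L0 : L != 0 by rewrite /L prodf_seq_neq0; apply/allP => p _; rewrite l0.
have -> : \prod_(p <- primes q) (local_factor R k p)^-1 = L^-1 by rewrite prodfV.
apply: (mulIf L0); rewrite divfK //.
apply: (@cvg_unique R (@norm_hausdorff _ _) (eprod 1 k @ \oo)%classic) => //.
have hL : ((fun N => eprod q k N * L) @ \oo --> D * L)%classic by apply: cvgM => //; exact: cvg_cst.
(* Once N > q every prime divisor of q lies in the range of the partial product, and [L] restores
   exactly the missing factors. *)
apply: cvg_trans hL; apply: near_eq_cvg; exists q.+1 => // N /= qN.
rewrite /eprod /L.
have pe : perm_eq [seq p <- index_iota 0 N | prime p && ~~ coprime p q] (primes q).
  apply: uniq_perm; rewrite ?filter_uniq ?primes_uniq ?iota_uniq // => p.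
  rewrite mem_filter mem_index_iota mem_primes q0 /=; case: (boolP (prime p)) => //= pp.
  rewrite prime_coprime // negbK; apply: andb_idr => /dvdn_leq h.
  by rewrite (leq_ltn_trans (h q0)).
rewrite -(perm_big _ pe) /= big_filter big_mkcondr -big_split /=; apply: eq_bigr => p _.
by rewrite coprimen1; case: coprime; rewrite ?mulr1 ?mul1r.
Qed.

(** Each factor p / (p - 1) of q / phi(q) is at most 2, and 2 to the number of prime divisors is
    below any power of q, up to a constant. *)
Lemma totient_ge (eps : R) : 0 < eps -> exists2 D : R, 0 < D &
  forall q, (0 < q)%N -> q%:R <= D * powR q%:R eps * (totient q)%:R.
Proof.
move=> e0; have [D D0 hD] := exp_omega_le (ler1n R 2) e0; exists D => // q q0.
apply: le_trans (ler_wpM2r (ler0n R _) (hD q q0)).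
rewrite -natrX -natrM ler_nat.
have -> : (2 ^ size (primes q) = \prod_(p <- primes q) 2)%N by rewrite big_const_seq count_predT iter_muln_1.
rewrite totientE // -big_split /= [X in (X <= _)%N](prod_prime_decomp q0) prime_decompE big_map /=.
rewrite !big_seq; apply: leq_prod => p; rewrite mem_primes => /and3P[pp _ pq].
have l0 : (0 < logn p q)%N by rewrite logn_gt0 mem_primes pp q0.
rewrite -{1}(prednK l0) expnS mulnA leq_mul2r; apply/orP; right.
by have := prime_gt1 pp; lia.
Qed.

End EulerProduct.

(** * The off-diagonal contribution *)

Section OffDiagonal.
Variable R : realType.

(** [h] numbers the members of a residue class with n >= q h(n) / 2, so n^{-1-eta} <= (2/q)^{1+eta}
    h(n)^{-1-eta}; as q / 2 >= 1, the exponent of 2/q can be lowered to 1. *)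
Lemma class_sum_le (q : nat) (eta : R) (P : pred nat) (h : nat -> nat) N L : (1 < q)%N -> 0 < eta ->
  (forall n, (n < N)%N -> P n -> (0 < h n < L)%N /\ (q * h n <= n.*2)%N) ->
  (forall n n', P n -> P n' -> h n = h n' -> n = n') ->
  \sum_(n < N | P n) powR n%:R (- (1 + eta)) <= 2 / q%:R * (1 + eta^-1) :> R.
Proof.
move=> q1 e0 hP hinj; have q0 : 0 < q%:R :> R by rewrite ltr0n ltnW.
pose F l : R := powR l%:R (- (1 + eta)).
have half n : (n < N)%N -> P n -> F n <= 2 / q%:R * F (h n).
  move=> nN /(hP n nN) [/andP[h0 _] hq].
  have hh : 0 < (h n)%:R :> R by rewrite ltr0n.
  have q2 : 1 <= q%:R / 2 :> R by rewrite ler_pdivlMr // mul1r ler_nat.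
  have le1 : q%:R / 2 * (h n)%:R <= n%:R :> R.
    by rewrite mulrAC ler_pdivrMr // -!natrM ler_nat muln2.
  apply: (@le_trans _ _ (powR (q%:R / 2 * (h n)%:R) (- (1 + eta)))).
    rewrite /F !powRN lef_pV2 ?posrE ?powR_gt0 //.
    - by apply: ge0_ler_powR; rewrite ?nnegrE //; lra.
    - by apply: lt_le_trans le1; rewrite mulr_gt0 //; lra.
    - by rewrite mulr_gt0 //; lra.
  rewrite powRM; [|lra|lra]; apply: ler_wpM2r; first exact: powR_ge0.
  have -> : 2 / q%:R = powR (q%:R / 2) (-1) :> R by rewrite powR_inv1 ?invf_div //; lra.
  by apply: ler_powR => //; lra.
apply: (@le_trans _ _ (\sum_(n < N | P n) 2 / q%:R * F (h n))).
  by apply: ler_sum => n Pn; apply: half.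
rewrite -mulr_sumr; apply: ler_wpM2l; first by rewrite divr_ge0 // ltW.
apply: le_trans (sum_powR_le L e0).
rewrite -(big_mkord P (fun n => F (h n))) -big_filter -(big_map h xpredT F) -(big_mkord xpredT F).
apply: sum_subset_le; rewrite ?iota_uniq //.
- rewrite map_inj_in_uniq ?filter_uniq ?iota_uniq // => n n'.
  by rewrite !mem_filter => /andP[Pn _] /andP[Pn' _]; exact: hinj.
- move=> l /mapP[n]; rewrite mem_filter mem_index_iota => /andP[Pn nN] ->.
  by rewrite mem_index_iota; have [/andP[]] := hP n nN Pn.
- by move=> n; exact: powR_ge0.
Qed.

Definition cong_count (q m n : nat) : R := (m == n %[mod q])%:R + (q %| m + n)%:R.

(** The class of m is numbered by (n - m) / q and that of -m by (m + n) / q; [m < n] makes both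
    positive and gives m + n <= 2 n. *)
Lemma cong_sum_le (q m N : nat) (eta : R) : (1 < q)%N -> 0 < eta ->
  \sum_(n < N | (m < n)%N) cong_count q m n * powR n%:R (- (1 + eta)) <= 4 / q%:R * (1 + eta^-1).
Proof.
move=> q1 e0; have q0 : (0 < q)%N by exact: ltnW.
have -> : 4 / q%:R * (1 + eta^-1) = 2 / q%:R * (1 + eta^-1) + 2 / q%:R * (1 + eta^-1) by ring.
under eq_bigr do rewrite mulrDl.
have e (b : pred nat) : \sum_(n < N | (m < n)%N) (b n)%:R * powR n%:R (- (1 + eta)) =
    \sum_(n < N | (m < n)%N && b n) powR n%:R (- (1 + eta)) :> R.
  by rewrite big_mkcondr; apply: eq_bigr => n _; case: (b n); rewrite ?mul1r ?mul0r.
rewrite big_split (e (fun n => m == n %[mod q])) (e (fun n => q %| m + n)%N); apply: lerD.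
  have hd n : (m < n)%N && (m == n %[mod q]) -> (n = (n - m) %/ q * q + m)%N.
    move=> /andP[mn h]; rewrite divnK ?subnK 1?ltnW //.
    by rewrite -eqn_mod_dvd 1?ltnW // eq_sym.
  apply: (@class_sum_le q eta (fun n => (m < n)%N && (m == n %[mod q])) (fun n => (n - m) %/ q)%N N N) => //.
    move=> n nN h; have := hd n h; case/andP: h => mn _; set d := ((n - m) %/ q)%N => hn.
    have d0 : (0 < d)%N by case: (posnP d) => // d0; move: hn mn; rewrite d0; lia.
    split; last by nia.
    by rewrite d0; nia.
  by move=> n n' /hd {2}-> /hd {2}-> ->.
have hd n : (m < n)%N && (q %| m + n)%N -> (m + n = (m + n) %/ q * q)%N.
  by move=> /andP[_ h]; rewrite divnK.
apply: (@class_sum_le q eta (fun n => (m < n)%N && (q %| m + n)%N) (fun n => (m + n) %/ q)%N N N.*2) => //.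
  move=> n nN h; have := hd n h; case/andP: h => mn _; set d := ((m + n) %/ q)%N => hn.
  have d0 : (0 < d)%N by case: (posnP d) => // d0; move: hn mn; rewrite d0; lia.
  split; last by nia.
  by rewrite d0; nia.
by move=> n n' /hd h /hd h' e2; rewrite e2 in h; lia.
Qed.

(** For m coprime to q > 2, q does not divide 2 m, so the diagonal counts each m once. The remaining
    sum of absolute values is symmetric, twice the part [m < n]. *)
Lemma congruence_sum_le (q N : nat) (v : nat -> R) (W eta : R) : (2 < q)%N -> 0 < eta ->
  (forall n, `|v n| <= W * powR n%:R (- (1 + eta))) ->
  (forall n, ~~ coprime n q -> v n = 0) ->
  `|\sum_(m < N) \sum_(n < N) v m * v n * cong_count q m n - \sum_(n < N) v n ^+ 2| <=
  8 * (W * (1 + eta^-1)) ^+ 2 / q%:R.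
Proof.
move=> q2 e0 hv v0; have q1 : (1 < q)%N by exact: ltnW.
have q0 : 0 < q%:R :> R by rewrite ltr0n; lia.
have W0 : 0 <= W by have := le_trans (normr_ge0 _) (hv 1%N); rewrite powR1 mulr1.
have c0 : 0 <= 1 + eta^-1 by rewrite addr_ge0 // invr_ge0 ltW.
have cc0 m n : 0 <= cong_count q m n by rewrite /cong_count addr_ge0.
have ccC m n : cong_count q m n = cong_count q n m by rewrite /cong_count eq_sym addnC.
pose F m n := `|v m| * `|v n| * cong_count q m n.
have FC m n : F m n = F n m by rewrite /F ccC [`|v m| * _]mulrC.
pose S := \sum_(m < N) \sum_(n < N | (m < n)%N) F m n.
have hS : S <= 4 * (W * (1 + eta^-1)) ^+ 2 / q%:R.
  apply: (@le_trans _ _ (\sum_(m < N) `|v m| * (W * (4 / q%:R * (1 + eta^-1))))).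
    apply: ler_sum => m _.
    apply: (@le_trans _ _ (`|v m| * (W * \sum_(n < N | (m < n)%N) cong_count q m n * powR n%:R (- (1 + eta))))).
      rewrite !mulr_sumr; apply: ler_sum => n _; rewrite /F -mulrA; apply: ler_wpM2l => //.
      by rewrite mulrCA mulrC; apply: ler_wpM2l.
    by apply: ler_wpM2l => //; apply: ler_wpM2l => //; exact: cong_sum_le.
  rewrite -mulr_suml.
  have -> : 4 * (W * (1 + eta^-1)) ^+ 2 / q%:R = (W * (1 + eta^-1)) * (W * (4 / q%:R * (1 + eta^-1))).
    by ring.
  apply: ler_wpM2r; first by rewrite !mulr_ge0 // invr_ge0 ltW.
  apply: le_trans (ler_wpM2l W0 (sum_powR_le N e0)); rewrite mulr_sumr.
  by apply: ler_sum => n _; exact: hv.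
have e : \sum_(m < N) \sum_(n < N) v m * v n * cong_count q m n - \sum_(n < N) v n ^+ 2 =
    \sum_(m < N) \sum_(n < N | n != m :> nat) v m * v n * cong_count q m n.
  rewrite -sumrB; apply: eq_bigr => m _; rewrite (bigD1 m) //= addrAC.
  have -> : v m * v m * cong_count q m m = v m ^+ 2.
    case: (boolP (coprime m q)) => cm; last by rewrite (v0 _ cm) !mul0r expr0n.
    rewrite /cong_count eqxx (_ : (q %| m + m)%N = false) ?addr0 ?mulr1 ?expr2 //.
    rewrite addnn -muln2 Gauss_dvdr 1?coprime_sym //; apply/negbTE/negP => /dvdn_leq; lia.
  by rewrite subrr add0r.
rewrite {}e; apply: le_trans (ler_norm_sum _ _ _) _.
apply: (@le_trans _ _ (\sum_(m < N) \sum_(n < N | n != m :> nat) F m n)).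
  apply: ler_sum => m _; apply: le_trans (ler_norm_sum _ _ _) _; apply: ler_sum => n _.
  by rewrite !normrM [`|cong_count _ _ _|]ger0_norm.
have -> : \sum_(m < N) \sum_(n < N | n != m :> nat) F m n = S + S.
  have eS : S = \sum_(m < N) \sum_(n < N | (n < m)%N) F m n.
    rewrite /S (exchange_big_dep xpredT) //=; apply: eq_bigr => m _.
    by apply: eq_bigr => n _; exact: FC.
  rewrite {2}eS -big_split /=; apply: eq_bigr => m _.
  rewrite (bigID (fun n : 'I_N => m < n)%N) /=; congr (_ + _).
    by apply: eq_bigl => n; rewrite neq_ltn; case: ltngtP.
  by apply: eq_bigl => n; rewrite neq_ltn; case: ltngtP.
have -> : 8 * (W * (1 + eta^-1)) ^+ 2 / q%:R = 4 * (W * (1 + eta^-1)) ^+ 2 / q%:R + 4 * (W * (1 + eta^-1)) ^+ 2 / q%:R by ring.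
exact: lerD.
Qed.

End OffDiagonal.

(** * Mean square over the even characters *)

Section MomentEstimate.
Variable R : realType.
Local Notation C := R[i].
Local Notation nm := (@Normc.normc R).

(** The part independent of chi in the coefficients of the truncation of L(1, chi)^{-k} to J Taylor
    terms. *)
Definition vJ (q k J n : nat) : R := if coprime n q then muk R k n * om R J n else 0.

Lemma vJ_coprime q k J n : ~~ coprime n q -> vJ q k J n = 0.
Proof. by rewrite /vJ => /negbTE ->. Qed.

(** Half of the gap 1 - rho absorbs the growth of [muk]; the other half keeps the exponent below
    -1. *)
Lemma vJ_bound k (rho : R) : 0 < rho < 1 -> exists2 D : R, 0 < D &
  forall q J n, `|vJ q k J n| <= D * rho^-1 ^+ J * powR n%:R (- (1 + (1 - rho) / 2)).
Proof.
move=> /andP[r0 r1]; have e0 : 0 < (1 - rho) / 2 by lra.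
have [D D0 hD] := muk_powR_le k e0; exists D => // q J n.
have h0 : 0 <= D * rho^-1 ^+ J by rewrite mulr_ge0 ?exprn_ge0 ?invr_ge0 // ltW.
rewrite /vJ; case: ifP => _; last by rewrite normr0 mulr_ge0 ?powR_ge0.
case: (posnP n) => [->|n0]; first by rewrite om_0 mulr0 normr0 mulr_ge0 ?powR_ge0.
rewrite normrM [`|om _ _ _|]ger0_norm ?om_ge0 //.
have r01 : 0 < rho <= 1 by rewrite r0 ltW.
apply: le_trans (ler_pM (normr_ge0 _) (om_ge0 _ _ _) (hD n n0) (om_le J n r01)) _.
rewrite mulrACA (_ : - (1 + (1 - rho) / 2) = (1 - rho) / 2 + (rho - 2)); last by lra.
have -> // : powR n%:R ((1 - rho) / 2 + (rho - 2)) =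
    powR n%:R ((1 - rho) / 2) * powR n%:R (rho - 2).
by rewrite !powR_expR // mulrDl expRD.
Qed.

(** Radius 5/4 in [om_tail] gives 1/n - om <= (4/5)^J n^{-3/4}. With |muk| <= D n^{1/4}, the
    difference of squares has exponent 1/2 - 3/4 - 1 = -5/4. *)
Lemma diag_truncation k : exists2 D : R, 0 < D &
  forall q J N, `|\sum_(n < N) vJ q k J n ^+ 2 - \sum_(n < N) diag_term R q k n| <= D * (4 / 5) ^+ J.
Proof.
have h4 : (0 : R) < 1 / 4 by [].
have [D D0 hD] := muk_powR_le k h4.
exists (D ^+ 2 * 2 * (1 + (1 / 4)^-1)) => [|q J N]; first by rewrite !mulr_gt0 // exprn_gt0.
have p45 : 0 <= (4 / 5 : R) ^+ J by rewrite exprn_ge0.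
have h0 : 0 <= D ^+ 2 * 2 * (4 / 5) ^+ J.
  by apply: mulr_ge0 => //; apply: mulr_ge0 => //; exact: sqr_ge0.
rewrite -sumrB; apply: le_trans (ler_norm_sum _ _ _) _.
apply: (@le_trans _ _ (\sum_(n < N) D ^+ 2 * 2 * (4 / 5) ^+ J * powR n%:R (- (1 + 1 / 4)))); last first.
  rewrite -mulr_sumr [leRHS]mulrAC; apply: ler_wpM2l; last exact: sum_powR_le.
  exact: h0.
apply: ler_sum => n _.
rewrite /vJ /diag_term; case: ifP => _; last by rewrite expr0n subr0 normr0 mulr_ge0 ?powR_ge0.
case: (posnP n) => [->|n0].
  by rewrite om_0 mulr0 invr0 !expr0n mulr0 subr0 normr0 mulr_ge0 ?powR_ge0.
have om1 := om_le_inv R J n; have om0 := om_ge0 R J n.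
have h54 : (1 : R) <= 5 / 4 by lra.
have := om_tail J n h54; rewrite invf_div => ht.
have -> : (muk R k n * om R J n) ^+ 2 - muk R k n ^+ 2 * n%:R^-1 ^+ 2 =
    - (muk R k n ^+ 2 * ((n%:R^-1 - om R J n) * (n%:R^-1 + om R J n))) by ring.
rewrite normrN normrM ger0_norm ?sqr_ge0 // ger0_norm; last by rewrite mulr_ge0; lra.
have hm : muk R k n ^+ 2 <= D ^+ 2 * powR n%:R (1 / 4) ^+ 2.
  rewrite -exprMn -real_normK ?num_real // lerXn2r ?nnegrE ?normr_ge0 ?hD //.
  by rewrite mulr_ge0 ?powR_ge0 ?ltW.
have hp : (n%:R^-1 - om R J n) * (n%:R^-1 + om R J n) <=
    ((4 / 5) ^+ J * powR n%:R (5 / 4 - 2)) * (2 * n%:R^-1).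
  by apply: ler_pM => //; lra.
apply: le_trans (ler_pM (sqr_ge0 _) _ hm hp) _; first by rewrite mulr_ge0; lra.
have -> : powR n%:R (- (1 + 1 / 4)) = powR n%:R (1 / 4) ^+ 2 * powR n%:R (5 / 4 - 2) * n%:R^-1 :> R.
  rewrite -[n%:R^-1]powR_inv1 // !powR_expR // -expRM_natl -!expRD; congr expR.
  by rewrite mulrA -!mulrDl; congr (_ * _); field.
by rewrite le_eqVlt; apply/orP; left; apply/eqP; ring.
Qed.

Lemma even_square_sum (q N : nat) (s : seq (nat -> C)) (v : nat -> R) : (1 < q)%N -> uniq s ->
  (forall chi, chi \in s <-> is_dchar q chi) -> (forall n, ~~ coprime n q -> v n = 0) ->
  \sum_(chi <- s | chi (q - 1)%N == 1) nm (\sum_(n < N) (v n)%:C * chi n) ^+ 2 =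
  (totient q)%:R / 2 * \sum_(m < N) \sum_(n < N) v m * v n * cong_count R q m n.
Proof.
move=> q1 us hs v0; apply: (@complexI R); rewrite rmorph_sum.
transitivity (\sum_(chi <- s | chi (q - 1)%N == 1) \sum_(m < N) \sum_(n < N)
    (v m * v n)%:C * (chi m * (chi n)^*)).
  apply: eq_bigr => chi _; rewrite -[LHS]/((nm _ ^+ 2)%:C) nm_sqr mulr_suml; apply: eq_bigr => m _.
  rewrite rmorph_sum mulr_sumr; apply: eq_bigr => n _.
  transitivity ((v m)%:C * chi m * ((chi n)^* * (v n)%:C)); last by rewrite rmorphM /=; ring.
  by congr (_ * _); rewrite mulrC; exact: conj_mul_real.
rewrite exchange_big /= mulr_sumr [RHS]rmorph_sum; apply: eq_bigr => m _.
rewrite exchange_big /= mulr_sumr [RHS]rmorph_sum; apply: eq_bigr => n _.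
rewrite -mulr_sumr; case: (boolP (coprime m q)) => cm; last by rewrite (v0 _ cm) !mul0r mulr0.
case: (boolP (coprime n q)) => cn; last by rewrite (v0 _ cn) mulr0 !mul0r mulr0.
rewrite (even_orthogonality q1 us hs cm cn) mulrCA [RHS]rmorphM [X in _ = _ * X]rmorphM /=.
congr (_ * (_ * _)); first by rewrite rmorphM fmorphV !rmorph_nat.
by rewrite /cong_count rmorphD !rmorph_nat.
Qed.

Lemma twisted_sum_bound (q N : nat) (chi : nat -> C) (v : nat -> R) (W eta : R) : 0 < eta ->
  (forall n, nm (chi n) <= 1) -> (forall n, `|v n| <= W * powR n%:R (- (1 + eta))) ->
  \sum_(n < N) nm ((v n)%:C * chi n) <= W * (1 + eta^-1).
Proof.
move=> e0 hchi hv; have W0 : 0 <= W by have := le_trans (normr_ge0 _) (hv 1%N); rewrite powR1 mulr1.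
apply: le_trans (ler_wpM2l W0 (sum_powR_le N e0)); rewrite mulr_sumr; apply: ler_sum => n _.
apply: le_trans (hv n); rewrite nmM nm_real; exact: ler_piMr.
Qed.

Definition even_chars (q : nat) (s : seq (nat -> C)) : seq (nat -> C) :=
  [seq chi <- s | (chi (q - 1)%N == 1) && (chi != principal_char R q)].

(** Sums over characters are expanded for finite N, where they can be exchanged freely, with bounds
    uniform in N that pass to the limit. The principal character is even, so it is subtracted, at
    the cost of the last square. *)
Lemma even_chars_square_sum (q : nat) (s : seq (nat -> C)) (v g : nat -> R) (W eta G del : R) :
  (2 < q)%N -> uniq s -> (forall chi, chi \in s <-> is_dchar q chi) -> 0 < eta ->
  (forall n, ~~ coprime n q -> v n = 0) -> (forall n, `|v n| <= W * powR n%:R (- (1 + eta))) ->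
  (forall N, `|\sum_(n < N) v n ^+ 2 - \sum_(n < N) g n| <= del) ->
  ((fun N => \sum_(n < N) g n) @ \oo --> G)%classic ->
  `|\sum_(chi <- even_chars q s) nm (ssum (fun n => (v n)%:C * chi n)) ^+ 2 - (totient q)%:R / 2 * G| <=
  (totient q)%:R / 2 * (8 * (W * (1 + eta^-1)) ^+ 2 / q%:R + del) + (W * (1 + eta^-1)) ^+ 2.
Proof.
move=> q2 us hs e0 v0 hv hdel hG; set c := W * (1 + eta^-1); set B := (X in _ <= X).
have q1 : (1 < q)%N by exact: ltnW.
have q0 : (0 < q)%N by exact: ltnW.
pose S (chi : nat -> C) N := \sum_(n < N) (v n)%:C * chi n.
have hsum chi : chi \in s -> summable_by (fun n => (v n)%:C * chi n) c.
  by move=> /hs hc N; apply: twisted_sum_bound => // n; exact: nm_dchar_le1 q0 hc n.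
pose V N := \sum_(chi <- even_chars q s) nm (S chi N) ^+ 2.
have hp : principal_char R q \in s by apply/hs; exact: principal_is_dchar.
have ep : principal_char R q (q - 1)%N = 1.
  by rewrite /principal_char -{2}(subnK q0) addn1 coprimenS.
have hV N : V N = (totient q)%:R / 2 * (\sum_(m < N) \sum_(n < N) v m * v n * cong_count R q m n) -
    nm (S (principal_char R q) N) ^+ 2.
  rewrite -(even_square_sum N q1 us hs v0) [in RHS]big_mkcond (bigD1_seq _ hp us) /= ep eqxx.
  by rewrite addrAC subrr add0r /V big_filter big_mkcondl.
have hVB N : `|V N - (totient q)%:R / 2 * \sum_(n < N) g n| <= B.
  have h1 := congruence_sum_le N q2 e0 hv v0; have h2 := hdel N.
  have h3 : nm (S (principal_char R q) N) ^+ 2 <= c ^+ 2.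
    rewrite lerXn2r ?nnegrE ?nm_ge0 //; first by apply: summable_by_ge0 (hsum _ hp).
    by apply: le_trans (nm_sum _ _ _) _; exact: hsum hp N.
  have t0 : 0 <= (totient q)%:R / 2 :> R by rewrite divr_ge0.
  rewrite hV; set A := \sum_(m < N) _ in h1 *; set D := \sum_(n < N) v n ^+ 2 in h1 h2 *.
  rewrite (_ : _ - _ - _ = (totient q)%:R / 2 * ((A - D) + (D - \sum_(n < N) g n)) -
    nm (S (principal_char R q) N) ^+ 2); last by ring.
  apply: le_trans (ler_normB _ _) _; apply: lerD; last by rewrite ger0_norm ?sqr_ge0.
  rewrite normrM ger0_norm //; apply: ler_wpM2l => //.
  by apply: le_trans (ler_normD _ _) _; apply: lerD.
(* [clim_sum] asks for convergence at every index, hence the value 0 outside the list. *)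
pose u chi N := if chi \in even_chars q s then ((nm (S chi N) ^+ 2)%:C : C) else 0.
pose l chi := if chi \in even_chars q s then ((nm (ssum (fun n => (v n)%:C * chi n)) ^+ 2)%:C : C) else 0.
have hu chi : clim (u chi) (l chi).
  rewrite /u /l; case: ifP => [h|_]; last exact: clim_cst.
  have hc : summable (fun n => (v n)%:C * chi n).
    by exists c; apply: hsum; move: h; rewrite mem_filter => /andP[].
  have hl := summable_clim hc; rewrite nm_sqr.
  by apply: eq_clim (climM hl (clim_conj hl)) => N; rewrite nm_sqr.
have hVl : clim (fun N => (V N)%:C) (\sum_(chi <- even_chars q s) nm (ssum (fun n => (v n)%:C * chi n)) ^+ 2)%:C.
  rewrite rmorph_sum big_seq (eq_bigr l) => [|chi h]; last by rewrite /l h.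
  rewrite -big_seq; apply: eq_clim (clim_sum (even_chars q s) hu) => N.
  by rewrite rmorph_sum big_seq [RHS]big_seq; apply: eq_bigr => chi h; rewrite /u h.
have /rlim_clim hGl := hG.
have := climB hVl (climZ ((totient q)%:R / 2 : R)%:C hGl).
move=> /(clim_le (N := 0%N)) h; rewrite -nm_real rmorphB rmorphM; apply: h => N _.
by rewrite -rmorphM -rmorphB nm_real; exact: hVB.
Qed.

Lemma inv_moment_sum_even_chars (q k : nat) (s : seq (nat -> C)) : uniq s ->
  (forall chi, chi \in s <-> is_dchar q chi) ->
  inv_moment_sum R q k = \sum_(chi <- even_chars q s) nm ((Defs.Lfun chi 1)^-1 ^+ k) ^+ 2.
Proof.
move=> us hs; rewrite /inv_moment_sum.
have -> : even_nonprincipal_chars q = [set` even_chars q s]%classic.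
  apply/seteqP; split=> chi /=.
    by move=> [h1 [h2 h3]]; rewrite mem_filter h3 eqxx /=; apply/andP; split; [apply/eqP|apply/hs].
  by rewrite mem_filter => /andP[/andP[/eqP h1 /eqP h2] /hs h3].
rewrite -fsbig_seq; last by rewrite filter_uniq.
by apply: eq_bigr => chi _; rewrite exprVn nmV nmX exprVn -exprM mulnC.
Qed.

Lemma sqr_dist_le (x y : C) (B d : R) : nm x <= B -> nm (x - y) <= B * d -> 0 <= d <= 1 ->
  `|nm x ^+ 2 - nm y ^+ 2| <= 3 * B ^+ 2 * d.
Proof.
move=> hx hxy /andP[d0 d1]; have B0 : 0 <= B := le_trans (nm_ge0 _) hx.
have x0 := nm_ge0 x; have y0 := nm_ge0 y.
have h1 : `|nm x - nm y| <= B * d.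
  rewrite ler_norml; have := ler_nmB x y; have := ler_nmB y x; rewrite (nmBC y x).
  by move=> *; apply/andP; split; lra.
have h2 : nm x + nm y <= 3 * B.
  have := ler_nmB y x; rewrite (nmBC y x); have : B * d <= B by rewrite ler_piMr.
  by lra.
rewrite subr_sqr normrM [`|nm x + nm y|]ger0_norm ?addr_ge0 //.
have -> : 3 * B ^+ 2 * d = (B * d) * (3 * B) by ring.
by apply: ler_pM; rewrite ?addr_ge0.
Qed.

(** The first term on the right pays for replacing L(1, chi)^{-k} by J Taylor terms at each of at
    most phi(q) characters; the rest comes from [even_chars_square_sum]. *)
Lemma moment_estimate (q k J : nat) (W eta G del : R) : GRH R -> (2 < q)%N -> 0 < eta ->
  (forall n, `|vJ q k J n| <= W * powR n%:R (- (1 + eta))) ->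
  (forall N, `|\sum_(n < N) vJ q k J n ^+ 2 - \sum_(n < N) diag_term R q k n| <= del) ->
  ((fun N => \sum_(n < N) diag_term R q k n) @ \oo --> G)%classic ->
  `|inv_moment_sum R q k - (totient q)%:R / 2 * G| <=
  (totient q)%:R * (3 * (invL_bound R q ^+ k) ^+ 2 * (16 / 17) ^+ J) +
  ((totient q)%:R / 2 * (8 * (W * (1 + eta^-1)) ^+ 2 / q%:R + del) + (W * (1 + eta^-1)) ^+ 2).
Proof.
move=> HG q2 e0 hW hdel hG; have q1 : (1 < q)%N by exact: ltnW.
have q0 : (0 < q)%N by exact: ltnW.
have [s us hs] := dchar_finite R q1.
rewrite (inv_moment_sum_even_chars k us hs).
have h1 := even_chars_square_sum q2 us hs e0 (@vJ_coprime q k J) hW hdel hG.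
set A := \sum_(chi <- _) _; set A' := \sum_(chi <- even_chars q s) _ in h1.
rewrite (_ : A - _ = (A - A') + (A' - (totient q)%:R / 2 * G)); last by ring.
apply: le_trans (ler_normD _ _) _; apply: lerD h1.
set E := 3 * _ * _.
have E0 : 0 <= E by apply: mulr_ge0; [apply: mulr_ge0 => //; exact: sqr_ge0|exact: exprn_ge0].
rewrite -sumrB; apply: le_trans (ler_norm_sum _ _ _) _.
apply: (@le_trans _ _ (\sum_(chi <- even_chars q s) E)); last first.
  rewrite big_const_seq count_predT iter_addr_0 -[_ *+ _]mulr_natl; apply: ler_wpM2r => //; rewrite ler_nat.
  by rewrite -(size_dchar q1 us hs) size_filter count_size.
rewrite !big_seq; apply: ler_sum => chi; rewrite mem_filter => /andP[/andP[_ /eqP hne] /hs hc].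
have -> : ssum (fun n => (vJ q k J n)%:C * chi n) = \sum_(j < J) T (mukchi chi k) j.
  have [-> _] := sum_T_mukchi q0 hc k J; apply: eq_ssum => n; rewrite /vJ /mukchi.
  case: (boolP (coprime n q)) => cn; last by rewrite (dchar_eq0 hc cn) !mulr0 mul0r.
  by rewrite rmorphM /=; ring.
have hX := Lfun_inv_truncation HG q0 hc hne k.
apply: sqr_dist_le; last by rewrite exprn_ge0 //= exprn_ile1 //; lra.
  (* Truncation to no terms at all bounds the value itself. *)
  by have := hX 0%N; rewrite big_ord0 subr0 expr0 mulr1.
exact: hX.
Qed.

End MomentEstimate.

(** * Conclusion *)

Section TruncationLength.
Variable R : realType.

(** Repeated squaring, rounded up to small fractions at each stage. *)
Lemma pow_16_17_le : (16 / 17 : R) ^+ 16 <= 2^-1.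
Proof.
have sq (x y : R) n : 0 <= x -> x ^+ n <= y -> x ^+ (n * 2) <= y ^+ 2.
  by move=> x0 h; rewrite exprM lerXn2r ?nnegrE ?exprn_ge0 // (le_trans _ h) ?exprn_ge0.
have x0 : (0 : R) <= 16 / 17 by [].
have h2 : (16 / 17 : R) ^+ 2 <= 8 / 9 by rewrite expr2; lra.
have h4 : (16 / 17 : R) ^+ 4 <= 4 / 5 by apply: le_trans (sq _ _ _ x0 h2) _; rewrite expr2; lra.
have h8 : (16 / 17 : R) ^+ 8 <= 2 / 3 by apply: le_trans (sq _ _ _ x0 h4) _; rewrite expr2; lra.
by apply: le_trans (sq _ _ _ x0 h8) _; rewrite expr2; lra.
Qed.

Lemma affine_power_le (x y : R) n : 36 <= x ^+ 6 -> 0 <= y <= x ^+ 9 ->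
  0 <= 36 * y ^+ n <= x ^+ (6 + 9 * n).
Proof.
move=> h36 /andP[y0 hy]; rewrite mulr_ge0 ?exprn_ge0 //= exprD exprM.
apply: ler_pM => //; first exact: exprn_ge0.
by apply: lerXn2r; rewrite // nnegrE // (le_trans y0).
Qed.

(** Sixteen more Taylor terms at least halve the error, so 16 A L of them compensate 2^{A L}, which
    dominates the power of q lost in [invL_bound]. *)
Lemma truncation_length (k : nat) : exists2 A : nat, (0 < A)%N & forall q L : nat, (0 < q)%N ->
  (q <= 2 ^ L)%N -> (0 < L)%N ->
  q%:R * (invL_bound R q ^+ k) ^+ 2 * (16 / 17) ^+ (16 * (A * L)) <= 1 /\
  q%:R * (4 / 5) ^+ (16 * (A * L)) <= 1 :> R.
Proof.
(* With x = 2^L one has 36 <= x^6 and 154 q <= x^9, so [invL_bound] is at most x^a. The exponent 2 k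
   comes from the squared k-th power, and one more x covers the factor q. *)
pose a := (6 + 9 * 180)%N; exists (1 + a * (k * 2))%N => // q L q0 qL L0.
set A := (1 + _)%N; pose x : R := 2 ^+ L.
have x2 : 2 <= x by rewrite /x -{1}[2]expr1; apply: ler_weXn2l => //; lra.
have x1 : 1 <= x by lra.
have x0 : 0 < x by lra.
have qx : q%:R <= x by rewrite /x -natrX ler_nat.
have h36 : 36 <= x ^+ 6.
  by apply: (@le_trans _ _ (2 ^+ 6)); [rewrite -natrX ler_nat|rewrite lerXn2r ?nnegrE // ltW].
have h154 : 154 * q%:R <= x ^+ 9.
  rewrite exprSr; apply: ler_pM => //.
  by apply: (@le_trans _ _ (2 ^+ 8)); [rewrite -natrX ler_nat|rewrite lerXn2r ?nnegrE // ltW].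
have p154 : 0 <= 154 * q%:R :> R by apply: mulr_ge0.
have hy : 0 <= (154 * q%:R : R) <= x ^+ 9 by apply/andP; split.
have /andP[B0 hB] : 0 <= invL_bound R q <= x ^+ a := affine_power_le 180 h36 hy.
have hxA : x * (x ^+ a ^+ k) ^+ 2 = x ^+ A by rewrite /A exprD expr1 -!exprM mulnA.
have hJ : x ^+ A * (16 / 17) ^+ (16 * (A * L)) <= 1.
  have -> : x ^+ A = 2 ^+ (A * L) by rewrite [(A * L)%N]mulnC exprM.
  rewrite [(16 / 17) ^+ _]exprM -exprMn.
  apply: exprn_ile1; first by apply: mulr_ge0 => //; exact: exprn_ge0.
  by have := pow_16_17_le; lra.
have J0 : 0 <= (16 / 17 : R) ^+ (16 * (A * L)) by exact: exprn_ge0.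
split.
  apply: le_trans hJ; apply: ler_wpM2r => //; rewrite -hxA.
  apply: ler_pM => //; first by apply: exprn_ge0; exact: exprn_ge0.
  have hBk : invL_bound R q ^+ k <= x ^+ a ^+ k.
    by apply: lerXn2r => //; rewrite nnegrE (le_trans B0).
  by apply: lerXn2r => //; rewrite nnegrE ?exprn_ge0 // (le_trans B0).
apply: le_trans hJ; apply: ler_pM; rewrite ?exprn_ge0 //.
  by apply: le_trans qx _; rewrite -[X in X <= _]expr1; apply: ler_weXn2l => //; rewrite /A leq_addr.
by apply: lerXn2r; rewrite ?nnegrE //; lra.
Qed.

End TruncationLength.

Local Close Scope complex_scope.

Lemma moment_asymptotics (R : realType) (k : nat) (eps : R) : GRH R -> (0 < k)%N -> 0 < eps ->
  exists2 K : R, 0 < K & forall q : nat, (2 < q)%N ->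
    exists2 M : R, 0 < M /\ main_term R q k = M &
      `|inv_moment_sum R q k - M| <= K * powR q%:R (eps - 1) * M.
Proof.
move=> HG k0 eps0; have [A A0 hA] := truncation_length R k.
(* Two shares of [e] pay for [Q ^+ 2], the third for comparing q with its totient. *)
pose e := eps / 3; have e0 : 0 < e by rewrite /e; lra.
(* With J = 16 A L this makes rho^{-J} equal to 2^{e L}, which is at most (2 q)^e. *)
pose a : R := e / (16 * A)%:R; have a0 : 0 < a by rewrite divr_gt0 // ltr0n muln_gt0.
pose rho : R := powR 2 (- a).
have rho0 : 0 < rho by exact: powR_gt0.
have rhoV : rho^-1 = powR 2 a by rewrite /rho powRN invrK.
have r1 : 1 < powR 2 a.
  by have := @gt0_ltr_powR R a a0 1 2; rewrite !nnegrE powR1 => -> //; lra.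
have rho1 : rho < 1 by rewrite -[rho]invrK rhoV invf_lt1 //; lra.
have [D1 D10 hD1] : exists2 D : R, 0 < D & forall q J n,
    `|vJ R q k J n| <= D * rho^-1 ^+ J * powR n%:R (- (1 + (1 - rho) / 2)).
  by apply: vJ_bound; rewrite rho0.
have [D2 D20 hD2] := diag_truncation R k.
have [D3 D30 hD3] := totient_ge e0.
pose eta := (1 - rho) / 2; have eta0 : 0 < eta by rewrite /eta; lra.
pose c := 1 + eta^-1; have c0 : 0 < c by rewrite ltr_pwDl // invr_ge0 ltW.
(* 3 covers the Taylor truncation, 5 = 4 + 1 the off-diagonal pairs and the principal character,
   [D2] the truncation of the diagonal. *)
pose K1 := 3 + 5 * (D1 * c) ^+ 2 + D2.
have K10 : 0 < K1 by have := sqr_ge0 (D1 * c); rewrite /K1; lra.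
pose t : R := powR 2 e; have t0 : 0 < t by exact: powR_gt0.
exists (2 * D3 * K1 * t ^+ 2); first by rewrite !mulr_gt0 // exprn_gt0.
move=> q q2; have q0 : (0 < q)%N by apply: leq_trans q2.
have qR : 0 < q%:R :> R by rewrite ltr0n.
have [G [G1 hG GE]] := diag_sum R q0 k0.
have phi0 : 0 < (totient q)%:R :> R by rewrite ltr0n totient_gt0.
have phiq : (totient q)%:R <= q%:R :> R.
  rewrite ler_nat totient_count_coprime -[leqRHS]subn0 -[leqRHS]muln1 -sum_nat_const_nat.
  by apply: leq_sum => i _; exact: leq_b1.
exists ((totient q)%:R / 2 * G).
  split; first by rewrite mulr_gt0 ?divr_gt0 //; lra.
  by rewrite /main_term GE; ring.
pose L := (trunc_log 2 q).+1; pose J := (16 * (A * L))%N.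
have hq1 : (q <= 2 ^ L)%N by apply: ltnW; exact: trunc_log_ltn.
have hq2 : (2 ^ L <= 2 * q)%N by rewrite expnS leq_mul2l /= trunc_logP.
pose y : R := powR q%:R e; have y0 : 0 < y by exact: powR_gt0.
pose Q := rho^-1 ^+ J.
have Q1 : 1 <= Q by apply: exprn_ege1; rewrite rhoV ltW.
have hQ : Q <= t * y.
  have -> : Q = powR (2 ^ L)%N%:R e.
    rewrite /Q rhoV -powR_mulrn ?powR_ge0 // -powRrM natrX -powR_mulrn // -powRrM.
    congr (powR 2 _); rewrite /a /J !natrM; field.
    by rewrite pnatr_eq0 -lt0n A0.
  rewrite /t /y -powRM //; apply: ge0_ler_powR; rewrite ?nnegrE ?(ltW e0) //.
  by rewrite -natrM ler_nat.
have [hA1 hA2] := hA q L q0 hq1 isT; rewrite -/J in hA1 hA2.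
have est := moment_estimate HG q2 eta0 (hD1 q J) (hD2 q J) hG.
apply: le_trans est _; rewrite -/Q -/c.
set B2 := (_ ^+ k) ^+ 2 in hA1 *.
have p45 : 0 <= (4 / 5 : R) ^+ J by exact: exprn_ge0.
have b1 : (totient q)%:R * (3 * B2 * (16 / 17) ^+ J) <= 3.
  apply: (@le_trans _ _ (3 * (q%:R * B2 * (16 / 17) ^+ J))); last by lra.
  rewrite (_ : 3 * (q%:R * _ * _) = q%:R * (3 * B2 * (16 / 17) ^+ J)); last by ring.
  apply: ler_wpM2r => //; apply: mulr_ge0; last exact: exprn_ge0.
  by apply: mulr_ge0 => //; exact: sqr_ge0.
have b2 : (totient q)%:R / 2 * (8 * (D1 * Q * c) ^+ 2 / q%:R) <= 4 * (D1 * c) ^+ 2 * Q ^+ 2.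
  have -> : (totient q)%:R / 2 * (8 * (D1 * Q * c) ^+ 2 / q%:R) =
      4 * (D1 * c) ^+ 2 * Q ^+ 2 * ((totient q)%:R / q%:R) by field; lra.
  rewrite ler_piMr ?ler_pdivrMr ?mul1r //.
  by apply: mulr_ge0; [apply: mulr_ge0|]; rewrite ?sqr_ge0.
have b3 : (totient q)%:R / 2 * (D2 * (4 / 5) ^+ J) <= D2.
  have h : (totient q)%:R * (4 / 5) ^+ J <= 1 :> R by apply: le_trans hA2; exact: ler_wpM2r.
  have := ler_wpM2l (ltW D20) h; rewrite mulr1 => h'.
  have -> : (totient q)%:R / 2 * (D2 * (4 / 5) ^+ J) = D2 * ((totient q)%:R * (4 / 5) ^+ J) / 2 by field.
  lra.
have Q2 : 1 <= Q ^+ 2 by apply: exprn_ege1.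
have b4 : (totient q)%:R * (3 * B2 * (16 / 17) ^+ J) +
    ((totient q)%:R / 2 * (8 * (D1 * Q * c) ^+ 2 / q%:R + D2 * (4 / 5) ^+ J) + (D1 * Q * c) ^+ 2) <=
    K1 * Q ^+ 2.
  have h1 : 3 <= 3 * Q ^+ 2 by lra.
  have h2 : D2 <= D2 * Q ^+ 2 by rewrite ler_peMr // ltW.
  have h3 : (D1 * Q * c) ^+ 2 = (D1 * c) ^+ 2 * Q ^+ 2 by ring.
  rewrite mulrDr; apply: le_trans (lerD b1 (lerD (lerD b2 b3) (lexx _))) _; rewrite h3.
  rewrite (_ : K1 * Q ^+ 2 = 3 * Q ^+ 2 + (4 * (D1 * c) ^+ 2 * Q ^+ 2 + D2 * Q ^+ 2 + (D1 * c) ^+ 2 * Q ^+ 2)).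
    by rewrite lerD // lerD2r lerD2l.
  by rewrite /K1; ring.
apply: le_trans b4 _.
have yq : powR q%:R (eps - 1) = y ^+ 3 / q%:R.
  rewrite powRB ?powRr1 //; last by rewrite (gt_eqF qR) implybT.
  by rewrite /y -powR_mulrn ?powR_ge0 // -powRrM; congr (powR _ _ / _); rewrite /e; field.
have hphi : q%:R <= D3 * y * (totient q)%:R := hD3 q q0.
apply: (@le_trans _ _ (K1 * (t * y) ^+ 2)).
  apply: ler_wpM2l; first exact: ltW.
  by apply: lerXn2r => //; rewrite nnegrE ?mulr_ge0 // ?(ltW t0) ?(ltW y0) //; lra.
rewrite yq; apply: (@le_trans _ _ (2 * D3 * K1 * t ^+ 2 * (y ^+ 3 / q%:R) * ((totient q)%:R / 2))).
  have -> : 2 * D3 * K1 * t ^+ 2 * (y ^+ 3 / q%:R) * ((totient q)%:R / 2) =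
      K1 * (t * y) ^+ 2 * (D3 * y * (totient q)%:R / q%:R) by field; lra.
  rewrite ler_peMr ?ler_pdivlMr ?mul1r //.
  by rewrite mulr_ge0 ?sqr_ge0 ?ltW.
apply: ler_wpM2l; last by rewrite ler_peMr // divr_ge0.
by rewrite !mulr_ge0 ?invr_ge0 ?exprn_ge0 ?(ltW D30) ?(ltW K10) ?(ltW t0) ?(ltW y0).
Qed.

Lemma inv_moment_sum2 (R : realType) k : inv_moment_sum R 2 k = 0.
Proof.
rewrite /inv_moment_sum (_ : even_nonprincipal_chars 2 = set0) ?fsbig_set0 //.
apply/seteqP; split=> // chi [hc [hne _]]; apply: hne; apply/funext => n.
rewrite /principal_char; case: (boolP (coprime n 2)) => cn; last by rewrite (dchar_eq0 hc cn).
rewrite -(dchar1 hc); apply: (dchar_eqmod hc).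
by move: cn; rewrite coprimen2 modn2 => ->.
Qed.

Theorem theorem5p1 (R : realType) : GRH R ->
  forall (k : nat), (0 < k)%N ->
  forall eps : R, 0 < eps ->
  exists K : R, 0 < K /\
    forall q : nat, (2 <= q)%N ->
      exists E : R,
        inv_moment_sum R q k = main_term R q k * (1 + E) /\
        `|E| <= K * powR (q%:R) (eps - 1).
Proof.
move=> HG k k0 eps eps0; have [K K0 hK] := moment_asymptotics HG k0 eps0.
(* The extra 2 is for q = 2, where the moment is an empty sum: the relative error is -1, while
   2^{eps-1} >= 1/2. *)
exists (K + 2); split; first by lra.
move=> q; rewrite leq_eqVlt => /orP[/eqP <-|q2].
  exists (-1); rewrite subrr mulr0 inv_moment_sum2; split=> //.
  have h : 2^-1 <= powR 2 (eps - 1) :> R.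
    by rewrite -powR_inv1 //; apply: ler_powR; [rewrite ler1n|lra].
  rewrite normrN1; have := ler_wpM2l (ltW K0) h; lra.
have [M [M0 hM] h] := hK q q2; rewrite hM.
exists ((inv_moment_sum R q k - M) / M); split; first by field; lra.
rewrite normrM normfV (gtr0_norm M0) ler_pdivrMr //; apply: le_trans h _.
by apply: ler_wpM2r; [exact: ltW|apply: ler_wpM2r; [exact: powR_ge0|lra]].
Qed.
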